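(* Let $\hat{\mathfrak g}$ be the universal central extension of $\mathfrak g=\mathfrak{psl}(2|2)$ with center $Z$, and let $\chi\in Z^*$ be typical and semisimple. Then the category $\hat{\mathfrak g}\text{-mod}_1^{\,\chi}$ is a direct sum of two blocks, and each block is equivalent to the category of finite-dimensional modules over the polynomial algebra $\mathbb C[x,y,t]$ with nilpotent action of $x,y,t$.
   Context: All spaces are over $\mathbb C$; modules are finite-dimensional and $\mathbb Z_2$-graded, morphisms are parity-preserving; $M^{op}$ is $M$ with shifted parity. $\mathfrak{psl}(2|2)$ is $\mathfrak{sl}(2|2)$ modulo scalar matrices; $E_{ij}$ are matrix units of $\mathfrak{gl}(2|2)$ (indices $1,2$ even, $3,4$ odd). The center $Z$ of $\hat{\mathfrak g}$ is purely even and 3-dimensional, so $\hat{\mathfrak g}_{\bar1}=\mathfrak g_{\bar1}$; a basis of $Z$ is $z_1=[E_{13},E_{24}]$, $z_{-1}=[E_{31},E_{42}]$ and $\mathbf 1=[E_{13},E_{31}]+[E_{24},E_{42}]$ (brackets in $\hat{\mathfrak g}$; in $\mathfrak{sl}(2|2)$ the element $\mathbf 1$ becomes the identity matrix). For $\chi\in Z^*$ put $D(\chi)=\chi(\mathbf 1)^2-4\chi(z_1)\chi(z_{-1})$, which is invariant under the action of $SL(2)$ on $\hat{\mathfrak g}$ by automorphisms; $\chi$ is semisimple if $D(\chi)\neq0$ (equivalently, it is $SL(2)$-conjugate to a nonzero $\chi'$ with $\chi'(z_{\pm1})=0$). The short $\mathfrak{sl}_2$-subalgebra of $\mathfrak g$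 is spanned by $h=\frac12(E_{11}-E_{22}+E_{33}-E_{44})$, $E_{12}+E_{34}$, $E_{21}+E_{43}$; it lifts to $\hat{\mathfrak g}$. $\hat{\mathfrak g}\text{-mod}_1$ is the category of finite-dimensional $\hat{\mathfrak g}$-modules on which $h$ has eigenvalues in $\{-1,0,1\}$, and $\hat{\mathfrak g}\text{-mod}_1^{\,\chi}$ is the full subcategory of modules on which $z-\chi(z)$ acts nilpotently for all $z\in Z$. $\chi$ is called typical if $\hat{\mathfrak g}\text{-mod}_1^{\,\chi}$ has exactly two simple objects up to isomorphism (exchanged by parity change); this holds exactly when $\chi\neq0$ and $D(\chi)\ne4$. A block is an indecomposable direct summand of the category. *)

(* Defs.v *)
From HB Require Import structures.
From mathcomp Require Import all_boot all_order all_algebra.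
From mathcomp Require Import boolp.
From mathcomp Require Import reals complex.
From mathcomp Require Import ring.
From mathcomp Require Import -(notations) mpoly.

Set Implicit Arguments.
Unset Strict Implicit.
Unset Printing Implicit Defensive.

Import GRing.Theory.
Local Open Scope ring_scope.

(* [false] is the even degree and [true] the odd one; [homog b] is the
   component of degree [b]. *)
Record grading (K : fieldType) (V : lmodType K) := Grading {
  homog : bool -> V -> Prop;
  homog0 : forall b, homog b 0;
  homogP : forall b a x y, homog b x -> homog b y -> homog b (a *: x + y);
  homog_dec : forall x, exists x0 x1,
    [/\ homog false x0, homog true x1 & x = x0 + x1];
  homog_disj : forall x, homog false x -> homog true x -> x = 0 }.

Section GradingTheory.
Variables (K : fieldType) (V : lmodType K) (s : grading V).

Lemma homogD b x y : homog s b x -> homog s b y -> homog s b (x + y).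
Proof. by move=> hx hy; rewrite -[x]scale1r; apply: homogP. Qed.

Lemma homogZ b a x : homog s b x -> homog s b (a *: x).
Proof. by move=> hx; rewrite -[_ *: _]addr0; apply: homogP => //; apply: homog0. Qed.

Lemma homogN b x : homog s b x -> homog s b (- x).
Proof. by move=> hx; rewrite -scaleN1r; apply: homogZ. Qed.

End GradingTheory.

Definition ssign (K : fieldType) (a b : bool) : K := (-1) ^+ (a && b).

Record lieSuper (K : fieldType) (L : lmodType K) := LieSuper {
  lgrading :> grading L;
  br : L -> L -> L;
  br_linl : forall y, linear (br^~ y);
  br_linr : forall x, linear (br x);
  br_homog : forall a b x y, homog lgrading a x -> homog lgrading b y ->
    homog lgrading (a (+) b) (br x y);
  br_anti : forall a b x y, homog lgrading a x -> homog lgrading b y ->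
    br x y = - (ssign K a b *: br y x);
  br_jacobi : forall a b x y z, homog lgrading a x -> homog lgrading b y ->
    br x (br y z) = br (br x y) z + ssign K a b *: br y (br x z) }.

Section BrLinear.
Variables (K : fieldType) (L : lmodType K) (s : lieSuper L).
HB.instance Definition _ x := GRing.isLinear.Build K L L _ (br s x) (br_linr s x).

Lemma brPl y a x x' : br s (a *: x + x') y = a *: br s x y + br s x' y.
Proof. exact: br_linl. Qed.
Lemma brDl x y z : br s (x + y) z = br s x z + br s y z.
Proof. by have := br_linl s z 1 x y; rewrite !scale1r. Qed.
Lemma br0l z : br s 0 z = 0.
Proof. by have := brDl 0 0 z; rewrite addr0 => /eqP; rewrite eq_sym -subr_eq0 addrK => /eqP. Qed.
Lemma brNl x z : br s (- x) z = - br s x z.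
Proof. by apply/eqP; rewrite -addr_eq0 -brDl addNr br0l. Qed.
End BrLinear.

Definition lie_hom (K : fieldType) (L M : lmodType K)
    (sL : lieSuper L) (sM : lieSuper M) (f : {linear L -> M}) : Prop :=
  (forall b x, homog sL b x -> homog sM b (f x)) /\
  (forall x y, f (br sL x y) = br sM (f x) (f y)).

Definition central_extension (K : fieldType) (E G : lmodType K)
    (sE : lieSuper E) (sG : lieSuper G) (p : {linear E -> G}) : Prop :=
  [/\ lie_hom sE sG p, (forall y, exists x, p x = y)
    & forall z, p z = 0 -> forall x, br sE z x = 0].

(* The competing extensions [E] are arbitrary, possibly infinite-dimensional. *)
Definition universal_central_extension (K : fieldType) (L G : lmodType K)
    (sL : lieSuper L) (sG : lieSuper G) (p : {linear L -> G}) : Prop :=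
  central_extension sL sG p /\
  forall (E : lmodType K) (sE : lieSuper E) (q : {linear E -> G}),
    central_extension sE sG q ->
    exists f : {linear L -> E},
      [/\ lie_hom sL sE f, (forall x, q (f x) = p x)
        & forall f' : {linear L -> E},
            lie_hom sL sE f' -> (forall x, q (f' x) = p x) -> f' =1 f].

Section SubAlgebra.
Variables (K : fieldType) (L : vectType K) (s : lieSuper L) (U : {vspace L}).
Hypothesis brU : forall x y, x \in U -> y \in U -> br s x y \in U.
Hypothesis grU : forall x0 x1, homog s false x0 -> homog s true x1 ->
  x0 + x1 \in U -> x0 \in U /\ x1 \in U.

Definition sub_homog b (x : subvs_of U) : Prop := homog s b (vsval x).

Fact sub_homog_dec x : exists x0 x1,
  [/\ sub_homog false x0, sub_homog true x1 & x = x0 + x1].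
Proof.
have [x0 [x1 [h0 h1 e]]] := homog_dec s (vsval x).
have [|u0 u1] := grU h0 h1; first by rewrite -e subvsP.
exists (vsproj U x0), (vsproj U x1); rewrite /sub_homog !vsprojK //; split=> //.
by apply: val_inj; rewrite /= !vsprojK.
Qed.

Definition sub_grading : grading (subvs_of U).
Proof.
refine (@Grading K (subvs_of U) sub_homog _ _ sub_homog_dec _).
- by move=> b; apply: homog0.
- by move=> b a x y; apply: homogP.
- by move=> x h0 h1; apply: val_inj; apply: homog_disj h0 h1.
Defined.

Definition sub_br (x y : subvs_of U) : subvs_of U :=
  vsproj U (br s (vsval x) (vsval y)).

Lemma val_sub_br x y : vsval (sub_br x y) = br s (vsval x) (vsval y).
Proof. by rewrite vsprojK // brU ?subvsP. Qed.

Definition sub_lie : lieSuper (subvs_of U).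
Proof.
refine (@LieSuper K (subvs_of U) sub_grading sub_br _ _ _ _ _).
- by move=> y a x x'; rewrite /= /sub_br linearP brPl linearP.
- by move=> x a y y'; rewrite /= /sub_br !linearP.
- by move=> a b x y; rewrite /= /sub_homog val_sub_br; apply: br_homog.
- by move=> a b x y hx hy; apply: val_inj; rewrite linearN linearZ /= !val_sub_br
    scalerN; apply: br_anti.
- by move=> a b x y z hx hy; apply: val_inj; rewrite linearD linearZ /= !val_sub_br;
    apply: br_jacobi.
Defined.
End SubAlgebra.

(* The underlying space of [L / I] is a complement of [I]. *)
Section Quotient.
Variables (K : fieldType) (L : vectType K) (s : lieSuper L) (I : {vspace L}).
Hypothesis brI : forall x y, y \in I -> br s x y \in I.
Hypothesis brI' : forall x y, x \in I -> br s x y \in I.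
Hypothesis grI : forall x0 x1, homog s false x0 -> homog s true x1 ->
  x0 + x1 \in I -> x0 \in I /\ x1 \in I.

Definition quo : vectType K := subvs_of (I^C)%VS.

Definition quo_pi (x : L) : quo := vsproj (I^C)%VS (x - projv I x).

Fact quo_pi_linear : linear quo_pi.
Proof.
move=> a x y; rewrite /quo_pi -linearP; congr (vsproj _ _).
by rewrite linearP scalerBr opprD addrACA.
Qed.
HB.instance Definition _ := GRing.isLinear.Build K L quo _ quo_pi quo_pi_linear.

Lemma quo_piK y : quo_pi (vsval y) = y.
Proof.
apply: val_inj; rewrite /= vsprojK ?memv_projC //.
have yC := subvsP y; suff -> : projv I (vsval y) = 0 by rewrite subr0.
apply/eqP; rewrite -memv0 -(capv_compl I) memv_cap memv_proj /=.
by rewrite -(subKr (vsval y) (projv I _)) rpredB // memv_projC.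
Qed.

Lemma quo_pi_eq0 x : quo_pi x = 0 <-> x \in I.
Proof.
split=> [/(congr1 val)|xI]; last by rewrite /quo_pi projv_id // subrr linear0.
rewrite /= vsprojK ?memv_projC // => /eqP; rewrite subr_eq0 => /eqP ->.
exact: memv_proj.
Qed.

Definition quo_homog b (y : quo) : Prop := exists2 x, homog s b x & quo_pi x = y.

Definition quo_grading : grading quo.
Proof.
refine (@Grading K quo quo_homog _ _ _ _).
- by move=> b; exists 0; [apply: homog0 | rewrite linear0].
- move=> b a _ _ [x hx <-] [y hy <-]; exists (a *: x + y); first exact: homogP.
  by rewrite linearP.
- move=> y; have [x0 [x1 [h0 h1 e]]] := homog_dec s (vsval y).
  exists (quo_pi x0), (quo_pi x1); split; [by exists x0 | by exists x1 |].
  by rewrite -linearD -e /= quo_piK.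
- move=> _ [x hx <-] [y hy e]; apply/quo_pi_eq0.
  have [|//] := @grI x (- y) hx (homogN hy).
  by apply/quo_pi_eq0; rewrite linearB /= e subrr.
Defined.

Definition quo_br (y y' : quo) : quo := quo_pi (br s (vsval y) (vsval y')).

Lemma quo_pi_br x x' : quo_pi (br s x x') = quo_br (quo_pi x) (quo_pi x').
Proof.
have dec u : exists2 v, v \in I & u = v + vsval (quo_pi u).
  exists (projv I u); first exact: memv_proj.
  by rewrite /= vsprojK ?memv_projC // addrC subrK.
rewrite /quo_br; have [v vI e] := dec x; have [v' vI' e'] := dec x'.
rewrite [in LHS]e brDl linearD /= [quo_pi (br s v _)](iffRL (quo_pi_eq0 _)) ?brI' //.
rewrite add0r [in LHS]e' linearD linearD /=.
by rewrite [quo_pi (br s _ v')](iffRL (quo_pi_eq0 _)) ?brI // add0r.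
Qed.

Definition quo_lie : lieSuper quo.
Proof.
refine (@LieSuper K quo quo_grading quo_br _ _ _ _ _).
- by move=> y a x x'; rewrite /= /quo_br linearP brPl linearP.
- by move=> x a y y'; rewrite /= /quo_br !linearP.
- move=> a b _ _ [x hx <-] [y hy <-]; rewrite -quo_pi_br.
  by exists (br s x y) => //; apply: br_homog.
- move=> a b _ _ [x hx <-] [y hy <-]; rewrite -!quo_pi_br (br_anti hx hy).
  by rewrite linearN linearZ.
- move=> a b _ _ z [x hx <-] [y hy <-]; rewrite -[z]quo_piK -!quo_pi_br.
  by rewrite (br_jacobi _ hx hy) linearD linearZ.
Defined.
End Quotient.

Section PSL.
Variable K : fieldType.

(* The usual indices 1, 2 (even) and 3, 4 (odd) are 0, 1 and 2, 3 in ['I_4]. *)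
Definition ipar (i : 'I_4) : bool := (2 <= i)%N.

Definition gl_comp (b : bool) (A : 'M[K]_4) : 'M[K]_4 :=
  \matrix_(i, j) (if ipar i (+) ipar j == b then A i j else 0).

Definition gl_homog (b : bool) (A : 'M[K]_4) : Prop := gl_comp b A = A.

Fact gl_comp_linear b : linear (gl_comp b).
Proof.
move=> a A B; apply/matrixP=> i j; rewrite !mxE.
by case: ifP => //; rewrite mulr0 addr0.
Qed.
HB.instance Definition _ b :=
  GRing.isLinear.Build K 'M[K]_4 'M[K]_4 _ (gl_comp b) (gl_comp_linear b).

Lemma gl_comp_sum A : gl_comp false A + gl_comp true A = A.
Proof. by apply/matrixP=> i j; rewrite !mxE; case: (_ (+) _) => /=; rewrite ?addr0 ?add0r. Qed.

Lemma gl_comp_comp a b A :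
  gl_comp a (gl_comp b A) = if a == b then gl_comp b A else 0.
Proof.
apply/matrixP=> i j; case: a b => [] [] /=; rewrite !mxE;
by case: (ipar i (+) ipar j).
Qed.

Lemma gl_homogM a b A B : gl_homog a A -> gl_homog b B ->
  gl_homog (a (+) b) (A * B).
Proof.
move=> hA hB; apply/matrixP=> i j; rewrite mxE; case: eqP => // ne.
rewrite mxE big1 // => k _; rewrite -hA -hB !mxE.
case: eqP => ha; last by rewrite mul0r.
case: eqP => hb; last by rewrite mulr0.
by case: ne; rewrite -ha -hb addbA addbK.
Qed.

Definition gl_grading : grading 'M[K]_4.
Proof.
refine (@Grading K 'M[K]_4 gl_homog _ _ _ _).
- by move=> b; rewrite /gl_homog linear0.
- by move=> b a x y hx hy; rewrite /gl_homog linearP /= hx hy.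
- move=> x; exists (gl_comp false x), (gl_comp true x).
  by rewrite /gl_homog !gl_comp_comp gl_comp_sum.
- by move=> x h0 <-; rewrite -h0 gl_comp_comp.
Defined.

(* The bilinear extension of [A, B] = AB - (-1)^{|A||B|} BA. *)
Definition gl_br (A B : 'M[K]_4) : 'M[K]_4 :=
  \sum_(a : bool) \sum_(b : bool)
    (gl_comp a A * gl_comp b B - ssign K a b *: (gl_comp b B * gl_comp a A)).

Lemma gl_brE a b A B : gl_homog a A -> gl_homog b B ->
  gl_br A B = A * B - ssign K a b *: (B * A).
Proof.
move=> hA hB; rewrite /gl_br (bigD1 a) //= (bigD1 b) //= hA hB.
rewrite big1 ?addr0 => [|b' ne].
  rewrite big1 ?addr0 // => a' ne.
  rewrite big1 // => b' _; rewrite -hA gl_comp_comp (negbTE ne).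
  by rewrite mul0r mulr0 scaler0 subrr.
by rewrite -hB gl_comp_comp (negbTE ne) mul0r mulr0 scaler0 subrr.
Qed.

Fact gl_br_linl B : linear (gl_br^~ B).
Proof.
move=> c A A'; rewrite /gl_br scaler_sumr -big_split; apply: eq_bigr => a _.
rewrite scaler_sumr -big_split; apply: eq_bigr => b _ /=.
rewrite linearP /= mulrDl mulrDr -scalerAl -scalerAr scalerBr !scalerDr !scalerA.
by rewrite [c * _]mulrC opprD addrACA.
Qed.

Fact gl_br_linr A : linear (gl_br A).
Proof.
move=> c B B'; rewrite /gl_br scaler_sumr -big_split; apply: eq_bigr => a _.
rewrite scaler_sumr -big_split; apply: eq_bigr => b _ /=.
rewrite linearP /= mulrDl mulrDr -scalerAl -scalerAr scalerBr !scalerDr !scalerA.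
by rewrite [c * _]mulrC opprD addrACA.
Qed.

Lemma gl_br_homog a b A B : gl_homog a A -> gl_homog b B ->
  gl_homog (a (+) b) (gl_br A B).
Proof.
move=> hA hB; rewrite (gl_brE hA hB) /gl_homog linearB linearZ /=.
rewrite (gl_homogM hA hB) addbC; congr (_ - _ *: _); exact: gl_homogM.
Qed.

Lemma gl_dec A : exists A0 A1,
  [/\ gl_homog false A0, gl_homog true A1 & A = A0 + A1].
Proof. exact: (homog_dec gl_grading). Qed.

Fact gl_br_anti a b A B : gl_homog a A -> gl_homog b B ->
  gl_br A B = - (ssign K a b *: gl_br B A).
Proof.
move=> hA hB; rewrite (gl_brE hA hB) (gl_brE hB hA) scalerBr scalerA.
by rewrite /ssign andbC -expr2 sqrr_sign scale1r opprB.
Qed.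

Fact gl_br_jacobi a b x y z : gl_homog a x -> gl_homog b y ->
  gl_br x (gl_br y z) = gl_br (gl_br x y) z + ssign K a b *: gl_br y (gl_br x z).
Proof.
move=> hx hy.
have key c w : gl_homog c w ->
    gl_br x (gl_br y w) = gl_br (gl_br x y) w + ssign K a b *: gl_br y (gl_br x w).
  move=> hw.
  rewrite (gl_brE hx (gl_br_homog hy hw)) (gl_brE (gl_br_homog hx hy) hw).
  rewrite (gl_brE hy (gl_br_homog hx hw)) (gl_brE hx hy) (gl_brE hy hw) (gl_brE hx hw).
  rewrite !(mulrBl, mulrBr, scalerBr) -!(scalerAl, scalerAr) !scalerA !mulrA.
  move: (x * y * w) (x * w * y) (y * w * x) (w * y * x) (y * x * w) (w * x * y).
  move=> m1 m2 m3 m4 m5 m6; apply/matrixP=> i j; rewrite !mxE /ssign.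
  by case: a b c {hx hy hw} => [] [] [] /=; ring.
have [z0 [z1 [h0 h1 ->]]] := gl_dec z.
have lin u v w : gl_br u (v + w) = gl_br u v + gl_br u w.
  by have := gl_br_linr u 1 v w; rewrite !scale1r.
by rewrite !lin scalerDr (key _ _ h0) (key _ _ h1) addrACA.
Qed.

Definition gl_lie : lieSuper 'M[K]_4 :=
  @LieSuper K 'M[K]_4 gl_grading gl_br gl_br_linl gl_br_linr gl_br_homog
    gl_br_anti gl_br_jacobi.

Definition supertrace (A : 'M[K]_4) : K^o := \sum_i (-1) ^+ ipar i * A i i.

Fact supertrace_linear : linear supertrace.
Proof.
move=> a A B; rewrite /supertrace /GRing.scale /= mulr_sumr -big_split.
by apply: eq_bigr => i _ /=; rewrite !mxE; ring.
Qed.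
HB.instance Definition _ :=
  GRing.isLinear.Build K 'M[K]_4 K^o _ supertrace supertrace_linear.

Lemma supertrace_comp a b A B :
  supertrace (gl_comp a A * gl_comp b B) =
  ssign K a b * supertrace (gl_comp b B * gl_comp a A).
Proof.
rewrite /supertrace mulr_sumr.
under eq_bigr do rewrite mxE mulr_sumr.
under [RHS]eq_bigr do rewrite mxE !mulr_sumr.
rewrite exchange_big; apply: eq_bigr => i _; apply: eq_bigr => k _; rewrite !mxE.
rewrite [ipar i (+) ipar k]addbC /ssign.
by case: a b (ipar i) (ipar k) => [] [] [] [] /=; ring.
Qed.

Lemma supertrace_br A B : supertrace (gl_br A B) = 0.
Proof.
rewrite /gl_br linear_sum big1 // => a _; rewrite linear_sum big1 // => b _.
by rewrite linearB linearZ /= supertrace_comp subrr.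
Qed.

Definition sl22 : {vspace 'M[K]_4} := lker (linfun supertrace).

Lemma sl22P A : (A \in sl22) = (supertrace A == 0).
Proof. by rewrite memv_ker lfunE. Qed.

Fact sl22_br A B : A \in sl22 -> B \in sl22 -> br gl_lie A B \in sl22.
Proof. by move=> _ _; rewrite sl22P supertrace_br. Qed.

Fact sl22_graded A0 A1 : homog gl_lie false A0 -> homog gl_lie true A1 ->
  A0 + A1 \in sl22 -> A0 \in sl22 /\ A1 \in sl22.
Proof.
move=> _ h1; suff s1 : supertrace A1 = 0.
  by rewrite !sl22P linearD /= s1 addr0 eqxx.
by rewrite /supertrace big1 // => i _; rewrite -h1 mxE addbb mulr0.
Qed.

Definition sl_lie : lieSuper (subvs_of sl22) := sub_lie sl22_br sl22_graded.

Lemma sl22_1 : 1%:M \in sl22.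
Proof.
by rewrite sl22P /supertrace !big_ord_recr big_ord0 /= !mxE /=; apply/eqP; ring.
Qed.

Definition scalars : {vspace subvs_of sl22} := <[vsproj sl22 1%:M]>%VS.

Lemma gl_homog1 c : gl_homog false (c%:M).
Proof.
apply/matrixP=> i j; rewrite !mxE; case: (eqVneq i j) => [->|]; first by rewrite addbb.
by case: ifP.
Qed.

Lemma scalarsP x : reflect (exists c, vsval x = c%:M) (x \in scalars).
Proof.
apply: (iffP (vlineP _ _)) => [[c ->]|[c e]]; exists c.
  by rewrite linearZ /= vsprojK ?sl22_1 // scalemx1.
by apply: val_inj; rewrite linearZ /= vsprojK ?sl22_1 // scalemx1.
Qed.

Lemma gl_scalarC (c : K) (A : 'M[K]_4) : A * c%:M = c%:M * A.
Proof. exact: scalar_mxC. Qed.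

Fact scalars_brl x y : x \in scalars -> br sl_lie x y \in scalars.
Proof.
case/scalarsP=> c e; apply/scalarsP; exists 0.
rewrite (val_sub_br sl22_br) e /=.
have [y0 [y1 [h0 h1 ->]]] := gl_dec (vsval y).
have := gl_br_linr c%:M 1 y0 y1; rewrite !scale1r => ->.
rewrite (gl_brE (gl_homog1 c) h0) (gl_brE (gl_homog1 c) h1).
by rewrite /ssign !scale1r !(gl_scalarC c) !subrr addr0 raddf0.
Qed.

Fact scalars_brr x y : y \in scalars -> br sl_lie x y \in scalars.
Proof.
case/scalarsP=> c e; apply/scalarsP; exists 0.
rewrite (val_sub_br sl22_br) e /=.
have [y0 [y1 [h0 h1 ->]]] := gl_dec (vsval x).
have := gl_br_linl c%:M 1 y0 y1; rewrite /= !scale1r => ->.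
rewrite (gl_brE h0 (gl_homog1 c)) (gl_brE h1 (gl_homog1 c)).
by rewrite /ssign !scale1r !(gl_scalarC c) !subrr addr0 raddf0.
Qed.

Fact scalars_graded x0 x1 : homog sl_lie false x0 -> homog sl_lie true x1 ->
  x0 + x1 \in scalars -> x0 \in scalars /\ x1 \in scalars.
Proof.
move=> h0 h1 /scalarsP[c] /= e.
have x10 : x1 = 0.
  apply: (homog_disj _ h1); rewrite /= /sub_homog.
  have -> : vsval x1 = c%:M - vsval x0 by rewrite -e addrC addKr.
  exact: (@homogD _ _ gl_grading false _ _ (gl_homog1 c) (@homogN _ _ gl_grading _ _ h0)).
by rewrite x10 mem0v; split=> //; apply/scalarsP; exists c; rewrite -e x10 addr0.
Qed.

Definition psl22 : vectType K := quo scalars.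

Definition psl_lie : lieSuper psl22 :=
  quo_lie scalars_brr scalars_brl scalars_graded.

(* The class of [A]; meaningful when the supertrace of [A] vanishes. *)
Definition psl_class (A : 'M[K]_4) : psl22 := quo_pi scalars (vsproj sl22 A).

(* Here [i] and [j] run from 1 to 4. *)
Definition Emx (i j : nat) : 'M[K]_4 := delta_mx (inord i.-1) (inord j.-1).

End PSL.

Record supermod (K : fieldType) (L : lmodType K) (s : lieSuper L) := SuperMod {
  msp :> vectType K;
  mgrading : grading msp;
  act : {linear L -> 'End(msp)};
  act_homog : forall a b x m, homog s a x -> homog mgrading b m ->
    homog mgrading (a (+) b) (act x m);
  act_br : forall a b x y m, homog s a x -> homog s b y ->
    act (br s x y) m = act x (act y m) - ssign K a b *: act y (act x m) }.

Record algmod (K : fieldType) (A : algType K) := AlgMod {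
  asp :> vectType K;
  aact : {linear A -> 'End(asp)};
  aact1 : aact 1 = \1%VF;
  aactM : forall a b, aact (a * b) = (aact a \o aact b)%VF }.

Definition nilpotent_lfun (K : fieldType) (V : vectType K) (f : 'End(V)) : Prop :=
  exists n, forall v, iter n f v = 0.

Record linCat (K : fieldType) := LinCat {
  ob : Type;
  hom : ob -> ob -> lmodType K;
  idm : forall X, hom X X;
  cmp : forall X Y Z, hom Y Z -> hom X Y -> hom X Z;
  cmp1l : forall X Y (f : hom X Y), cmp (idm Y) f = f;
  cmp1r : forall X Y (f : hom X Y), cmp f (idm X) = f;
  cmpA : forall X Y Z T (f : hom Z T) (g : hom Y Z) (h : hom X Y),
    cmp f (cmp g h) = cmp (cmp f g) h;
  cmp_linl : forall X Y Z (g : hom X Y), linear (fun f : hom Y Z => cmp f g);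
  cmp_linr : forall X Y Z (f : hom Y Z), linear (fun g : hom X Y => cmp f g) }.

Arguments hom {K} C X Y : rename.
Arguments idm {K} C X : rename.

Section Cat.
Variables (K : fieldType) (C : linCat K).

Definition is_iso X Y (f : hom C X Y) : Prop :=
  exists g : hom C Y X, cmp g f = idm C X /\ cmp f g = idm C Y.

Definition isomorphic X Y : Prop := exists f : hom C X Y, is_iso f.

Definition is_zero X : Prop := idm C X = 0.

Definition monic X Y (f : hom C X Y) : Prop :=
  forall T (g h : hom C T X), cmp f g = cmp f h -> g = h.

Definition is_simple X : Prop :=
  ~ is_zero X /\
  forall Y (f : hom C Y X), monic f -> is_zero Y \/ is_iso f.

Definition is_biproduct X Y S : Prop :=
  exists (i : hom C X S) (j : hom C Y S) (p : hom C S X) (q : hom C S Y),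
    [/\ cmp p i = idm C X, cmp q j = idm C Y, cmp p j = 0, cmp q i = 0
      & cmp i p + cmp j q = idm C S].

Definition replete (P : ob C -> Prop) : Prop :=
  forall X Y, isomorphic X Y -> P X -> P Y.

(* [P] and [Q] stand for the full subcategories on their objects. *)
Definition direct_sum (P Q : ob C -> Prop) : Prop :=
  [/\ replete P, replete Q,
      forall X Y, P X -> Q Y -> (forall f : hom C X Y, f = 0) /\
  (forall f : hom C Y X, f = 0)
    & forall S, exists X Y, [/\ P X, Q Y & is_biproduct X Y S]].

Definition indecomposable : Prop :=
  (exists X, ~ is_zero X) /\
  forall P Q, direct_sum P Q ->
    (forall X, P X -> is_zero X) \/ (forall X, Q X -> is_zero X).

Definition full_sub (P : ob C -> Prop) : linCat K.
Proof.
refine (@LinCat K {X | P X} (fun X Y => hom C (sval X) (sval Y))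
  (fun X => idm C (sval X)) (fun X Y Z f g => cmp f g) _ _ _ _ _).
- by move=> X Y f; apply: cmp1l.
- by move=> X Y f; apply: cmp1r.
- by move=> X Y Z T f g h; apply: cmpA.
- by move=> X Y Z g; apply: cmp_linl.
- by move=> X Y Z f; apply: cmp_linr.
Defined.

End Cat.

Definition is_block (K : fieldType) (C : linCat K) (P : ob C -> Prop) : Prop :=
  (exists Q, direct_sum P Q) /\ indecomposable (full_sub P).

Record functor (K : fieldType) (C D : linCat K) := Functor {
  fob : ob C -> ob D;
  fhom : forall X Y, {linear hom C X Y -> hom D (fob X) (fob Y)};
  fhom1 : forall X, fhom X X (idm C X) = idm D (fob X);
  fhomM : forall X Y Z (f : hom C Y Z) (g : hom C X Y),
    fhom X Z (cmp f g) = cmp (fhom Y Z f) (fhom X Y g) }.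

Definition functor_id (K : fieldType) (C : linCat K) : functor C C :=
  @Functor K C C id (fun X Y => idfun) (fun X => erefl) (fun X Y Z f g => erefl).

Definition functor_comp (K : fieldType) (C D B : linCat K)
    (G : functor D B) (F : functor C D) : functor C B.
Proof.
refine (@Functor K C B (fun X => fob G (fob F X))
  (fun X Y => fhom G (fob F X) (fob F Y) \o fhom F X Y) _ _).
- by move=> X /=; rewrite !fhom1.
- by move=> X Y Z f g /=; rewrite !fhomM.
Defined.

Definition nat_iso (K : fieldType) (C D : linCat K) (F G : functor C D) : Prop :=
  exists eta : forall X, hom D (fob F X) (fob G X),
    (forall X, is_iso (eta X)) /\
  (forall X Y (f : hom C X Y), cmp (eta Y) (fhom F X Y f) = cmp (fhom G X Y f) (eta X)).

Definition equivalent (K : fieldType) (C D : linCat K) : Prop :=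
  exists (F : functor C D) (G : functor D C),
    nat_iso (functor_comp G F) (functor_id C) /\
  nat_iso (functor_comp F G) (functor_id D).

Section SupermodCat.
Variables (K : fieldType) (L : lmodType K) (s : lieSuper L).
Implicit Types M N P : supermod s.

Definition supermor_pred M N : {pred 'Hom(M, N)} := fun f => `[<
  (forall b m, homog (mgrading M) b m -> homog (mgrading N) b (f m)) /\
  (forall x m, f (act M x m) = act N x (f m)) >].

Arguments supermor_pred M N f : clear implicits.

Fact supermor_submod M N : submod_closed (supermor_pred M N).
Proof.
split=> [|a f g /asboolP[df cf] /asboolP[dg cg]]; apply/asboolP; split=> [b m hm|x m].
- by rewrite lfunE; apply: homog0.
- by rewrite !lfunE /= linear0.
- by rewrite lfunE /= lfunE /=; apply: homogP; [apply: df | apply: dg].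
- by rewrite !(add_lfunE, scale_lfunE) cf cg linearP.
Qed.
HB.instance Definition _ M N :=
  GRing.isSubmodClosed.Build K 'Hom(M, N) (supermor_pred M N) (supermor_submod M N).

Record supermor M N := Supermor {
  supermor_val :> 'Hom(M, N); _ : supermor_val \in supermor_pred M N }.

HB.instance Definition _ M N := [isSub for @supermor_val M N].
HB.instance Definition _ M N := [Choice of supermor M N by <:].
HB.instance Definition _ M N := [SubChoice_isSubLmodule of supermor M N by <:].

Fact supermor_id_subproof M : \1%VF \in supermor_pred M M.
Proof. by apply/asboolP; split=> *; rewrite !lfunE. Qed.

Fact supermor_comp_subproof M N P (f : supermor N P) (g : supermor M N) :
  (supermor_val f \o supermor_val g)%VF \in supermor_pred M P.
Proof.
have /asboolP[df cf] := valP f; have /asboolP[dg cg] := valP g; apply/asboolP.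
split=> [b m hm|x m]; rewrite !comp_lfunE; first exact/df/dg.
by rewrite cg cf.
Qed.

Definition supermodCat : linCat K.
Proof.
refine (@LinCat K (supermod s) (fun M N => supermor M N)
  (fun M => Supermor (supermor_id_subproof M))
  (fun M N P f g => Supermor (supermor_comp_subproof f g)) _ _ _ _ _).
- by move=> M N f; apply/val_inj/lfunP=> m /=; rewrite !lfunE /= lfunE.
- by move=> M N f; apply/val_inj/lfunP=> m /=; rewrite !lfunE /= lfunE.
- by move=> M N P Q f g h; apply/val_inj/lfunP=> m /=; rewrite !comp_lfunE.
- by move=> M N P g a f f'; apply/val_inj/lfunP=> m /=;
    rewrite !(comp_lfunE, add_lfunE, scale_lfunE).
- by move=> M N P f a g g'; apply/val_inj/lfunP=> m /=;
    rewrite !(comp_lfunE, add_lfunE, scale_lfunE) linearP.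
Defined.

Section Parity.
Variable M : supermod s.

Definition op_grading : grading M.
Proof.
refine (@Grading K M (fun b => homog (mgrading M) (~~ b)) _ _ _ _).
- by move=> b; apply: homog0.
- by move=> b; apply: homogP.
- move=> x; have [x0 [x1 [h0 h1 e]]] := homog_dec (mgrading M) x.
  by exists x1, x0; rewrite addrC.
- by move=> x h0 h1; apply: homog_disj h1 h0.
Defined.

Fact op_act_homog a b x m : homog s a x -> homog op_grading b m ->
  homog op_grading (a (+) b) (act M x m).
Proof. by move=> hx hm; rewrite /= -addbN; apply: act_homog. Qed.

(* The parity shift changes only the grading: there is no sign in the action. *)
Definition op_mod : supermod s :=
  @SuperMod K L s M op_grading (act M) op_act_homog (@act_br K L s M).
End Parity.

End SupermodCat.

Section AlgmodCat.
Variables (K : fieldType) (A : algType K).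
Implicit Types M N P : algmod A.

Definition algmor_pred M N : {pred 'Hom(M, N)} := fun f => `[<
  forall x m, f (aact M x m) = aact N x (f m) >].

Arguments algmor_pred M N f : clear implicits.

Fact algmor_submod M N : submod_closed (algmor_pred M N).
Proof.
split=> [|a f g /asboolP cf /asboolP cg]; apply/asboolP => x m.
  by rewrite !lfunE /= linear0.
by rewrite !(add_lfunE, scale_lfunE) cf cg linearP.
Qed.
HB.instance Definition _ M N :=
  GRing.isSubmodClosed.Build K 'Hom(M, N) (algmor_pred M N) (algmor_submod M N).

Record algmor M N := Algmor {
  algmor_val :> 'Hom(M, N); _ : algmor_val \in algmor_pred M N }.

HB.instance Definition _ M N := [isSub for @algmor_val M N].
HB.instance Definition _ M N := [Choice of algmor M N by <:].
HB.instance Definition _ M N := [SubChoice_isSubLmodule of algmor M N by <:].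

Fact algmor_id_subproof M : \1%VF \in algmor_pred M M.
Proof. by apply/asboolP=> *; rewrite !lfunE. Qed.

Fact algmor_comp_subproof M N P (f : algmor N P) (g : algmor M N) :
  (algmor_val f \o algmor_val g)%VF \in algmor_pred M P.
Proof.
have /asboolP cf := valP f; have /asboolP cg := valP g; apply/asboolP => x m.
by rewrite !comp_lfunE cg cf.
Qed.

Definition algmodCat : linCat K.
Proof.
refine (@LinCat K (algmod A) (fun M N => algmor M N)
  (fun M => Algmor (algmor_id_subproof M))
  (fun M N P f g => Algmor (algmor_comp_subproof f g)) _ _ _ _ _).
- by move=> M N f; apply/val_inj/lfunP=> m /=; rewrite !lfunE /= lfunE.
- by move=> M N f; apply/val_inj/lfunP=> m /=; rewrite !lfunE /= lfunE.
- by move=> M N P Q f g h; apply/val_inj/lfunP=> m /=; rewrite !comp_lfunE.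
- by move=> M N P g a f f'; apply/val_inj/lfunP=> m /=;
    rewrite !(comp_lfunE, add_lfunE, scale_lfunE).
- by move=> M N P f a g g'; apply/val_inj/lfunP=> m /=;
    rewrite !(comp_lfunE, add_lfunE, scale_lfunE) linearP.
Defined.
End AlgmodCat.

(* Ungraded finite-dimensional modules over K[x, y, t]. *)
Definition nilpPolyCat (K : fieldType) : linCat K :=
  full_sub (C := algmodCat (mpoly 3 K))
    (fun M => forall i : 'I_3, nilpotent_lfun (aact M (mpolyX K (mnm1 i)))).

Definition center (K : fieldType) (L : vectType K) (s : lieSuper L) : {vspace L} :=
  lker (linfun (fun x => linfun (br s x))).

Lemma centerP (K : fieldType) (L : vectType K) (s : lieSuper L) z :
  reflect (forall x, br s z x = 0) (z \in center s).
Proof.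
have lin : linear (fun x => linfun (br s x) : 'Hom(L, L)).
  move=> a x y; apply/lfunP=> t.
  by rewrite add_lfunE scale_lfunE !lfunE /= brPl.
pose f := HB.pack_for {linear L -> 'Hom(L, L)} (fun x => linfun (br s x))
  (GRing.isLinear.Build K L 'Hom(L, L) _ _ lin).
rewrite /center memv_ker -[linfun _]/(linfun f) lfunE /=.
apply: (iffP eqP) => [/lfunP h x|h]; first by have := h x; rewrite !lfunE.
by apply/lfunP=> x; rewrite !lfunE /= h.
Qed.

Section Psl22Extension.
Variables (K : fieldType) (L : vectType K) (s : lieSuper L).
Variable p : {linear L -> psl22 K}.

(* The bracket in [L] of arbitrary lifts of the classes of [A] and [B]; it does
   not depend on the lifts because the kernel of [p] is central. *)
Definition lift_br (A B : 'M[K]_4) : L :=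
  br s ((linfun p)^-1%VF (psl_class A)) ((linfun p)^-1%VF (psl_class B)).

Lemma lift_brE A B x y : central_extension s (psl_lie K) p ->
  p x = psl_class A -> p y = psl_class B -> lift_br A B = br s x y.
Proof.
case=> [[hp _] surj cen] ex ey.
have liftK u : linfun p ((linfun p)^-1%VF u) = u.
  have [v <-] := surj u; apply: limg_lfunVK.
  by rewrite -(lfunE p) memv_img ?memvf.
have cenr z : p z = 0 -> forall w, br s w z = 0.
  move=> pz; have [z0 [z1 [h0 h1 e]]] := homog_dec s z.
  have e0 : p z0 = 0.
    apply: (homog_disj (hp _ _ h0)).
    have -> : p z0 = - p z1 by apply/eqP; rewrite -addr_eq0 -linearD -e pz.
    exact/homogN/hp.
  have e1 : p z1 = 0 by move: pz; rewrite e linearD /= e0 add0r.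
  move=> w; have [w0 [w1 [k0 k1 ->]]] := homog_dec s w.
  rewrite e brDl !linearD /= (br_anti k0 h0) (br_anti k0 h1).
  rewrite (br_anti k1 h0) (br_anti k1 h1) !(cen _ e0) !(cen _ e1).
  by rewrite !scaler0 oppr0 !addr0.
have eqp u v : p u = v -> p ((linfun p)^-1%VF v - u) = 0.
  by move=> e; rewrite linearB /= -(lfunE p) liftK e subrr.
rewrite /lift_br; set x' := _^-1%VF _; set y' := _^-1%VF _.
rewrite -[x'](subrK x) brDl cen ?eqp // add0r.
by rewrite -[y'](subrK y) linearD /= cenr ?eqp // add0r.
Qed.

Definition z_pos : L := lift_br (Emx K 1 3) (Emx K 2 4).

Definition z_neg : L := lift_br (Emx K 3 1) (Emx K 4 2).

Definition z_one : L := lift_br (Emx K 1 3) (Emx K 3 1) + lift_br (Emx K 2 4) (Emx K 4 2).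

(* The short sl_2 is perfect, so it has a unique lift to a central extension;
   since [E12 + E34, E21 + E43] = 2 h, the lift of h is half a bracket of lifts. *)
Definition h_short : L :=
  2^-1 *: lift_br (Emx K 1 2 + Emx K 3 4) (Emx K 2 1 + Emx K 4 3).

Definition in_mod1 (M : supermod s) : Prop :=
  forall c, passmx.leigenvalue (act M h_short) c -> c \in [:: -1; 0; 1].

Section CentralCharacter.
Variable chi : 'Hom(subvs_of (center s), K^o).

Definition has_gen_char (M : supermod s) : Prop :=
  forall z : subvs_of (center s),
    nilpotent_lfun (act M (vsval z) - chi z *: \1%VF).

Definition mod1_chi : linCat K :=
  full_sub (C := supermodCat s) (fun M => in_mod1 M /\ has_gen_char M).

(* The elements z_pos, z_neg, z_one are central, so that [vsproj] is only a
   change of type here. *)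
Definition chi_at (z : L) : K := chi (vsproj (center s) z).

Definition discr : K := chi_at z_one ^+ 2 - 4 * chi_at z_pos * chi_at z_neg.

Definition semisimple_char : Prop := discr <> 0.

Definition typical_char : Prop :=
  exists S T : ob mod1_chi,
    [/\ is_simple S, is_simple T, ~ isomorphic S T,
        forall X : ob mod1_chi, is_simple X -> isomorphic X S \/ isomorphic X T
      & isomorphic (C := supermodCat s) (op_mod (sval S)) (sval T)].
End CentralCharacter.
End Psl22Extension.

(* Main.v *)
(* As [h_short] has eigenvalues -1, 0 and 1, on a module of the category
   h1 = E11 - E22 has eigenvalues -2, ..., 2. The equivalence sends a module M to the
   eigenspace F(M) = ker (h1 - 2), on which z_pos, z_neg, z_one minus their values
   under chi act as commuting nilpotent operators x, y, t.

   A weight argument shows that the submodule generated by a Z-stable subspace N of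
   F(M) meets F(M) in N only. By typicality the two simple objects differ by parity, so
   F vanishes on no nonzero object as soon as it is nonzero somewhere; hence a stable
   subspace meeting F(M) trivially is 0, and one containing F(M) is M. So F is
   faithful, and a map between the spaces F extends to the modules because the
   submodule generated by its graph is again a graph. For essential surjectivity,
   the outer SL(2) twists the 4-dimensional representation by a matrix g with
   polynomial entries; tensoring two such twists over the algebra with N gives a module
   with F = N, and g, g' can be solved for so that z_pos, z_neg, z_one act on N as
   prescribed.

   The parity of h1 commutes with even and anticommutes with odd elements, so the
   modules on which the grading is, or is opposite to, the parity of h1 are the two
   blocks. Each is indecomposable since the trivial module over the polynomial algebra
   has scalar endomorphisms and maps to every nonzero nilpotent module. *)

From HB Require Import structures.
Require Import Defs.
From mathcomp Require Import all_boot all_order all_algebra.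
From mathcomp Require Import boolp.
From mathcomp Require Import reals complex.
From mathcomp Require Import ring ssrAC.
From mathcomp Require Import mxtens.
From mathcomp Require Import -(notations) ssrcomplements mpoly.
(* Imported again, as [vector] shadows [hom]. *)
Require Import Defs.

Set Implicit Arguments.
Unset Strict Implicit.
Unset Printing Implicit Defensive.

Import GRing.Theory Num.Theory.
Local Open Scope ring_scope.


(** * Linear categories *)

(** The Lie superalgebra is given only by its universal property, so computations are moved to 4 x 4
    matrices: in any central extension the bracket of lifts is a linear section plus an explicit
    cocycle [omega], and universality then embeds the algebra into the model psl(2|2) + K^3.

    Nothing is assumed diagonalisable, as the category bounds only the eigenvalues of [h_short]. The
    substitute is h^2 (h^2 - 1)(h^2 - 4) = 0 for h = h1, h2, a consequence of e^3 = 0. Since 2 is a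
    simple root, F(M) is an honest eigenspace and the image of a polynomial in h1, which makes F
    compatible with quotients.

    Two tensor factors occur because h1 has largest eigenvalue 1 on one twist, and because the
    central values of one twist are the coefficients of a binary quadratic form of discriminant 1.
    Sums of two such forms reach every form of nonzero discriminant; the equations are solved with
    operators on N, so inverses are needed only modulo the annihilator of N.

    Thus semisimplicity gives essential surjectivity and an object with nonzero F; typicality then
    gives faithfulness, and fullness within each parity. *)

Section Categories.
Variable K : fieldType.
Implicit Types C D : linCat K.

Lemma cmpDl C X Y Z (f g : hom C Y Z) (h : hom C X Y) :
  cmp (f + g) h = cmp f h + cmp g h.
Proof. by have := cmp_linl h 1 f g; rewrite !scale1r. Qed.

Lemma cmpZl C X Y Z a (f : hom C Y Z) (h : hom C X Y) :
  cmp (a *: f) h = a *: cmp f h.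
Proof.
have e0 : cmp 0 h = 0 :> hom C X Z.
  by apply: (@addrI _ (cmp 0 h)); rewrite -cmpDl !addr0.
by have := cmp_linl h a f 0; rewrite !addr0 e0 addr0.
Qed.

Lemma cmp0l C X Y Z (h : hom C X Y) : cmp (0 : hom C Y Z) h = 0.
Proof. by rewrite -(scale0r (0 : hom C Y Z)) cmpZl scale0r. Qed.

Lemma cmpDr C X Y Z (h : hom C Y Z) (f g : hom C X Y) :
  cmp h (f + g) = cmp h f + cmp h g.
Proof. by have := cmp_linr h 1 f g; rewrite !scale1r. Qed.

Lemma cmpZr C X Y Z a (h : hom C Y Z) (f : hom C X Y) :
  cmp h (a *: f) = a *: cmp h f.
Proof.
have e0 : cmp h 0 = 0 :> hom C X Z.
  by apply: (@addrI _ (cmp h 0)); rewrite -cmpDr !addr0.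
by have := cmp_linr h a f 0; rewrite !addr0 e0 addr0.
Qed.

Lemma cmp0r C X Y Z (h : hom C Y Z) : cmp h (0 : hom C X Y) = 0.
Proof. by rewrite -(scale0r (0 : hom C X Y)) cmpZr scale0r. Qed.

(** The inverse picks preimages of objects and morphisms by choice; faithfulness makes the preimage
    of a morphism unique, whence the choice is linear and functorial. *)
Lemma ff_es_equivalent C D (F : functor C D) :
  (forall X Y (f g : hom C X Y), fhom F X Y f = fhom F X Y g -> f = g) ->
  (forall X Y (u : hom D (fob F X) (fob F Y)), exists f, fhom F X Y f = u) ->
  (forall N, exists X, isomorphic (fob F X) N) ->
  equivalent C D.
Proof.
move=> faith full es.
pose lft X Y (u : hom D (fob F X) (fob F Y)) := sval (cid (full X Y u)).
have lftK X Y u : fhom F X Y (lft X Y u) = u by rewrite /lft; case: cid.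
have lft_uniq X Y u f : fhom F X Y f = u -> lft X Y u = f.
  by move=> e; apply: faith; rewrite lftK.
pose G0 N := sval (cid (es N)).
have isoG N : isomorphic (fob F (G0 N)) N by rewrite /G0; case: cid.
pose ev N : hom D (fob F (G0 N)) N := sval (cid (isoG N)).
have isoev N : is_iso (ev N) by rewrite /ev; case: cid.
pose ve N : hom D N (fob F (G0 N)) := sval (cid (isoev N)).
have [vK vK'] : (forall N, cmp (ve N) (ev N) = idm D _) /\
    (forall N, cmp (ev N) (ve N) = idm D _).
  by split=> N; rewrite /ve; case: cid => g [].
pose G1f N N' (u : hom D N N') : hom C (G0 N) (G0 N') :=
  lft _ _ (cmp (ve N') (cmp u (ev N))).
have G1_lin N N' : linear (@G1f N N').
  move=> a u u'; apply: lft_uniq; rewrite linearP !lftK.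
  by rewrite cmpDl cmpZl cmpDr cmpZr.
pose G1 N N' : {linear hom D N N' -> hom C (G0 N) (G0 N')} :=
  HB.pack (@G1f N N') (GRing.isLinear.Build _ _ _ _ _ (@G1_lin N N')).
have G1_1 N : G1 N N (idm D N) = idm C (G0 N).
  by apply: lft_uniq; rewrite fhom1 cmp1l vK.
have G1_M X Y Z (f : hom D Y Z) (g : hom D X Y) :
    G1 X Z (cmp f g) = cmp (G1 Y Z f) (G1 X Y g).
  apply: lft_uniq; rewrite fhomM !lftK -!cmpA; congr (cmp _ _).
  by rewrite (cmpA (ev Y)) vK' cmp1l.
exists F, (Functor G1_1 G1_M); split.
- exists (fun X => lft (G0 (fob F X)) X (ev (fob F X))); split=> [X|X Y f].
    exists (lft X (G0 (fob F X)) (ve (fob F X))).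
    split; apply: faith; rewrite /= fhomM !lftK.
      by rewrite vK -fhom1.
    by rewrite vK' -fhom1.
  by apply: faith; rewrite /= !fhomM !lftK cmpA vK' cmp1l.
- exists (fun N => ev N); split=> [N|X Y f]; first by exists (ve N); rewrite /= vK vK'.
  by rewrite /= lftK cmpA vK' cmp1l.
Qed.

(** If k is the biproduct of X in P and Y in Q, the idempotent of X is a scalar, hence 0 or 1, so k
    lies in Q or in P. As k maps nontrivially to every nonzero object, the other subcategory is
    zero. *)
Lemma indecomposable_by C (k : ob C) : ~ is_zero k ->
  (forall f : hom C k k, exists a, f = a *: idm C k) ->
  (forall X, ~ is_zero X -> exists f : hom C k X, f <> 0) ->
  indecomposable C.
Proof.
move=> k0 endk homk; split; first by exists k.
move=> P Q [repP repQ PQ0 dec].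
have [X [Y [PX QY [i [j [p [q [ip jq jp iq e]]]]]]]] := dec k.
have [a ea] := endk (cmp i p).
have idem : a * a = a.
  have : cmp (cmp i p) (cmp i p) = cmp i p by rewrite -cmpA (cmpA p) ip cmp1l.
  rewrite ea cmpZl cmp1l scalerA => /eqP; rewrite -subr_eq0 -scalerBl.
  rewrite scaler_eq0 subr_eq0 => /orP[/eqP //|/eqP e0]; last by case: (k0 e0).
have side (Z : ob C) (R R' : ob C -> Prop) (u : hom C Z k) (v : hom C k Z) :
    replete R -> R Z -> (forall X Y, R X -> R' Y -> forall f : hom C X Y, f = 0) ->
    cmp v u = idm C Z -> cmp u v = idm C k -> forall M, R' M -> is_zero M.
  move=> repR RZ R0 vu uv M RM.
  have Rk : R k by apply: repR RZ; exists u, v.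
  by apply: contrapT => /homk[f]; apply; apply: R0 Rk RM _.
have [a0|a1] : a = 0 \/ a = 1.
  have /eqP : a * (a - 1) = 0 by rewrite mulrBr mulr1 idem subrr.
  by rewrite mulf_eq0 subr_eq0 => /orP[] /eqP; [left|right].
- left; apply: (side Y Q P j q repQ QY) => //.
    by move=> X' Y' QX PY f; have [_ h] := PQ0 _ _ PY QX; apply: h.
  by rewrite -e ea a0 scale0r add0r.
- right; apply: (side X P Q i p repP PX) => //.
    by move=> X' Y' PX' QY' f; have [h _] := PQ0 _ _ PX' QY'; apply: h.
  by rewrite ea a1 scale1r.
Qed.

End Categories.

(** * The central extension *)

Notation o0 := (@Ordinal 4 0 isT).
Notation o1 := (@Ordinal 4 1 isT).
Notation o2 := (@Ordinal 4 2 isT).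
Notation o3 := (@Ordinal 4 3 isT).
Notation k0 := (@Ordinal 3 0 isT).
Notation k1 := (@Ordinal 3 1 isT).
Notation k2 := (@Ordinal 3 2 isT).

Lemma I4_ind (P : 'I_4 -> Prop) : P o0 -> P o1 -> P o2 -> P o3 -> forall i, P i.
Proof.
move=> h0 h1 h2 h3 [[|[|[|[|n]]]] lt] //.
- by rewrite (_ : Ordinal lt = o0) //; apply: val_inj.
- by rewrite (_ : Ordinal lt = o1) //; apply: val_inj.
- by rewrite (_ : Ordinal lt = o2) //; apply: val_inj.
- by rewrite (_ : Ordinal lt = o3) //; apply: val_inj.
Qed.

Lemma I3_ind (P : 'I_3 -> Prop) : P k0 -> P k1 -> P k2 -> forall i, P i.
Proof.
move=> h0 h1 h2 [[|[|[|n]]] lt] //.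
- by rewrite (_ : Ordinal lt = k0) //; apply: val_inj.
- by rewrite (_ : Ordinal lt = k1) //; apply: val_inj.
- by rewrite (_ : Ordinal lt = k2) //; apply: val_inj.
Qed.

Lemma sum4 (V : nmodType) (F : 'I_4 -> V) : \sum_i F i = F o0 + F o1 + F o2 + F o3.
Proof.
rewrite !big_ord_recr big_ord0 /= add0r.
by congr (_ + _ + _ + _); congr F; apply: val_inj.
Qed.

Lemma sum3 (V : nmodType) (F : 'I_3 -> V) : \sum_i F i = F k0 + F k1 + F k2.
Proof.
rewrite !big_ord_recr big_ord0 /= add0r.
by congr (_ + _ + _); congr F; apply: val_inj.
Qed.

(** * The cocycle on matrices *)

Section Cocycle.
Variable K : fieldType.
Implicit Types A B X Y Z : 'M[K]_4.

(* The cocycle of the universal central extension, with components along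
   [z_pos], [z_neg] and [z_one]. *)
Definition omega (k : 'I_3) A B : K :=
  match val k with
  | 0 => A o0 o2 * B o1 o3 + A o1 o3 * B o0 o2 - A o0 o3 * B o1 o2 - A o1 o2 * B o0 o3
  | 1 => A o2 o0 * B o3 o1 + A o3 o1 * B o2 o0 - A o2 o1 * B o3 o0 - A o3 o0 * B o2 o1
  | _ => 2^-1 * (A o0 o2 * B o2 o0 + A o0 o3 * B o3 o0 + A o1 o2 * B o2 o1
      + A o1 o3 * B o3 o1 + A o2 o0 * B o0 o2 + A o3 o0 * B o0 o3
      + A o2 o1 * B o1 o2 + A o3 o1 * B o1 o3)
  end.

Lemma omegaPl k a A A' B : omega k (a *: A + A') B = a * omega k A B + omega k A' B.
Proof. by case: k => [[|[|n]] lt]; rewrite /omega /= !mxE; ring. Qed.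

Lemma omegaPr k a A B B' : omega k A (a *: B + B') = a * omega k A B + omega k A B'.
Proof. by case: k => [[|[|n]] lt]; rewrite /omega /= !mxE; ring. Qed.

Lemma omegaDl k A A' B : omega k (A + A') B = omega k A B + omega k A' B.
Proof. by have := omegaPl k 1 A A' B; rewrite scale1r mul1r. Qed.

Lemma omegaDr k A B B' : omega k A (B + B') = omega k A B + omega k A B'.
Proof. by have := omegaPr k 1 A B B'; rewrite scale1r mul1r. Qed.

Lemma gl_homog_entry b A i j : gl_homog b A -> ipar i (+) ipar j != b -> A i j = 0.
Proof. by move=> <- /negbTE h; rewrite mxE h. Qed.

Lemma even_entries A : gl_homog false A ->
  ((A o0 o2 = 0) * (A o0 o3 = 0) * (A o1 o2 = 0) * (A o1 o3 = 0)) *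
  ((A o2 o0 = 0) * (A o2 o1 = 0) * (A o3 o0 = 0) * (A o3 o1 = 0)).
Proof. by move=> hA; do !split; apply: gl_homog_entry hA _. Qed.

Lemma odd_entries A : gl_homog true A ->
  ((A o0 o0 = 0) * (A o0 o1 = 0) * (A o1 o0 = 0) * (A o1 o1 = 0)) *
  ((A o2 o2 = 0) * (A o2 o3 = 0) * (A o3 o2 = 0) * (A o3 o3 = 0)).
Proof. by move=> hA; do !split; apply: gl_homog_entry hA _. Qed.

Lemma omega_even k A B : gl_homog false A -> omega k A B = 0.
Proof.
move=> hA; case: k => [[|[|n]] lt]; rewrite /omega /=;
  rewrite !(even_entries hA) !mul0r; ring.
Qed.

Lemma omegaC k A B : omega k A B = omega k B A.
Proof. by case: k => [[|[|n]] lt]; rewrite /omega /=; ring. Qed.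

Lemma supertrace4 A : supertrace A = A o0 o0 + A o1 o1 - A o2 o2 - A o3 o3.
Proof. by rewrite /supertrace sum4 /= expr0 expr1 !mul1r !mulN1r. Qed.

Lemma mulmx4 A B i j :
  (A * B) i j = A i o0 * B o0 j + A i o1 * B o1 j + A i o2 * B o2 j + A i o3 * B o3 j.
Proof. by rewrite !mxE sum4. Qed.

Lemma gl_br_evenl A B : gl_homog false A -> gl_br A B = A * B - B * A.
Proof.
move=> hA; have [B0 [B1 [h0 h1 ->]]] := gl_dec B.
have := gl_br_linr A 1 B0 B1; rewrite !scale1r => ->.
by rewrite (gl_brE hA h0) (gl_brE hA h1) /ssign /= expr0 !scale1r mulrDr mulrDl
  opprD addrACA.
Qed.

Lemma gl_br_evenr A B : gl_homog false B -> gl_br A B = A * B - B * A.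
Proof.
move=> hB; have [A0 [A1 [h0 h1 ->]]] := gl_dec A.
have := gl_br_linl B 1 A0 A1; rewrite /= !scale1r => ->.
by rewrite (gl_brE h0 hB) (gl_brE h1 hB) /ssign /= expr0 !scale1r mulrDr mulrDl
  opprD addrACA.
Qed.

(** Along [z_pos] and [z_neg], [omega] is the polarised determinant of an off-diagonal block, which
    an even X scales by the difference of the traces of its diagonal blocks, that is, by the
    supertrace up to sign. Along [z_one] it is half the trace form on odd matrices, invariant under
    every even X. *)
Lemma omega_inv k X Y Z : gl_homog false X -> supertrace X = 0 ->
  gl_homog true Y -> gl_homog true Z ->
  omega k Y (gl_br X Z) = - omega k (gl_br X Y) Z.
Proof.
move=> hX + hY hZ; rewrite supertrace4 (gl_brE hX hZ) (gl_brE hX hY) /ssign /=.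
rewrite !expr0 !scale1r => e.
have {}e : X o3 o3 = X o0 o0 + X o1 o1 - X o2 o2.
  by apply/eqP; rewrite eq_sym -subr_eq0 -[X in _ == X]e; apply/eqP; ring.
have ent (i j : 'I_4) : (X * Z - Z * X) i j = (X * Z) i j - (Z * X) i j.
  by rewrite !mxE.
have ent' (i j : 'I_4) : (X * Y - Y * X) i j = (X * Y) i j - (Y * X) i j.
  by rewrite !mxE.
case: k => [[|[|n]] lt]; rewrite /omega /= !ent !ent' !mulmx4;
  rewrite !(even_entries hX, odd_entries hY, odd_entries hZ) ?e; ring.
Qed.

(** [omega] vanishes as soon as one argument is even, so only triples with exactly two odd members
    matter, and these reduce to [omega_inv] by symmetry. *)
Lemma omega_jacobi k a b c X Y Z : gl_homog a X -> gl_homog b Y -> gl_homog c Z ->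
  supertrace X = 0 -> supertrace Y = 0 -> supertrace Z = 0 ->
  omega k X (gl_br Y Z) =
    omega k (gl_br X Y) Z + ssign K a b * omega k Y (gl_br X Z).
Proof.
move=> hX hY hZ sX sY sZ.
have hXY := gl_br_homog hX hY; have hXZ := gl_br_homog hX hZ.
have hYZ := gl_br_homog hY hZ.
have anti A B (p q : bool) : gl_homog p A -> gl_homog q B ->
    gl_br A B = - (ssign K p q *: gl_br B A) by move=> h h'; apply: gl_br_anti.
have omegaZr A B (s : K) : omega k A (- (s *: B)) = - (s * omega k A B).
  by have := omegaPr k (-s) A B 0; rewrite addr0 scaleNr => ->;
    rewrite (_ : omega k A 0 = 0) ?addr0 ?mulNr // omegaC omega_even // /gl_homog linear0.
case: a b c hX hY hZ hXY hXZ hYZ => [] [] [] hX hY hZ hXY hXZ hYZ;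
  rewrite /ssign /= ?expr1 ?expr0 ?mul1r ?mulN1r.
- rewrite omegaC (omega_even _ _ hYZ) (omega_even _ _ hXY).
  by rewrite omegaC (omega_even _ _ hXZ) subrr.
- rewrite (anti _ _ _ _ hY hZ) (anti _ _ _ _ hX hZ) /ssign /= expr0.
  rewrite !omegaZr !mul1r.
  rewrite (omegaC k (gl_br X Y)) (omega_even _ _ hZ).
  by rewrite (omega_inv k hZ sZ hX hY) omegaC; ring.
- rewrite (omega_even _ _ hY) addr0.
  rewrite (anti _ _ _ _ hX hY) /ssign /= expr0 scale1r.
  rewrite (omega_inv k hY sY hX hZ).
  by rewrite (omegaC k (- _)) -[gl_br Y X]scale1r omegaZr mul1r omegaC scale1r.
- rewrite (omega_even _ _ hY) addr0 omegaC (omega_even _ _ hYZ).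
  by rewrite omegaC (omega_even _ _ hZ).
- rewrite (omega_even _ _ hX) (omega_inv k hX sX hY hZ).
  by ring.
- rewrite (omega_even _ _ hX) (omegaC _ Y) (omega_even _ _ hXZ).
  by rewrite omegaC (omega_even _ _ hZ) addr0.
- by rewrite (omega_even _ _ hX) (omega_even _ _ hXY) (omega_even _ _ hY) addr0.
- by rewrite (omega_even _ _ hX) (omega_even _ _ hXY) (omega_even _ _ hY) addr0.
Qed.

Lemma omega_scalar k c B : omega k c%:M B = 0.
Proof. by apply: omega_even; apply: gl_homog1. Qed.

(* A representative modulo scalar matrices. *)
Definition mat (y : psl22 K) : 'M[K]_4 := vsval (vsval y).

Lemma mat_linear : linear mat.
Proof. by move=> a x y; rewrite /mat !linearP. Qed.
HB.instance Definition _ := GRing.isLinear.Build K (psl22 K) 'M[K]_4 _ mat mat_linear.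

Lemma mat_sl y : mat y \in sl22 K.
Proof. exact: subvsP. Qed.

Lemma psl_class_linear : linear (@psl_class K).
Proof. by move=> a A B; rewrite /psl_class !linearP. Qed.
HB.instance Definition _ :=
  GRing.isLinear.Build K 'M[K]_4 (psl22 K) _ (@psl_class K) psl_class_linear.

Lemma matK y : psl_class (mat y) = y.
Proof. by rewrite /psl_class /mat vsvalK quo_piK. Qed.

(** The complement of the scalars underlying [psl22] is arbitrary, so a matrix is recovered from its
    class only up to a scalar. *)
Lemma mat_psl_class A : A \in sl22 K -> exists c, mat (psl_class A) = A + c%:M.
Proof.
move=> sA; set B := mat _.
have : psl_class (B - A) = 0 by rewrite linearB /= matK subrr.
move/quo_pi_eq0/scalarsP=> [c]; rewrite vsprojK ?rpredB ?mat_sl // => e.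
by exists c; rewrite -e addrC subrK.
Qed.

Lemma psl_class1 c : psl_class (c%:M : 'M[K]_4) = 0.
Proof.
apply/quo_pi_eq0/scalarsP; exists c.
by rewrite vsprojK // -scalemx1 rpredZ // sl22_1.
Qed.

Lemma psl_homogP b y : homog (psl_lie K) b y ->
  exists A, [/\ gl_homog b A, A \in sl22 K & y = psl_class A].
Proof.
case=> x hx <-; exists (vsval x); split=> //; first exact: subvsP.
by rewrite /psl_class vsvalK.
Qed.

Lemma psl_class_homog b A : gl_homog b A -> A \in sl22 K ->
  homog (psl_lie K) b (psl_class A).
Proof.
by move=> hA sA; exists (vsproj (sl22 K) A) => //; rewrite /= /sub_homog vsprojK.
Qed.

Lemma psl_class_br A B : A \in sl22 K -> B \in sl22 K ->
  br (psl_lie K) (psl_class A) (psl_class B) = psl_class (gl_br A B).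
Proof.
move=> sA sB; rewrite /= -quo_pi_br; [|exact: scalars_brr|exact: scalars_brl].
by rewrite /psl_class /sl_lie /= /sub_br !vsprojK.
Qed.

End Cocycle.

(** * The model of the central extension *)

Section Model.
Variable K : fieldType.

Lemma omega_psl_class k (A B : 'M[K]_4) : A \in sl22 K -> B \in sl22 K ->
  omega k (mat (psl_class A)) (mat (psl_class B)) = omega k A B.
Proof.
move=> /mat_psl_class[c ->] /mat_psl_class[d ->].
by rewrite omegaDl omega_scalar addr0 omegaDr (omegaC k A d%:M) omega_scalar addr0.
Qed.

Definition psl_ext : lmodType K := (psl22 K * 'rV[K]_3)%type.

Definition ext_homog (b : bool) (u : psl_ext) : Prop :=
  homog (psl_lie K) b u.1 /\ (b -> u.2 = 0).

Fact ext_homog_dec x : exists x0 x1,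
  [/\ ext_homog false x0, ext_homog true x1 & x = x0 + x1].
Proof.
have [y0 [y1 [h0 h1 e]]] := homog_dec (psl_lie K) x.1.
exists (y0, x.2), (y1, 0); split=> //.
by case: x e => x1 x2 /= ->; congr (_, _); rewrite addr0.
Qed.

Definition ext_grading : grading psl_ext.
Proof.
refine (@Grading K psl_ext ext_homog _ _ ext_homog_dec _).
- by move=> b; split=> //; apply: homog0.
- move=> b a x y [h1 h2] [h1' h2']; split=> [|hb]; first exact: homogP.
  by rewrite /= h2 // h2' // scaler0 addr0.
- move=> [x1 x2] [h _] [h' /(_ isT) /= e].
  by have /= -> := homog_disj h h'; rewrite e.
Defined.

Definition ext_br (u v : psl_ext) : psl_ext :=
  (br (psl_lie K) u.1 v.1, \row_k omega k (mat u.1) (mat v.1)).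

Definition ext_lie : lieSuper psl_ext.
Proof.
refine (@LieSuper K psl_ext ext_grading ext_br _ _ _ _ _).
- move=> y a x x'; congr (_, _).
    exact: (brPl (psl_lie K) y.1 a x.1 x'.1).
  by apply/rowP=> k; rewrite !mxE /= -omegaPl linearP.
- move=> x a y y'; congr (_, _).
    exact: (br_linr (psl_lie K) x.1 a y.1 y'.1).
  by apply/rowP=> k; rewrite !mxE /= -omegaPr linearP.
- move=> a b x y [hx _] [hy _]; split; first exact: br_homog hx hy.
  move: hx hy => /psl_homogP[A [hA sA eA]] /psl_homogP[B [hB sB eB]] /= hab.
  apply/rowP=> k; rewrite !mxE eA eB omega_psl_class //.
  case: a b hab hA hB => [] [] // _ hA hB; last exact: omega_even.
  by rewrite omegaC omega_even.
- move=> a b x y [hx _] [hy _]; congr (_, _); first exact: (br_anti hx hy).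
  apply/rowP=> k; rewrite !mxE /=.
  move: hx hy => /psl_homogP[A [hA sA ->]] /psl_homogP[B [hB sB ->]].
  rewrite !omega_psl_class // (omegaC k B A) /ssign.
  case: a b hA hB => [] [] hA hB /=; rewrite ?expr1 ?expr0 ?mul1r ?mulN1r ?opprK //.
  + by rewrite omegaC omega_even // oppr0.
  + by rewrite omega_even // oppr0.
  + by rewrite omega_even // oppr0.
- move=> a b x y z [hx _] [hy _]; congr (_, _); first exact: (br_jacobi _ hx hy).
  apply/rowP=> k; rewrite !mxE [LHS]/= /ext_br.
  have key c w : homog (psl_lie K) c w ->
      omega k (mat x.1) (mat (br (psl_lie K) y.1 w)) =
      omega k (mat (br (psl_lie K) x.1 y.1)) (mat w) +
      ssign K a b * omega k (mat y.1) (mat (br (psl_lie K) x.1 w)).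
    move: hx hy => /psl_homogP[A [hA sA ->]] /psl_homogP[B [hB sB ->]].
    move=> /psl_homogP[C [hC sC ->]].
    have sbr X Y : gl_br X Y \in sl22 K by rewrite sl22P supertrace_br.
    rewrite !psl_class_br // !omega_psl_class //.
    by apply: (omega_jacobi k hA hB hC); apply/eqP; rewrite -sl22P.
  have [z0 [z1 [h0 h1 e]]] := homog_dec (psl_lie K) z.1.
  have brD u : br (psl_lie K) u (z0 + z1) = br (psl_lie K) u z0 + br (psl_lie K) u z1.
    by rewrite linearD.
  change (omega k (mat x.1) (mat (br (psl_lie K) y.1 z.1)) =
      omega k (mat (br (psl_lie K) x.1 y.1)) (mat z.1) +
      ssign K a b * omega k (mat y.1) (mat (br (psl_lie K) x.1 z.1))).
  rewrite e !brD ![mat (_ + _)]linearD !omegaDr.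
  by rewrite (key _ _ h0) (key _ _ h1) mulrDr addrACA.
Defined.

Definition ext_proj (u : psl_ext) : psl22 K := u.1.
Lemma ext_proj_linear : linear ext_proj. Proof. by []. Qed.
HB.instance Definition _ :=
  GRing.isLinear.Build K psl_ext (psl22 K) _ ext_proj ext_proj_linear.

Lemma ext_central : central_extension ext_lie (psl_lie K) ext_proj.
Proof.
split=> [|y|z z0 x]; first by split=> [b x []|].
  by exists (y, 0).
have {}z0 : z.1 = 0 := z0.
congr (_, _); first by rewrite z0; apply: (br0l (psl_lie K)).
apply/rowP=> k; rewrite !mxE z0 linear0.
by apply: omega_even; rewrite /gl_homog linear0.
Qed.

End Model.

Lemma comb4P (K : fieldType) (V : lmodType K) (a c1 c2 c3 d1 d2 d3 : K)
    (t u x y z : V) :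
  a *: t + u + (a * c1 + d1) *: x + (a * c2 + d2) *: y + (a * c3 + d3) *: z =
  a *: (t + c1 *: x + c2 *: y + c3 *: z) + (u + d1 *: x + d2 *: y + d3 *: z).
Proof.
rewrite !scalerDl -!scalerA !scalerDr.
by rewrite (addrACA (a *: t)) (addrACA (a *: t + _)) (addrACA (a *: t + _ + _)).
Qed.

Lemma comb4N (K : fieldType) (V : lmodType K) (e c1 c2 c3 : K) (t x y z : V) :
  - (e *: (t + c1 *: x + c2 *: y + c3 *: z)) =
  - (e *: t) + (- (e * c1)) *: x + (- (e * c2)) *: y + (- (e * c3)) *: z.
Proof. by rewrite !scalerDr !opprD !scalerA !scaleNr. Qed.

Lemma sum_cancel (V : zmodType) (z v w a b : V) :
  z + v + w + (a - v) + (b - w) = a + b + z.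
Proof.
rewrite [RHS]addrC -!addrA (addrCA v w) (addrCA v a) addNKr.
by rewrite (addrCA w a) (addrCA w b) subrr addr0.
Qed.

(** * Brackets of lifts in an arbitrary central extension *)

Section Lift.
Variables (K : numFieldType) (L : vectType K) (s : lieSuper L).
Variable p : {linear L -> psl22 K}.
Hypothesis pce : central_extension s (psl_lie K) p.
Implicit Types A B C : 'M[K]_4.
Local Notation beta := (lift_br s p).
Local Notation E i j := (delta_mx i j : 'M[K]_4).

Lemma liftK u : p ((linfun p)^-1%VF u) = u.
Proof.
have [_ surj _] := pce; have [v <-] := surj u; rewrite -[LHS](lfunE p).
by apply: limg_lfunVK; rewrite -(lfunE p) memv_img ?memvf.
Qed.

Lemma beta_linl B : linear (beta^~ B).
Proof. by move=> a A A'; rewrite /lift_br linearP linearP brPl. Qed.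
Lemma beta_linr A : linear (beta A).
Proof. by move=> a B B'; rewrite /lift_br linearP linearP linearP. Qed.

Lemma lift_homog b y : homog (psl_lie K) b y -> exists2 x, homog s b x & p x = y.
Proof.
move=> hy; have [[hp _] surj _] := pce; have [x e] := surj y.
have [x0 [x1 [h0 h1 ex]]] := homog_dec s x.
have [k0 k1] := (hp _ _ h0, hp _ _ h1).
have e01 : y = p x0 + p x1 by rewrite -e ex linearD.
case: b hy => hy.
- exists x1 => //; have : p x0 = y - p x1 by rewrite e01 addrK.
  move=> h; have -> : y = p x1 + p x0 by rewrite addrC.
  suff -> : p x0 = 0 by rewrite addr0.
  by apply: (homog_disj k0); rewrite h; apply: homogD => //; apply: homogN.
- exists x0 => //; have : p x1 = y - p x0 by rewrite e01 addrC addKr.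
  move=> h; rewrite e01; suff -> : p x1 = 0 by rewrite addr0.
  by apply: (@homog_disj _ _ (psl_lie K)) => //; rewrite h;
    apply: homogD => //; apply: homogN.
Qed.

Lemma class_lift b A : gl_homog b A -> A \in sl22 K ->
  exists2 x, homog s b x & p x = psl_class A.
Proof. by move=> hA sA; apply/lift_homog/psl_class_homog. Qed.

Lemma beta_anti a b A B : gl_homog a A -> gl_homog b B -> A \in sl22 K ->
  B \in sl22 K -> beta A B = - (ssign K a b *: beta B A).
Proof.
move=> hA hB sA sB; have [x hx ex] := class_lift hA sA.
have [y hy ey] := class_lift hB sB.
by rewrite (lift_brE pce ex ey) (lift_brE pce ey ex) (br_anti hx hy).
Qed.

Lemma sl_br A B : gl_br A B \in sl22 K.
Proof. by rewrite sl22P supertrace_br. Qed.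

Lemma p_br x y A B : p x = psl_class A -> p y = psl_class B ->
  A \in sl22 K -> B \in sl22 K -> p (br s x y) = psl_class (gl_br A B).
Proof.
have [[_ hp] _ _] := pce.
by move=> ex ey sA sB; rewrite hp ex ey psl_class_br.
Qed.

Lemma beta_jacobi a b c A B C : gl_homog a A -> gl_homog b B -> gl_homog c C ->
  A \in sl22 K -> B \in sl22 K -> C \in sl22 K ->
  beta A (gl_br B C) = beta (gl_br A B) C + ssign K a b *: beta B (gl_br A C).
Proof.
move=> hA hB hC sA sB sC; have [x hx ex] := class_lift hA sA.
have [y hy ey] := class_lift hB sB; have [z hz ez] := class_lift hC sC.
rewrite (lift_brE pce ex (p_br ey ez sB sC)) (lift_brE pce (p_br ex ey sA sB) ez).
by rewrite (lift_brE pce ey (p_br ex ez sA sC)) (br_jacobi _ hx hy).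
Qed.

(** A generic diagonal matrix of supertrace 0: its roots are 2, 8, 3 and 5 up to sign, so two root
    vectors have total weight 0 only if their roots are opposite or if, as for E13 and E24, the
    total is the supertrace up to sign. Integer values let these totals be computed. *)
Definition wti (i : 'I_4) : int := nth 0 [:: 1; -1; 4%:Z; - 4%:Z] i.
Definition wt i : K := (wti i)%:~R.
Definition Hwt : 'M[K]_4 := \matrix_(i, j) (wt i *+ (i == j)).

Lemma wt_eq (n : int) i j k l : wti i - wti j + wti k - wti l = n ->
  wt i - wt j + wt k - wt l = n%:~R.
Proof. by move=> <-; rewrite !rmorphB rmorphD rmorphB. Qed.

Lemma wt_neq i j : i != j -> wt i - wt j != 0.
Proof.
by rewrite -rmorphB intr_eq0; elim/I4_ind: i; elim/I4_ind: j.
Qed.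

Lemma Hwt_homog : gl_homog false Hwt.
Proof.
apply/matrixP=> i j; rewrite !mxE; case: eqP => //.
by case: (eqVneq i j) => [->|]; rewrite ?addbb.
Qed.

Lemma Hwt_sl : Hwt \in sl22 K.
Proof.
rewrite sl22P supertrace4 !mxE !eqxx !mulr1n -!rmorphD -!rmorphB.
by rewrite intr_eq0.
Qed.

Lemma E_homog i j : gl_homog (ipar i (+) ipar j) (E i j).
Proof.
apply/matrixP=> k l; rewrite !mxE.
by have [->|_] := eqVneq k i; have [->|_] := eqVneq l j; rewrite ?eqxx //=; case: ifP.
Qed.

Lemma E_sl i j : i != j -> E i j \in sl22 K.
Proof.
rewrite sl22P => ij; rewrite /supertrace big1 // => k _; rewrite mxE.
by case: eqP => [->|]; rewrite ?mulr0 // (negbTE ij) mulr0.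
Qed.

Lemma br_E i j k l : gl_br (E i j) (E k l) =
  E i l *+ (j == k) - ssign K (ipar i (+) ipar j) (ipar k (+) ipar l) *: (E k j *+ (l == i)).
Proof. by rewrite (gl_brE (E_homog i j) (E_homog k l)) -!mul_delta_mx_cond. Qed.

Lemma Hwt_diag : Hwt = diag_mx (\row_i wt i).
Proof. by apply/matrixP=> k l; rewrite !mxE; case: eqP => [->|]. Qed.

Lemma br_HE i j : gl_br Hwt (E i j) = (wt i - wt j) *: E i j.
Proof.
rewrite (gl_brE Hwt_homog (E_homog i j)) /ssign /= expr0 scale1r.
rewrite Hwt_diag.
apply/matrixP=> k l; rewrite -!mulmxE mul_diag_mx mul_mx_diag !mxE.
have [->|_] := eqVneq k i; have [->|_] := eqVneq l j; rewrite ?mulr1 ?mulr0 /=; ring.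
Qed.

(* A linear section of [p] modulo scalars: [Hwt] acts on the root vectors with
   distinct nonzero weights, so brackets with it lift them canonically.
   Locked, as patterns such as [scalerDr] would unfold the sums. *)
Fact tau_key : unit. Proof. exact: tt. Qed.
Definition tau A : L := locked_with tau_key (
  \sum_i \sum_j (if i == j then 0 else (A i j / (wt i - wt j)) *: beta Hwt (E i j))
  + ((A o0 o0 - A o1 o1) / 2) *: beta (E o0 o1) (E o1 o0)
  + ((A o2 o2 - A o3 o3) / 2) *: beta (E o2 o3) (E o3 o2)).

Lemma tau_def A : tau A =
  \sum_i \sum_j (if i == j then 0 else (A i j / (wt i - wt j)) *: beta Hwt (E i j))
  + ((A o0 o0 - A o1 o1) / 2) *: beta (E o0 o1) (E o1 o0)
  + ((A o2 o2 - A o3 o3) / 2) *: beta (E o2 o3) (E o3 o2).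
Proof. by rewrite /tau unlock. Qed.

Lemma tau_linear : linear tau.
Proof.
move=> a A B; rewrite !tau_def !scalerDr addrACA; congr (_ + _); last first.
  by rewrite scalerA -scalerDl !mxE; congr (_ *: _); ring.
rewrite addrACA; congr (_ + _); last first.
  by rewrite scalerA -scalerDl !mxE; congr (_ *: _); ring.
rewrite scaler_sumr -big_split; apply: eq_bigr => i _.
rewrite scaler_sumr -big_split; apply: eq_bigr => j _ /=.
case: eqP => _; first by rewrite scaler0 addr0.
by rewrite scalerA -scalerDl !mxE; congr (_ *: _); ring.
Qed.
HB.instance Definition _ := GRing.isLinear.Build K 'M[K]_4 L _ tau tau_linear.

Lemma tauE i j : i != j -> tau (E i j) = (wt i - wt j)^-1 *: beta Hwt (E i j).
Proof.
move=> ij; rewrite tau_def; have e k : (E i j) k k = 0.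
  by rewrite mxE; case: eqP => [->|//]; rewrite (negbTE ij).
rewrite !e !subrr !mul0r !scale0r !addr0 (bigD1 i) //= (bigD1 j) //= (negbTE ij).
rewrite [X in _ + X + _]big1 => [|l /negbTE nl]; last first.
  by case: eqP => // _; rewrite mxE eqxx nl /= mul0r scale0r.
rewrite big1 ?addr0 => [|k /negbTE nk]; last first.
  by rewrite big1 // => l _; case: eqP => // _; rewrite mxE nk /= mul0r scale0r.
by rewrite mxE !eqxx mul1r.
Qed.

(** Compares the bracket of lifts with the cocycle of the model. Once this holds on all of sl(2|2),
    [tau] and the three central elements define a homomorphism from the model to [L]. *)
Definition good A B : Prop :=
  beta A B = tau (gl_br A B) + omega k0 A B *: z_pos s p +
    omega k1 A B *: z_neg s p + omega k2 A B *: z_one s p.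

Lemma good_linl a A A' B : good A B -> good A' B -> good (a *: A + A') B.
Proof.
by rewrite /good beta_linl gl_br_linl tau_linear !omegaPl comb4P => <- <-.
Qed.

Lemma good_linr a A B B' : good A B -> good A B' -> good A (a *: B + B').
Proof.
by rewrite /good beta_linr gl_br_linr tau_linear !omegaPr comb4P => <- <-.
Qed.

Lemma good_sym a b A B : gl_homog a A -> gl_homog b B -> A \in sl22 K ->
  B \in sl22 K -> good A B -> good B A.
Proof.
move=> hA hB sA sB; move=> e; rewrite /good (beta_anti hB hA sB sA) e comb4N.
have -> : tau (gl_br B A) = - (ssign K b a *: tau (gl_br A B)).
  by rewrite (gl_br_anti hB hA) linearN linearZ.
have om k : omega k B A = - (ssign K b a * omega k A B).
  rewrite (omegaC _ B A); clear e.
  case: a b hA hB => [] [] hA hB; rewrite /ssign /= ?expr0 ?expr1 ?mulN1r ?opprK //;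
  by rewrite ?(omega_even _ _ hA) ?mulr0 ?oppr0 // omegaC (omega_even _ _ hB) mulr0 oppr0.
by rewrite !om.
Qed.

Lemma gl_brZl a A B : gl_br (a *: A) B = a *: gl_br A B.
Proof.
by have := brPl (gl_lie K) B a A 0; rewrite !addr0 [br _ 0 _](br0l (gl_lie K)) addr0.
Qed.

Lemma gl_brZr a A B : gl_br A (a *: B) = a *: gl_br A B.
Proof.
have e0 : gl_br A 0 = 0 := linear0 (br (gl_lie K) A).
by have := gl_br_linr A a B 0; rewrite !addr0 e0 addr0.
Qed.

Lemma tau_wt n A : n != 0 -> (forall i j, A i j * (wt i - wt j - n) = 0) ->
  tau A = n^-1 *: beta Hwt A.
Proof.
move=> n0 hA; have diag i : A i i = 0.
  by have /eqP := hA i i; rewrite subrr sub0r mulrN oppr_eq0 mulf_eq0 (negbTE n0) orbF => /eqP.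
pose f := HB.pack_for {linear 'M[K]_4 -> L} (beta Hwt)
  (GRing.isLinear.Build _ _ _ _ _ (beta_linr Hwt)).
rewrite tau_def !diag subrr !mul0r !scale0r !addr0.
rewrite [X in beta _ X]matrix_sum_delta -[beta _ _]/(f _) linear_sum scaler_sumr.
apply: eq_bigr => i _; rewrite linear_sum scaler_sumr; apply: eq_bigr => j _.
rewrite linearZ /=; case: (eqVneq i j) => [->|ij].
  by rewrite diag scale0r scaler0.
rewrite scalerA; congr (_ *: _); have /eqP := hA i j.
rewrite mulf_eq0 subr_eq0 => /orP[/eqP ->|/eqP ->]; first by rewrite mul0r mulr0.
exact: mulrC.
Qed.

(** If both entries were nonzero, a and b would be the weights of their positions, which add up to
    0. *)
Lemma wt_cross a b A B i j k l : (forall i j, A i j * (wt i - wt j - a) = 0) ->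
  (forall i j, B i j * (wt i - wt j - b) = 0) -> a + b != 0 ->
  wti i - wti j + wti k - wti l = 0 -> A i j * B k l = 0.
Proof.
move=> hA hB ab w; have {}w := wt_eq w.
apply/eqP; rewrite -(inj_eq (mulfI ab)) mulr0; apply/eqP.
have -> : (a + b) * (A i j * B k l) = - (A i j * (wt i - wt j - a) * B k l)
   - A i j * (B k l * (wt k - wt l - b)) + (wt i - wt j + wt k - wt l) * (A i j * B k l).
  by ring.
by rewrite hA hB w mul0r !mulr0 mul0r oppr0 !addr0.
Qed.

(** By the Jacobi identity, bracketing [Hwt] with [A, B] gives a + b times the bracket of the lifts;
    dividing by a + b yields [tau] through [tau_wt]. The cocycle terms vanish because [omega] pairs
    only positions of opposite weight. *)
Lemma good_wt c d a b A B : gl_homog c A -> gl_homog d B -> A \in sl22 K ->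
  B \in sl22 K -> gl_br Hwt A = a *: A -> gl_br Hwt B = b *: B -> a + b != 0 ->
  good A B.
Proof.
move=> hA hB sA sB wA wB ab.
have entry X n : gl_br Hwt X = n *: X -> forall i j, X i j * (wt i - wt j - n) = 0.
  move=> + i j => /matrixP /(_ i j); rewrite [RHS]mxE => e.
  have : gl_br Hwt X i j = (wt i - wt j) * X i j.
    have lin A1 : gl_br Hwt A1 = \sum_k \sum_l A1 k l *: gl_br Hwt (E k l).
      pose f := HB.pack_for {linear 'M[K]_4 -> 'M[K]_4} (gl_br Hwt)
        (GRing.isLinear.Build _ _ _ _ _ (gl_br_linr Hwt)).
      rewrite {1}[A1]matrix_sum_delta -[gl_br _ _]/(f _) linear_sum.
      by apply: eq_bigr => k _; rewrite linear_sum; apply: eq_bigr => l _; rewrite linearZ.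
    rewrite lin summxE (bigD1 i) //= summxE (bigD1 j) //= br_HE !mxE !eqxx mulr1.
    rewrite !big1 => [|k nk|l nl]; first by rewrite !addr0 mulrC.
      rewrite summxE big1 // => l _; rewrite br_HE !mxE eq_sym (negbTE nk) /=.
      by rewrite !mulr0.
    by rewrite br_HE !mxE eqxx eq_sym (negbTE nl) /= !mulr0.
  by rewrite e => e'; rewrite mulrBr [_ * n]mulrC e' mulrC subrr.
have [eA eB] := (entry _ _ wA, entry _ _ wB).
have om k : omega k A B = 0.
  have := wt_cross eA eB ab => h.
  by case: k => [[|[|n]] lt]; rewrite /omega /= !h // ?subr0 ?addr0 ?mulr0 ?subr0.
rewrite /good !om !scale0r !addr0.
have wAB : gl_br Hwt (gl_br A B) = (a + b) *: gl_br A B.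
  rewrite (gl_br_jacobi _ Hwt_homog hA) wA wB /ssign /= expr0 scale1r scalerDl.
  by rewrite gl_brZl gl_brZr.
rewrite (tau_wt ab (entry _ _ wAB)).
rewrite (beta_jacobi Hwt_homog hA hB Hwt_sl sA sB) wA wB /ssign /= expr0 scale1r.
have -> : beta (a *: A) B = a *: beta A B.
  have := beta_linl B a A 0; rewrite !addr0 => ->.
  by rewrite /lift_br linear0 linear0 br0l addr0.
have -> : beta A (b *: B) = b *: beta A B.
  have := beta_linr A b B 0; rewrite !addr0 => ->.
  by rewrite /lift_br [psl_class 0]linear0 linear0 linear0 addr0.
by rewrite -scalerDl scalerA mulVf // scale1r.
Qed.

Definition h1 : 'M[K]_4 := E o0 o0 - E o1 o1.
Definition h2 : 'M[K]_4 := E o2 o2 - E o3 o3.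

Lemma h1_homog : gl_homog false h1.
Proof. by rewrite /gl_homog linearB /= (E_homog o0 o0) (E_homog o1 o1). Qed.

Lemma h2_homog : gl_homog false h2.
Proof. by rewrite /gl_homog linearB /= (E_homog o2 o2) (E_homog o3 o3). Qed.

Lemma h1_sl : h1 \in sl22 K.
Proof. by rewrite sl22P supertrace4 !mxE /=; apply/eqP; ring. Qed.

Lemma h2_sl : h2 \in sl22 K.
Proof. by rewrite sl22P supertrace4 !mxE /=; apply/eqP; ring. Qed.

Lemma br_E_E1 i j : i != j -> gl_br (E i j) (E j i) =
  E i i - ssign K (ipar i (+) ipar j) (ipar i (+) ipar j) *: E j j.
Proof. by move=> ij; rewrite br_E !eqxx !mulr1n (addbC (ipar j)). Qed.

Lemma br_Hh1 : gl_br Hwt h1 = 0 *: h1.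
Proof.
have -> : h1 = (- 1) *: E o1 o1 + E o0 o0 by rewrite scaleN1r addrC.
by rewrite gl_br_linr !br_HE !subrr !scale0r scaler0 addr0.
Qed.

Lemma br_Hh2 : gl_br Hwt h2 = 0 *: h2.
Proof.
have -> : h2 = (- 1) *: E o3 o3 + E o2 o2 by rewrite scaleN1r addrC.
by rewrite gl_br_linr !br_HE !subrr !scale0r scaler0 addr0.
Qed.

Lemma good_E_wt i j k l : i != j -> k != l ->
  wti i - wti j + (wti k - wti l) != 0 -> good (E i j) (E k l).
Proof.
move=> ij kl w; apply: (good_wt (E_homog i j) (E_homog k l) (E_sl ij) (E_sl kl)
  (br_HE i j) (br_HE k l)).
by rewrite -!rmorphB -rmorphD intr_eq0.
Qed.

Lemma Emx_E (i j : nat) (a b : 'I_4) : i.-1 = a -> j.-1 = b -> Emx K i j = E a b.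
Proof. by move=> ea eb; rewrite /Emx ea eb !inord_val. Qed.

Lemma z_posE : z_pos s p = beta (E o0 o2) (E o1 o3).
Proof. by rewrite /z_pos (@Emx_E 1 3 o0 o2) // (@Emx_E 2 4 o1 o3). Qed.

Lemma z_negE : z_neg s p = beta (E o2 o0) (E o3 o1).
Proof. by rewrite /z_neg (@Emx_E 3 1 o2 o0) // (@Emx_E 4 2 o3 o1). Qed.

Lemma z_oneE : z_one s p = beta (E o0 o2) (E o2 o0) + beta (E o1 o3) (E o3 o1).
Proof.
by rewrite /z_one (@Emx_E 1 3 o0 o2) // (@Emx_E 3 1 o2 o0) // (@Emx_E 2 4 o1 o3) //
  (@Emx_E 4 2 o3 o1).
Qed.

Lemma tau_h1 : tau h1 = beta (E o0 o1) (E o1 o0).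
Proof.
rewrite tau_def (_ : (h1 o0 o0 - h1 o1 o1) / 2 = 1); last by rewrite !mxE /=; field.
rewrite (_ : (h1 o2 o2 - h1 o3 o3) / 2 = 0); last by rewrite !mxE /=; field.
rewrite scale1r scale0r addr0 big1 ?add0r // => i _; rewrite big1 // => j _.
case: eqP => // /eqP ij; rewrite !mxE.
by elim/I4_ind: i ij; elim/I4_ind: j => //= _; rewrite ?subrr ?subr0 mul0r scale0r.
Qed.

Lemma tau_h2 : tau h2 = beta (E o2 o3) (E o3 o2).
Proof.
rewrite tau_def (_ : (h2 o0 o0 - h2 o1 o1) / 2 = 0); last by rewrite !mxE /=; field.
rewrite (_ : (h2 o2 o2 - h2 o3 o3) / 2 = 1); last by rewrite !mxE /=; field.
rewrite scale1r scale0r addr0 big1 ?add0r // => i _; rewrite big1 // => j _.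
case: eqP => // /eqP ij; rewrite !mxE.
by elim/I4_ind: i ij; elim/I4_ind: j => //= _; rewrite ?subrr ?subr0 mul0r scale0r.
Qed.

(* The brackets of opposite weight that are not definitions are obtained from
   [u = [E13, E31]] by conjugating with the even root vectors. *)
Let u := beta (E o0 o2) (E o2 o0).

Lemma beta_jac_E i j k l m n : i != j -> k != l -> m != n ->
  beta (gl_br (E i j) (E k l)) (E m n) = beta (E i j) (gl_br (E k l) (E m n))
   - ssign K (ipar i (+) ipar j) (ipar k (+) ipar l) *: beta (E k l) (gl_br (E i j) (E m n)).
Proof.
move=> ij kl mn.
by rewrite (beta_jacobi (E_homog i j) (E_homog k l) (E_homog m n)) ?E_sl // addrK.
Qed.

Lemma betaNr A B : beta A (- B) = - beta A B.
Proof.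
have e0 : beta A 0 = 0 by rewrite /lift_br [psl_class 0]linear0 linear0 linear0.
by have := beta_linr A (-1) B 0; rewrite !addr0 e0 addr0 !scaleN1r.
Qed.

Lemma betaNl A B : beta (- A) B = - beta A B.
Proof.
have e0 : beta 0 B = 0 by rewrite /lift_br [psl_class 0]linear0 linear0 br0l.
by have := beta_linl B (-1) A 0; rewrite !addr0 e0 addr0 !scaleN1r.
Qed.

Lemma beta0r A : beta A 0 = 0.
Proof. by rewrite /lift_br [psl_class 0]linear0 linear0 linear0. Qed.

Ltac brc := rewrite br_E /ssign /= ?mulr1n ?mulr0n ?expr0 ?expr1 ?scale1r
  ?scaleN1r ?scaler0 ?subr0 ?sub0r ?opprK ?oppr0 ?add0r ?addr0 //.

Let br_23_02 : gl_br (E o2 o3) (E o0 o2) = - E o0 o3. Proof. brc. Qed.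
Let br_02_30 : gl_br (E o0 o2) (E o3 o0) = E o3 o2. Proof. brc. Qed.
Let br_23_30 : gl_br (E o2 o3) (E o3 o0) = E o2 o0. Proof. brc. Qed.
Let br_10_02 : gl_br (E o1 o0) (E o0 o2) = E o1 o2. Proof. brc. Qed.
Let br_02_21 : gl_br (E o0 o2) (E o2 o1) = E o0 o1. Proof. brc. Qed.
Let br_10_21 : gl_br (E o1 o0) (E o2 o1) = - E o2 o0. Proof. brc. Qed.
Let br_10_03 : gl_br (E o1 o0) (E o0 o3) = E o1 o3. Proof. brc. Qed.
Let br_03_31 : gl_br (E o0 o3) (E o3 o1) = E o0 o1. Proof. brc. Qed.
Let br_10_31 : gl_br (E o1 o0) (E o3 o1) = - E o3 o0. Proof. brc. Qed.
Let br_02_03 : gl_br (E o0 o2) (E o0 o3) = 0. Proof. brc. Qed.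
Let br_23_31 : gl_br (E o2 o3) (E o3 o1) = E o2 o1. Proof. brc. Qed.
Let br_31_30 : gl_br (E o3 o1) (E o3 o0) = 0. Proof. brc. Qed.

Lemma beta_03_30 : beta (E o0 o3) (E o3 o0) = u - tau h2.
Proof.
have := @beta_jac_E o2 o3 o0 o2 o3 o0 isT isT isT.
rewrite br_23_02 br_02_30 br_23_30 /ssign /= expr0 scale1r betaNl -tau_h2 -/u => e.
by rewrite -[LHS]opprK e opprB.
Qed.

Lemma beta_10_01 : beta (E o1 o0) (E o0 o1) = - tau h1.
Proof.
rewrite (beta_anti (E_homog o1 o0) (E_homog o0 o1)) ?E_sl // /ssign /= expr0 scale1r.
by rewrite tau_h1.
Qed.

Lemma beta_12_21 : beta (E o1 o2) (E o2 o1) = u - tau h1.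
Proof.
have := @beta_jac_E o1 o0 o0 o2 o2 o1 isT isT isT.
rewrite br_10_02 br_02_21 br_10_21 /ssign /= expr0 scale1r betaNr opprK beta_10_01.
by rewrite -/u addrC.
Qed.

Lemma beta_13_31 : beta (E o1 o3) (E o3 o1) = u - tau h1 - tau h2.
Proof.
have := @beta_jac_E o1 o0 o0 o3 o3 o1 isT isT isT.
rewrite br_10_03 br_03_31 br_10_31 /ssign /= expr0 scale1r betaNr opprK beta_10_01.
by rewrite beta_03_30 => ->; rewrite addrCA addrA.
Qed.

Lemma beta_12_03 : beta (E o1 o2) (E o0 o3) = - z_pos s p.
Proof.
have := @beta_jac_E o1 o0 o0 o2 o0 o3 isT isT isT.
rewrite br_10_02 br_02_03 br_10_03 /ssign /= expr0 scale1r beta0r sub0r => ->.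
by rewrite z_posE.
Qed.

Lemma beta_21_30 : beta (E o2 o1) (E o3 o0) = - z_neg s p.
Proof.
have := @beta_jac_E o2 o3 o3 o1 o3 o0 isT isT isT.
rewrite br_23_31 br_31_30 br_23_30 /ssign /= expr0 scale1r beta0r sub0r => ->.
rewrite (beta_anti (E_homog o3 o1) (E_homog o2 o0)) ?E_sl // /ssign /= expr1 scaleN1r.
by rewrite opprK z_negE.
Qed.

(** The second summand of [z_one] is u - tau h1 - tau h2, so the normalisation of [z_one] determines
    u. *)
Lemma twice_u : u = 2^-1 *: (z_one s p + tau h1 + tau h2).
Proof.
rewrite z_oneE -/u beta_13_31; move: u (tau h1) (tau h2) => x y z.
have -> : x + (x - y - z) + y + z = x + x.
  by rewrite -!addrA (addrCA (- z)) addNr addr0 addNr addr0.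
by rewrite -mulr2n -scaler_nat scalerA mulVf ?scale1r // Num.Theory.pnatr_eq0.
Qed.

Lemma tau_diag (a b c d : K) :
  tau (a *: E o0 o0 + b *: E o1 o1 + c *: E o2 o2 + d *: E o3 o3) =
  ((a - b) / 2) *: tau h1 + ((c - d) / 2) *: tau h2.
Proof.
rewrite tau_h1 tau_h2 tau_def big1 ?add0r => [|i _].
  by congr (_ *: _ + _ *: _); rewrite !mxE /=; ring.
rewrite big1 // => j _; case: eqP => // /eqP ij; rewrite !mxE.
by elim/I4_ind: i ij; elim/I4_ind: j => //= _; rewrite !mulr0 !addr0 mul0r scale0r.
Qed.

Lemma br_EE_odd i j : i != j -> ipar i (+) ipar j ->
  gl_br (E i j) (E j i) = E i i + E j j.
Proof. by move=> ij h; rewrite br_E_E1 // /ssign h /= expr1 scaleN1r opprK. Qed.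

Lemma good_01_10 : good (E o0 o1) (E o1 o0).
Proof.
rewrite /good -tau_h1 br_E_E1 // /ssign /= expr0 scale1r -/h1.
by rewrite !(omega_even _ _ (E_homog o0 o1)) !scale0r !addr0.
Qed.

Lemma good_23_32 : good (E o2 o3) (E o3 o2).
Proof.
rewrite /good -tau_h2 br_E_E1 // /ssign /= expr0 scale1r -/h2.
by rewrite !(omega_even _ _ (E_homog o2 o3)) !scale0r !addr0.
Qed.

Lemma good_zero A B (a b c : K) : gl_br A B = 0 -> omega k0 A B = a ->
  omega k1 A B = b -> omega k2 A B = c ->
  beta A B = a *: z_pos s p + b *: z_neg s p + c *: z_one s p -> good A B.
Proof. by rewrite /good => -> -> -> -> ->; rewrite linear0 add0r. Qed.

Lemma good_02_13 : good (E o0 o2) (E o1 o3).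
Proof.
apply: (@good_zero _ _ 1 0 0); try by rewrite /omega !mxE /=; ring.
  by brc.
by rewrite !scale0r !addr0 scale1r z_posE.
Qed.

Lemma good_12_03 : good (E o1 o2) (E o0 o3).
Proof.
apply: (@good_zero _ _ (-1) 0 0); try by rewrite /omega !mxE /=; ring.
  by brc.
by rewrite !scale0r !addr0 scaleN1r beta_12_03.
Qed.

Lemma good_20_31 : good (E o2 o0) (E o3 o1).
Proof.
apply: (@good_zero _ _ 0 1 0); try by rewrite /omega !mxE /=; ring.
  by brc.
by rewrite !scale0r addr0 add0r scale1r z_negE.
Qed.

Lemma good_21_30 : good (E o2 o1) (E o3 o0).
Proof.
apply: (@good_zero _ _ 0 (-1) 0); try by rewrite /omega !mxE /=; ring.
  by brc.
by rewrite !scale0r addr0 add0r scaleN1r beta_21_30.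
Qed.

(** The shifts by 2^-1 compensate the halves of [tau h1] and [tau h2] contained in u; the remaining
    half of [z_one] is the value of [omega k2]. *)
Lemma good_odd i j (a b c d : K) : i != j -> ipar i (+) ipar j ->
  E i i + E j j = a *: E o0 o0 + b *: E o1 o1 + c *: E o2 o2 + d *: E o3 o3 ->
  beta (E i j) (E j i) = u + ((a - b) / 2 - 2^-1) *: tau h1 +
    ((c - d) / 2 - 2^-1) *: tau h2 ->
  omega k0 (E i j) (E j i) = 0 -> omega k1 (E i j) (E j i) = 0 ->
  omega k2 (E i j) (E j i) = 2^-1 -> good (E i j) (E j i).
Proof.
move=> ij odd e eb o_0 o_1 o_2; rewrite /good br_EE_odd // e tau_diag o_0 o_1 o_2 eb.
rewrite !scale0r !addr0 twice_u 2!scalerDr !scalerBl.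
move: (_ *: z_one s p) (2^-1 *: tau h1) (2^-1 *: tau h2) => z v w.
exact: sum_cancel.
Qed.

Lemma good_02_20 : good (E o0 o2) (E o2 o0).
Proof.
apply: (@good_odd _ _ 1 0 1 0) => //; try by rewrite /omega !mxE /=; ring.
  by rewrite !scale1r !scale0r !addr0.
by rewrite !subr0 !mul1r !subrr !scale0r !addr0.
Qed.

Lemma good_03_30 : good (E o0 o3) (E o3 o0).
Proof.
apply: (@good_odd _ _ 1 0 0 1) => //; try by rewrite /omega !mxE /=; ring.
  by rewrite !scale1r !scale0r !addr0.
rewrite beta_03_30 subr0 mul1r subrr scale0r addr0; congr (_ + _).
by rewrite -scaleN1r; congr (_ *: _); field.
Qed.

Lemma good_12_21 : good (E o1 o2) (E o2 o1).
Proof.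
apply: (@good_odd _ _ 0 1 1 0) => //; try by rewrite /omega !mxE /=; ring.
  by rewrite !scale1r !scale0r !addr0 add0r.
rewrite beta_12_21 subr0 mul1r subrr scale0r addr0; congr (_ + _).
by rewrite -scaleN1r; congr (_ *: _); field.
Qed.

Lemma good_13_31 : good (E o1 o3) (E o3 o1).
Proof.
apply: (@good_odd _ _ 0 1 0 1) => //; try by rewrite /omega !mxE /=; ring.
  by rewrite !scale1r !scale0r !addr0 add0r.
rewrite beta_13_31; congr (_ + _ + _);
  by rewrite -scaleN1r; congr (_ *: _); field.
Qed.

(** Only pairs of total weight 0 escape [good_E_wt]; up to order these are the ten pairs treated
    above. *)
Lemma good_E i j k l : i != j -> k != l -> good (E i j) (E k l).
Proof.
move=> ij kl; have [w|] := eqVneq (wti i - wti j + (wti k - wti l)) 0; last first.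
  exact: good_E_wt.
have sym : good (E k l) (E i j) -> good (E i j) (E k l).
  by apply: (good_sym (E_homog k l) (E_homog i j)); rewrite E_sl.
elim/I4_ind: i ij w sym => ij; elim/I4_ind: j ij => // ij w;
  elim/I4_ind: k kl w => kl; elim/I4_ind: l kl => // kl w sym;
  first [ by [] | by move: (w) | exact: good_01_10 | exact: good_23_32 | exact: good_02_13 | exact: good_12_03
    | exact: good_20_31 | exact: good_21_30 | exact: good_02_20 | exact: good_03_30
    | exact: good_12_21 | exact: good_13_31
    | apply: sym; first [ exact: good_01_10 | exact: good_23_32 | exact: good_02_13 | exact: good_12_03
    | exact: good_20_31 | exact: good_21_30 | exact: good_02_20 | exact: good_03_30
    | exact: good_12_21 | exact: good_13_31 ] ].
Qed.

Lemma sl22_ind (P : 'M[K]_4 -> Prop) : P 0 ->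
  (forall a A B, P A -> P B -> P (a *: A + B)) ->
  (forall i j, i != j -> P (E i j)) -> P h1 -> P h2 -> P 1%:M ->
  forall A, A \in sl22 K -> P A.
Proof.
move=> P0 PD PE Ph1 Ph2 P1 A; rewrite sl22P supertrace4 => /eqP sA.
have PD' X Y : P X -> P Y -> P (X + Y).
  by move=> hX hY; rewrite -[X]scale1r; apply: PD.
have PZ a X : P X -> P (a *: X) by move=> hX; rewrite -[_ *: _]addr0; apply: PD.
have -> : A = (\sum_i \sum_(j | i != j) A i j *: E i j) +
    (((A o0 o0 - A o1 o1) / 2) *: h1 + (((A o2 o2 - A o3 o3) / 2) *: h2 +
    ((A o0 o0 + A o1 o1) / 2) *: 1%:M)).
  rewrite {1}[A]matrix_sum_delta.
  have e i : \sum_j A i j *: E i j = \sum_(j | i != j) A i j *: E i j + A i i *: E i i.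
    by rewrite (bigD1 i) //= addrC; congr (_ + _); apply: eq_bigl => j; rewrite eq_sym.
  under eq_bigr do rewrite e.
  rewrite big_split /=; congr (_ + _); rewrite sum4.
  apply/matrixP=> i j; rewrite !mxE.
  have e3 : A o3 o3 = A o0 o0 + A o1 o1 - A o2 o2.
    by apply/eqP; rewrite eq_sym -subr_eq0 sA.
  by elim/I4_ind: i; elim/I4_ind: j; rewrite /= ?e3; field.
apply: (PD'); first by elim/big_ind: _ => // i _; elim/big_ind: _ => // j ij; apply/PZ/PE.
by apply: (PD'); [apply: PZ | apply: (PD'); apply: PZ].
Qed.

Theorem good_sl A B : A \in sl22 K -> B \in sl22 K -> good A B.
Proof.
have g0r X : good X 0.
  by rewrite /good beta0r (omegaC _ X) (omegaC _ X) (omegaC _ X) !omega_even ?/gl_homog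
    ?linear0 // [gl_br X 0](linear0 (br (gl_lie K) X)) linear0 !scale0r !addr0.
have g0l X : good 0 X.
  rewrite /good !omega_even /gl_homog ?linear0 // [gl_br 0 X](br0l (gl_lie K)) linear0.
  by rewrite !scale0r !addr0 /lift_br [psl_class 0]linear0 linear0 br0l.
have g1l X : X \in sl22 K -> good 1%:M X.
  move=> sX; rewrite /good !(omega_scalar _ 1) !scale0r !addr0.
  rewrite /lift_br psl_class1 linear0 br0l.
  have [X0 [X1 [h0 h1' ->]]] := gl_dec X.
  have := gl_br_linr 1%:M 1 X0 X1; rewrite !scale1r => ->.
  rewrite (gl_brE (gl_homog1 1) h0) (gl_brE (gl_homog1 1) h1').
  by rewrite /ssign !scale1r !(gl_scalarC 1) !subrr addr0 linear0.
have sl1 := sl22_1 K.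
have g1r X : X \in sl22 K -> good X 1%:M.
  move=> sX; have [X0 [X1 [k0 k1 e]]] := gl_dec X.
  have [s0 s1] := sl22_graded k0 k1 (eq_ind _ (fun Y => Y \in sl22 K) sX _ e).
  have q0 : good X0 1%:M by apply: (good_sym (gl_homog1 1) k0) => //; apply: g1l.
  have q1 : good X1 1%:M by apply: (good_sym (gl_homog1 1) k1) => //; apply: g1l.
  by have := good_linl 1 q0 q1; rewrite scale1r -e.
have ghE h i j : gl_homog false h -> h \in sl22 K -> gl_br Hwt h = 0 *: h -> i != j ->
    good h (E i j).
  move=> hh sh wh ij; apply: (good_wt hh (E_homog i j) sh (E_sl ij) wh (br_HE i j)).
  by rewrite add0r wt_neq.
have gEh h i j : gl_homog false h -> h \in sl22 K -> gl_br Hwt h = 0 *: h -> i != j ->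
    good (E i j) h.
  move=> hh sh wh ij; apply: (good_sym hh (E_homog i j)) => //; first exact: E_sl.
  exact: ghE.
have ghh h h' : gl_homog false h -> gl_br h h' = 0 -> beta h h' = 0 -> good h h'.
  by move=> hh e e'; rewrite /good e e' !(omega_even _ _ hh) linear0 !scale0r !addr0.
have hhself h : gl_homog false h -> h \in sl22 K -> good h h.
  move=> hh sh; apply: ghh => //.
    by rewrite (gl_brE hh hh) /ssign /= expr0 scale1r subrr.
  have := beta_anti hh hh sh sh; rewrite /ssign /= expr0 scale1r => /eqP.
  by rewrite -addr_eq0 -mulr2n -scaler_nat scaler_eq0 Num.Theory.pnatr_eq0 /= => /eqP.
(* Both have weight 0, so [good_wt] does not apply. Instead h1 is written as [E12, E21], whose
   factors commute with h2, and the Jacobi identity gives 0. *)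
have gh12 : good h1 h2.
  have b0 : gl_br h1 h2 = 0.
    rewrite (gl_brE h1_homog h2_homog) /ssign /= expr0 scale1r.
    apply/matrixP=> i j; rewrite !mxE !sum4 !mxE.
    by elim/I4_ind: i; elim/I4_ind: j; rewrite /=; ring.
  apply: ghh => //; first exact: h1_homog.
  have <- : gl_br (E o0 o1) (E o1 o0) = h1.
    by rewrite br_E_E1 // /ssign /= expr0 scale1r.
  have := beta_jacobi (E_homog o0 o1) (E_homog o1 o0) h2_homog (E_sl _) (E_sl _) h2_sl.
  have z i j : gl_br (E i j) h2 = gl_br (E i j) (E o2 o2) - gl_br (E i j) (E o3 o3).
    have := gl_br_linr (E i j) (-1) (E o3 o3) (E o2 o2).
    by rewrite !scaleN1r ![- _ + _]addrC.
  have -> : gl_br (E o1 o0) h2 = 0 by rewrite z !br_E /= !scaler0 !subrr.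
  have -> : gl_br (E o0 o1) h2 = 0 by rewrite z !br_E /= !scaler0 !subrr.
  by move=> /(_ isT isT); rewrite !beta0r scaler0 addr0.
have hh1 := h1_homog; have hh2 := h2_homog; have sh1 := h1_sl; have sh2 := h2_sl.
have gh21 : good h2 h1 by apply: (good_sym hh1 hh2).
have wh1 := br_Hh1; have wh2 := br_Hh2.
move=> sA; elim/sl22_ind: A / sA => [|a X Y hX hY sB|i j ij|||] //.
- by apply: good_linl; [apply: hX|apply: hY].
- move=> sB; elim/sl22_ind: B / sB => [|a X Y|k l kl|||] //; last exact: g1r (E_sl ij).
  + exact: good_linr.
  + exact: good_E.
  + exact: gEh.
  + exact: gEh.
- move=> sB; elim/sl22_ind: B / sB => [|a X Y|k l kl|||] //; last exact: g1r.
  + exact: good_linr.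
  + exact: ghE.
  + exact: hhself.
- move=> sB; elim/sl22_ind: B / sB => [|a X Y|k l kl|||] //; last exact: g1r.
  + exact: good_linr.
  + exact: ghE.
  + exact: hhself.
- exact: g1l.
Qed.

End Lift.

(** * The universal extension inside the model *)

Section Universal.
Variables (K : numFieldType) (L : vectType K) (s : lieSuper L).
Variable p : {linear L -> psl22 K}.
Hypothesis Luce : universal_central_extension s (psl_lie K) p.
Implicit Types A B C : 'M[K]_4.
Local Notation beta := (lift_br s p).
Local Notation tauL := (tau s p).
Local Notation E i j := (delta_mx i j : 'M[K]_4).

Let pce : central_extension s (psl_lie K) p := proj1 Luce.

Definition zc (k : 'I_3) : L :=
  match val k with 0 => z_pos s p | 1 => z_neg s p | _ => z_one s p end.

Lemma p_beta A B : A \in sl22 K -> B \in sl22 K ->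
  p (beta A B) = psl_class (gl_br A B).
Proof. by move=> sA sB; apply: (p_br pce); rewrite ?(liftK pce). Qed.

Lemma beta_homog a b A B : gl_homog a A -> gl_homog b B -> A \in sl22 K ->
  B \in sl22 K -> homog s (a (+) b) (beta A B).
Proof.
move=> hA hB sA sB; have [x hx ex] := class_lift pce hA sA.
have [y hy ey] := class_lift pce hB sB.
by rewrite (lift_brE pce ex ey); apply: br_homog.
Qed.

Lemma tau1 : tauL 1%:M = 0.
Proof.
have -> : 1%:M = 1 *: E o0 o0 + 1 *: E o1 o1 + 1 *: E o2 o2 + 1 *: E o3 o3.
  apply/matrixP=> i j; rewrite !mxE.
  by elim/I4_ind: i; elim/I4_ind: j; rewrite /= ?mulr1 ?mulr0 ?addr0 ?add0r.
by rewrite tau_diag subrr mul0r !scale0r addr0.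
Qed.

Lemma tau_scalar c : tauL c%:M = 0.
Proof. by rewrite -scalemx1 linearZ /= tau1 scaler0. Qed.

Lemma p_tau A : A \in sl22 K -> p (tauL A) = psl_class A.
Proof.
move=> sA; elim/sl22_ind: A / sA => [|a X Y hX hY|i j ij|||].
- by rewrite !linear0.
- by rewrite !linearP /= hX hY.
- rewrite tauE // linearZ /= p_beta ?Hwt_sl ?E_sl // br_HE linearZ /= scalerA.
  by rewrite mulVf ?scale1r ?wt_neq.
- by rewrite tau_h1 p_beta ?E_sl // br_E_E1 // /ssign /= expr0 scale1r.
- by rewrite tau_h2 p_beta ?E_sl // br_E_E1 // /ssign /= expr0 scale1r.
- by rewrite tau1 linear0 psl_class1.
Qed.

Lemma tau_homog b A : gl_homog b A -> homog s b (tauL A).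
Proof.
move=> hA; rewrite tau_def; apply: homogD; first apply: homogD.
- elim/big_ind: _ => [|x y|i _]; [exact: homog0|exact: homogD|].
  elim/big_ind: _ => [|x y|j _]; [exact: homog0|exact: homogD|].
  case: eqP => [_|/eqP ij]; first exact: homog0.
  have [<-|ne] := eqVneq (ipar i (+) ipar j) b.
    apply: homogZ; rewrite -[_ (+) _]addFb.
    by apply: beta_homog; rewrite ?Hwt_sl ?E_sl //; [apply: Hwt_homog|apply: E_homog].
  by rewrite (gl_homog_entry hA ne) mul0r scale0r; apply: homog0.
- case: b hA => hA.
    by rewrite !(odd_entries hA) subrr mul0r scale0r; apply: homog0.
  apply: homogZ; apply: (@beta_homog false false); rewrite ?E_sl //;
    by [apply: (E_homog K o0 o1)|apply: (E_homog K o1 o0)].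
- case: b hA => hA.
    by rewrite !(odd_entries hA) subrr mul0r scale0r; apply: homog0.
  apply: homogZ; apply: (@beta_homog false false); rewrite ?E_sl //;
    by [apply: (E_homog K o2 o3)|apply: (E_homog K o3 o2)].
Qed.

Lemma zc_homog k : homog s false (zc k).
Proof.
have odd i j : i != j -> ipar i (+) ipar j -> gl_homog true (E i j) /\ E i j \in sl22 K.
  by move=> ij h; split; [rewrite -h; apply: E_homog|apply: E_sl].
have bh i j k' l : i != j -> ipar i (+) ipar j -> k' != l -> ipar k' (+) ipar l ->
    homog s false (beta (E i j) (E k' l)).
  move=> ij h kl h'; have [hA sA] := odd _ _ ij h; have [hB sB] := odd _ _ kl h'.
  exact: (@beta_homog true true).
elim/I3_ind: k; rewrite /zc /=; first by rewrite z_posE; apply: bh.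
  by rewrite z_negE; apply: bh.
by rewrite z_oneE; apply: homogD; apply: bh.
Qed.

Lemma p_zc k : p (zc k) = 0.
Proof.
elim/I3_ind: k; rewrite /zc /=.
- by rewrite z_posE p_beta ?E_sl // br_E /= mulr0n scaler0 subrr linear0.
- by rewrite z_negE p_beta ?E_sl // br_E /= mulr0n scaler0 subrr linear0.
- rewrite z_oneE linearD /= !p_beta ?E_sl // -linearD /=.
  rewrite !br_E_E1 // /ssign /= expr1 !scaleN1r !opprK.
  apply/eqP; rewrite -(psl_class1 1); apply/eqP; congr psl_class.
  apply/matrixP=> i j; rewrite !mxE.
  by elim/I4_ind: i; elim/I4_ind: j; rewrite /= ?addr0 ?add0r.
Qed.

Lemma zc_central k x : br s (zc k) x = 0.
Proof. by have [_ _ h] := pce; apply/h/p_zc. Qed.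

Lemma zc_centralr k x : br s x (zc k) = 0.
Proof.
have [x0 [x1 [h0 h1 ->]]] := homog_dec s x.
by rewrite brDl (br_anti h0 (zc_homog k)) (br_anti h1 (zc_homog k)) !zc_central
  !scaler0 oppr0 addr0.
Qed.

Definition of_ext (u : psl_ext K) : L := tauL (mat u.1) + \sum_k u.2 0 k *: zc k.

Lemma of_ext_linear : linear of_ext.
Proof.
move=> a u v; rewrite /of_ext -[(a *: u + v).1]/(a *: u.1 + v.1).
rewrite mat_linear tau_linear scalerDr addrACA; congr (_ + _).
rewrite scaler_sumr -big_split; apply: eq_bigr => k _ /=.
by rewrite !mxE scalerDl scalerA.
Qed.
HB.instance Definition _ := GRing.isLinear.Build K (psl_ext K) L _ of_ext of_ext_linear.

Lemma tau_br A B : A \in sl22 K -> B \in sl22 K ->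
  br s (tauL A) (tauL B) = tauL (gl_br A B) + \sum_k omega k A B *: zc k.
Proof.
move=> sA sB; rewrite -(lift_brE pce (p_tau sA) (p_tau sB)) (good_sl pce sA sB).
by rewrite sum3 /zc /= !addrA.
Qed.

Lemma p_of_ext u : p (of_ext u) = u.1.
Proof.
rewrite /of_ext linearD /= p_tau ?mat_sl // matK linear_sum big1 ?addr0 // => k _.
by rewrite linearZ /= p_zc scaler0.
Qed.

Lemma of_ext_hom : lie_hom (ext_lie K) s of_ext.
Proof.
split=> [b u [hu h2]|u v].
  rewrite /of_ext; apply: homogD.
    have [A [hA sA ->]] := psl_homogP hu; have [c ->] := mat_psl_class sA.
    by rewrite linearD /= tau_scalar addr0; apply: tau_homog.
  case: b hu h2 => hu h2.
    rewrite h2 // big1 => [|k _]; first exact: homog0.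
    by rewrite mxE scale0r.
  elim/big_ind: _ => [|x y|k _]; [exact: homog0|exact: homogD|].
  exact/homogZ/zc_homog.
have zr x a : br s x (\sum_k a k *: zc k) = 0.
  by rewrite linear_sum big1 // => k _; rewrite linearZ /= zc_centralr scaler0.
have zl x a : br s (\sum_k a k *: zc k) x = 0.
  have [_ _ h] := pce; apply: h; rewrite linear_sum big1 // => k _.
  by rewrite linearZ /= p_zc scaler0.
rewrite {2 3}/of_ext brDl zl addr0 linearD /= zr addr0 tau_br ?mat_sl //.
rewrite /of_ext; congr (_ + _); last by apply: eq_bigr => k _; rewrite mxE.
have -> : (br (ext_lie K) u v).1 = psl_class (gl_br (mat u.1) (mat v.1)).
  by rewrite -psl_class_br ?mat_sl // !matK.
have [c ->] := mat_psl_class (sl_br (mat u.1) (mat v.1)).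
by rewrite linearD /= tau_scalar addr0.
Qed.

(** Universality maps L to the model over psl(2|2). Composed with [of_ext], this is an endomorphism
    of L over psl(2|2), hence the identity by the uniqueness clause applied to L itself. *)
Lemma to_ext_ex : exists f : {linear L -> psl_ext K},
  [/\ lie_hom s (ext_lie K) f, forall x, (f x).1 = p x & cancel f of_ext].
Proof.
have [f [fh fp _]] := (proj2 Luce) _ _ _ (ext_central K).
exists f; split=> // x.
have [i [ih ip iu]] := (proj2 Luce) _ _ _ pce.
have [fh1 fh2] := fh; have [gh1 gh2] := of_ext_hom.
have e1 : (of_ext \o f : {linear L -> L}) =1 i.
  apply: iu => [|y]; last by rewrite /= p_of_ext -fp.
  by split=> [b y hy|y z]; [apply/gh1/fh1 | rewrite /= fh2 gh2].
have e2 : (idfun : {linear L -> L}) =1 i by apply: iu.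
exact: etrans (e1 x) (esym (e2 x)).
Qed.

Definition to_ext : {linear L -> psl_ext K} := sval (cid to_ext_ex).

Lemma to_ext_hom : lie_hom s (ext_lie K) to_ext.
Proof. by rewrite /to_ext; case: cid => f []. Qed.

Lemma to_ext_fst x : (to_ext x).1 = p x.
Proof. by rewrite /to_ext; case: cid => f []. Qed.

Lemma to_extK : cancel to_ext of_ext.
Proof. by rewrite /to_ext; case: cid => f []. Qed.

Lemma ext_dec x : x = tauL (mat (p x)) + \sum_k (to_ext x).2 0 k *: zc k.
Proof. by rewrite -{1}[x]to_extK /of_ext to_ext_fst. Qed.

Lemma to_ext_beta A B : A \in sl22 K -> B \in sl22 K ->
  to_ext (beta A B) = (psl_class (gl_br A B), \row_k omega k A B).
Proof.
move=> sA sB; rewrite (lift_brE pce (p_tau sA) (p_tau sB)) (proj2 to_ext_hom).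
rewrite /= /ext_br !to_ext_fst !p_tau // psl_class_br //; congr (_, _).
by apply/rowP=> k; rewrite !mxE omega_psl_class.
Qed.

(** The cocycle separates the three central elements on the brackets that define them; in particular
    they are independent in L. *)
Lemma to_ext_zc k : to_ext (zc k) = (0, delta_mx 0 k).
Proof.
suff e2 : (to_ext (zc k)).2 = delta_mx 0 k.
  by rewrite [LHS]surjective_pairing to_ext_fst p_zc e2.
apply/rowP=> l; elim/I3_ind: k; rewrite /zc /=.
- rewrite z_posE to_ext_beta ?E_sl // !mxE /=.
  by elim/I3_ind: l; rewrite /omega !mxE /=; ring.
- rewrite z_negE to_ext_beta ?E_sl // !mxE /=.
  by elim/I3_ind: l; rewrite /omega !mxE /=; ring.
- rewrite z_oneE linearD /= !to_ext_beta ?E_sl // !mxE /=.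
  by elim/I3_ind: l; rewrite /omega !mxE /=; field.
Qed.

Lemma h_shortE : h_short s p = tauL (2^-1 *: (h1 K + h2 K)).
Proof.
have hom i j : ipar i = ipar j -> gl_homog false (E i j).
  by move=> e; have := E_homog K i j; rewrite e addbb.
rewrite /h_short !linearZ /=; congr (_ *: _).
rewrite (@Emx_E K 1 2 o0 o1) // (@Emx_E K 3 4 o2 o3) // (@Emx_E K 2 1 o1 o0) //.
rewrite (@Emx_E K 4 3 o3 o2) // (good_sl pce) ?rpredD ?E_sl //.
have h : gl_homog false (E o0 o1 + E o2 o3).
  by rewrite /gl_homog linearD /= !hom.
rewrite !(omega_even _ _ h) !scale0r !addr0; congr (tau _ _ _).
have h' : gl_homog false (E o1 o0 + E o3 o2) by rewrite /gl_homog linearD /= !hom.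
rewrite (gl_brE h h') /ssign /= expr0 scale1r; apply/matrixP=> i j.
rewrite !mxE !sum4 !mxE.
by elim/I4_ind: i; elim/I4_ind: j; rewrite /=; ring.
Qed.

Lemma zc_center k : zc k \in center s.
Proof. by apply/centerP=> x; apply: zc_central. Qed.

(* psl(2|2) has trivial center. *)
Lemma center_zc z : z \in center s -> z = \sum_k (to_ext z).2 0 k *: zc k.
Proof.
move=> /centerP cz; rewrite {1}[z]ext_dec; set A := mat (p z).
suff [c ->] : exists c, A = c%:M by rewrite tau_scalar add0r.
have sA : A \in sl22 K := mat_sl _.
(* The class of A is central in psl(2|2). Bracketing with [Hwt] then kills the off-diagonal entries
   of A, and bracketing with E i j equates its diagonal entries i and j. *)
have scal B : B \in sl22 K -> exists c, gl_br A B = c%:M.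
  move=> sB; have : psl_class (gl_br A B) = 0.
    rewrite -psl_class_br // matK -(p_tau sB); have [[_ h] _ _] := pce.
    by rewrite -h cz linear0.
  by move/quo_pi_eq0/scalarsP=> [c]; rewrite vsprojK ?sl_br // => ->; exists c.
have offd i j : i != j -> A i j = 0.
  move=> ij; have [c /matrixP/(_ i j)] := scal _ (Hwt_sl K).
  rewrite (gl_br_evenr _ (Hwt_homog K)) Hwt_diag -!mulmxE mul_diag_mx mul_mx_diag !mxE.
  rewrite (negbTE ij) mulr0n [A i j * _]mulrC -mulrBl => /eqP.
  by rewrite mulf_eq0 (negbTE (wt_neq K _)) 1?eq_sym // => /eqP.
have hA : gl_homog false A.
  apply/matrixP=> i j; rewrite !mxE; case: ifP => // h.
  by rewrite offd //; apply: contraFneq h => ->; rewrite addbb.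
have dg i j : i != j -> A i i = A j j.
  move=> ij; have [c /matrixP/(_ i j)] := scal _ (E_sl K ij).
  rewrite (gl_br_evenl _ hA) !mxE (negbTE ij) mulr0n.
  rewrite (bigD1 i) //= [X in _ + X - _]big1 => [|k nk]; last first.
    by rewrite !mxE (negbTE nk) mulr0.
  rewrite (bigD1 j) //= [X in _ - (_ + X)]big1 => [|k nk]; last first.
    by rewrite !mxE (negbTE nk) andbF mul0r.
  by rewrite !mxE !eqxx mulr1 mul1r !addr0 => /eqP; rewrite subr_eq0 => /eqP.
exists (A o0 o0); apply/matrixP=> i j; rewrite !mxE.
have [<-|ij] := eqVneq i j; last exact: offd.
by have [->|] := eqVneq i o0; [|apply: dg].
Qed.

End Universal.

(** * Highest weight spaces *)

Section Coordinates.
Variables (K : fieldType) (V : vectType K).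
(** Coordinates reduce linear identities between vectors to scalar ones, within reach of [ring] and
    [field]; [vring] and [vfield] rely on this. *)
Definition crd i (v : V) : K := coord (vbasis {:V}) i v.
Lemma crdD i u v : crd i (u + v) = crd i u + crd i v. Proof. exact: linearD. Qed.
Lemma crdN i v : crd i (- v) = - crd i v. Proof. exact: linearN. Qed.
Lemma crdZ i a v : crd i (a *: v) = a * crd i v. Proof. exact: linearZ. Qed.
Lemma crd0 i : crd i 0 = 0. Proof. exact: linear0. Qed.
Lemma crd_inj u v : (forall i, crd i u = crd i v) -> u = v.
Proof.
move=> e; rewrite (coord_vbasis (memvf u)) (coord_vbasis (memvf v)).
by apply: eq_bigr => i _; congr (_ *: _); apply: e.
Qed.
End Coordinates.

Section LfunLinear.
Variables (K : fieldType) (V W : vectType K) (f : 'Hom(V, W)).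
Lemma lfD u v : f (u + v) = f u + f v. Proof. exact: linearD. Qed.
Lemma lfN v : f (- v) = - f v. Proof. exact: linearN. Qed.
Lemma lfZ a v : f (a *: v) = a *: f v. Proof. exact: linearZ. Qed.
Lemma lf0 : f 0 = 0. Proof. exact: linear0. Qed.
End LfunLinear.

Ltac nrm rel := rewrite ?(rel, lfD, lfN, lfZ, lf0).
Ltac vring := rewrite ?(lfD, lfN, lfZ, lf0);
  apply: crd_inj => ?; rewrite ?(crdD, crdN, crdZ, crd0); ring.

Section Eigen.
Variables (K : numClosedFieldType) (V : vectType K).
Implicit Types (f H T : 'End(V)) (U : {vspace V}).

Lemma eigen_ex f U : U != 0%VS -> (forall v, v \in U -> f v \in U) ->
  exists a v, [/\ v \in U, v != 0 & f v = a *: v].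
Proof.
move=> U0 fU.
pose g : 'End(subvs_of U) := linfun (vsproj U \o f \o vsval).
have gE x : vsval (g x) = f (vsval x).
  by rewrite lfunE /= vsprojK // fU // subvsP.
pose e := vbasis {:subvs_of U}.
have be : basis_of {:subvs_of U} e := vbasisP _.
have d0 : (0 < \dim {:subvs_of U})%N.
  by rewrite dimvf /dim /= lt0n dimv_eq0.
have [a /eigenvalueP[u ua u0]] := eigenvalue_closed (passmx.mxof e e g) d0.
exists a, (vsval (passmx.vecof e u)); split; first exact: subvsP.
  by rewrite -[0]/(vsval (0 : subvs_of U)) (inj_eq val_inj) passmx.vecof_eq0.
rewrite -gE (passmx.hom_vecof e be) ua /passmx.vecof -linearZ scaler_sumr /=.
by congr vsval; apply: eq_bigr => i _; rewrite mxE scalerA.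
Qed.

(** Finite dimension in place of spectral decompositions: an equation f u = w with w in U is solved
    inside U, so a vector that f sends into U already lies in U. *)
Lemma inj_stable_surj f U : (forall v, f v = 0 -> v = 0) ->
  (forall v, v \in U -> f v \in U) -> forall w, w \in U -> exists2 u, u \in U & f u = w.
Proof.
move=> finj fU w wU.
have ker0 : lker f = 0%VS.
  apply/eqP; rewrite -subv0; apply/subvP=> v; rewrite memv_ker memv0 => /eqP /finj ->.
  exact: eqxx.
have sub : (f @: U <= U)%VS by apply/subvP=> _ /memv_imgP[v vU ->]; apply: fU.
have : w \in (f @: U)%VS.
  suff -> : (f @: U)%VS = U by [].
  by apply/eqP; rewrite eqEdim sub /= limg_dim_eq // ker0 capv0.
by move=> /memv_imgP[u uU ->]; exists u.
Qed.

(** [T] raises weights by c, but [H] need not be diagonalisable. If T v is an eigenvector, its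
    eigenvalue a lies in S, so H - (a - c) is injective, hence bijective on the stable subspace ker
    T. It maps v into ker T, so v is in ker T. *)
Lemma shift_nilp H T (c : K) (S : K -> Prop) :
  (forall v, H (T v) = T (H v) + c *: T v) ->
  (forall a v, v != 0 -> H v = a *: v -> S a) ->
  (forall a, S a -> ~ S (a - c)) -> forall v, T v = 0.
Proof.
move=> HT eig Sc; suff T0 : limg T = 0%VS.
  by move=> v; apply/eqP; rewrite -memv0 -T0 memv_img // memvf.
apply: contrapT => /eqP T0.
have [|a [w [/memv_imgP[v _ ->{w}] Tv0 aTv]]] := @eigen_ex H (limg T) T0.
  by move=> _ /memv_imgP[v _ ->]; rewrite HT memvD ?memvZ ?memv_img ?memvf.
pose f : 'End(V) := H - (a - c) *: \1%VF.
have fE x : f x = H x - (a - c) *: x.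
  by rewrite /f add_lfunE opp_lfunE scale_lfunE id_lfunE.
have finj x : f x = 0 -> x = 0.
  rewrite fE => /eqP; rewrite subr_eq0 => /eqP hx; apply: contrapT => /eqP x0.
  exact: Sc (eig _ _ Tv0 aTv) (eig _ _ x0 hx).
have fT x : T (f x) = H (T x) - a *: T x by rewrite fE HT; vring.
have fker x : x \in lker T -> f x \in lker T.
  by rewrite !memv_ker fT => /eqP ->; rewrite linear0 scaler0 subrr.
have : f v \in lker T by rewrite memv_ker fT aTv subrr.
move=> /(inj_stable_surj finj fker)[u uT fuv].
have uv : u - v = 0 by apply: finj; rewrite linearB /= fuv subrr.
move: uT; rewrite memv_ker => /eqP; have -> : u = v by rewrite -[u](subrK v) uv add0r.
by move=> Tv; rewrite Tv eqxx in Tv0.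
Qed.

(* Jacobson's argument in sl_2: [ad f] applied repeatedly to [e ^ 3 = 0]. *)
Lemma sl2_weights (e f h : 'End(V)) :
  (forall w, h (e w) = e (h w) + 2 *: e w) ->
  (forall w, h (f w) = f (h w) - 2 *: f w) ->
  (forall w, e (f w) = f (e w) + h w) ->
  (forall w, e (e (e w)) = 0) ->
  forall w, h (h (h (h (h (h w))))) - 5 *: h (h (h (h w))) + 4 *: h (h w) = 0.
Proof.
move=> he hf ef e3.
have rel := (ef, he, hf).
(* As operators, the next four facts read e^2 (h + 2) = 0, f e^2 = e h (h + 1), e h (h + 1)(h + 2) =
   0 and e f h (h - 1)(h - 2) = 0; the first expands e^3 f = 0. *)
have s1 w : e (e (h w)) = - (2 *: e (e w)).
  have : 3 *: (e (e (h w)) + 2 *: e (e w)) = 0.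
    by rewrite -(e3 (f w)); nrm rel; rewrite ?(e3, linear0); vring.
  by move/eqP; rewrite scaler_eq0 Num.Theory.pnatr_eq0 /= addr_eq0 => /eqP.
have s3 w : f (e (e w)) = e (h (h w)) + e (h w).
  have h0 : e (e (f (h w))) = 0.
    have -> : e (e (f (h w))) = e (e (h (f w))) + 2 *: e (e (f w)) by rewrite hf; vring.
    by rewrite s1 addNr.
  have : 2 *: f (e (e w)) = 2 *: (e (h (h w)) + e (h w)).
    apply/eqP; rewrite eq_sym -subr_eq0 -[X in _ == X]h0; apply/eqP.
    by nrm rel; rewrite s1; vring.
  by apply: scalerI; rewrite Num.Theory.pnatr_eq0.
have s4 w : e (h (h (h w))) + 3 *: e (h (h w)) + 2 *: e (h w) = 0.
  have := s3 (h w); rewrite s1 linearN linearZ /= s3 => /eqP.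
  rewrite eq_sym -addr_eq0 => /eqP <-; vring.
have s5 w : e (f (h (h (h w)))) - 3 *: e (f (h (h w))) + 2 *: e (f (h w)) = 0.
  by rewrite -(s4 (f w)); nrm hf; vring.
(* x is (h + 1)(h + 2) w. Both e f and f e kill h (h - 1)(h - 2) x, hence so does their difference
   h. *)
move=> w; pose x := h (h w) + 3 *: h w + 2 *: w.
have e1 : f (e (h (h (h x)) - 3 *: h (h x) + 2 *: h x)) = 0.
  rewrite -(linear0 f) -(s4 (h (h w) - 3 *: h w + 2 *: w)); congr (f _).
  by rewrite /x; vring.
have := s5 x; rewrite !ef => s5x.
have e2 : h (h (h (h x))) - 3 *: h (h (h x)) + 2 *: h (h x) = 0.
  by rewrite -s5x -[LHS]add0r -e1; vring.
by rewrite -e2 /x; vring.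
Qed.

End Eigen.

Section Weights.
Variable K : numClosedFieldType.
Local Notation E i j := (delta_mx i j : 'M[K]_4).
Local Notation h1 := (h1 K).
Local Notation h2 := (h2 K).

Definition wtm (n : int) (A : 'M[K]_4) : Prop := gl_br h1 A = n%:~R *: A.

Definition cw (i : 'I_4) : int := nth 0 [:: 1; -1; 0; 0] i.

Lemma wtm_E i j : wtm (cw i - cw j) (E i j).
Proof.
rewrite /wtm (gl_br_evenl _ (h1_homog K)).
have -> : h1 = diag_mx (\row_i (cw i)%:~R).
  apply/matrixP=> k l; rewrite !mxE.
  by elim/I4_ind: k; elim/I4_ind: l; rewrite /= ?subr0 ?sub0r.
apply/matrixP=> k l; rewrite -!mulmxE mul_diag_mx mul_mx_diag !mxE rmorphB.
have [->|_] := eqVneq k i; have [->|_] := eqVneq l j; rewrite ?mulr1 ?mulr0 /=; ring.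
Qed.

Lemma wtm0 n : wtm n 0.
Proof. by rewrite /wtm [LHS](linear0 (br (gl_lie K) h1)) scaler0. Qed.

Lemma wtmP n a A B : wtm n A -> wtm n B -> wtm n (a *: A + B).
Proof. by rewrite /wtm gl_br_linr => -> ->; rewrite scalerDr !scalerA mulrC. Qed.

Lemma wtm_br m n a A B : gl_homog a A -> wtm m A -> wtm n B -> wtm (m + n) (gl_br A B).
Proof.
move=> hA wA wB; rewrite /wtm (gl_br_jacobi _ (h1_homog K) hA) wA wB gl_brZl gl_brZr.
by rewrite /ssign /= expr0 scale1r -scalerDl rmorphD.
Qed.

Lemma gl_homogP b a (A B : 'M[K]_4) : gl_homog b A -> gl_homog b B ->
  gl_homog b (a *: A + B).
Proof. exact: (homogP (g := gl_grading K)). Qed.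

(** An odd matrix unit joins one of the indices 1, 2, where h1 has entries 1 and -1, to one of 3, 4,
    where it has entry 0; so only the weights 1 and -1 occur. *)
Lemma odd_dec A : gl_homog true A -> exists A1 A2,
  [/\ gl_homog true A1, wtm 1 A1, gl_homog true A2, wtm (-1) A2 & A = A1 + A2].
Proof.
move=> hA; pose cmp (n : int) : 'M[K]_4 :=
  \sum_i \sum_(j | cw i - cw j == n) A i j *: E i j.
have odd0 : gl_homog true (0 : 'M[K]_4) by rewrite /gl_homog linear0.
have homD X Y : gl_homog true X -> gl_homog true Y -> gl_homog true (X + Y : 'M[K]_4).
  by move=> hX hY; rewrite -[X]scale1r; apply: gl_homogP.
have wtD n X Y : wtm n X -> wtm n Y -> wtm n (X + Y).
  by move=> hX hY; rewrite -[X]scale1r; apply: wtmP.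
have hc n : gl_homog true (cmp n).
  rewrite /cmp; elim/big_ind: _ => // i _; elim/big_ind: _ => // j _.
  have [e|ne] := eqVneq (ipar i (+) ipar j) true.
    by rewrite -[_ *: _]addr0; apply: gl_homogP => //; rewrite -e; apply: E_homog.
  by rewrite (gl_homog_entry hA ne) scale0r.
have wc n : wtm n (cmp n).
  rewrite /cmp; elim/big_ind: _ => [||i _]; [exact: wtm0|exact: wtD|].
  elim/big_ind: _ => [||j /eqP e]; [exact: wtm0|exact: wtD|].
  by rewrite -[_ *: _]addr0; apply: wtmP (wtm0 _); rewrite -e; apply: wtm_E.
exists (cmp 1), (cmp (-1)); split=> //.
rewrite /cmp -big_split [LHS]matrix_sum_delta; apply: eq_bigr => i _ /=.
rewrite [X in _ = X + _]big_mkcond [X in _ = _ + X]big_mkcond -big_split.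
apply: eq_bigr => j _ /=; rewrite -[X in X = _]addr0.
by elim/I4_ind: i; elim/I4_ind: j; rewrite /= ?(odd_entries hA) ?scale0r ?addr0 ?add0r.
Qed.

Lemma even_dec A : gl_homog false A -> A \in sl22 K ->
  A = A o0 o1 *: E o0 o1 + A o1 o0 *: E o1 o0 + A o2 o3 *: E o2 o3 + A o3 o2 *: E o3 o2
    + ((A o0 o0 - A o1 o1) / 2) *: h1 + ((A o2 o2 - A o3 o3) / 2) *: h2
    + ((A o0 o0 + A o1 o1) / 2) *: 1%:M.
Proof.
move=> hA; rewrite sl22P supertrace4 => /eqP sA.
have e3 : A o3 o3 = A o0 o0 + A o1 o1 - A o2 o2.
  by apply/eqP; rewrite eq_sym -subr_eq0 sA.
apply/matrixP=> i j; rewrite !mxE.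
by elim/I4_ind: i; elim/I4_ind: j; rewrite /= ?(even_entries hA) ?e3; field.
Qed.

Lemma wtm0_entries A : wtm 0 A -> gl_homog false A -> A o0 o1 = 0 /\ A o1 o0 = 0.
Proof.
rewrite /wtm => + hA; rewrite (gl_br_evenl _ (h1_homog K)) scale0r => /matrixP w.
have := w o0 o1; have := w o1 o0; rewrite !mxE !sum4 !mxE /=.
rewrite !(mulr0, mul0r, mulr1, mul1r, subr0, sub0r, addr0, add0r, mulrN1, mulN1r, opprK).
rewrite -[- _ - _]opprD => /eqP + /eqP; rewrite oppr_eq0 -!mulr2n !mulrn_eq0 /=.
by move=> /eqP -> /eqP ->.
Qed.

End Weights.

(** * The two even sl(2) subalgebras on a module *)

Section Rep.
Variables (K : numClosedFieldType) (L : vectType K) (s : lieSuper L).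
Variable p : {linear L -> psl22 K}.
Hypothesis Luce : universal_central_extension s (psl_lie K) p.
Variables (W : vectType K) (rho : {linear L -> 'End(W)}).
Implicit Types (A B C : 'M[K]_4) (U N : {vspace W}) (v w : W).
Local Notation E i j := (delta_mx i j : 'M[K]_4).
Local Notation h1 := (h1 K).
Local Notation h2 := (h2 K).

(** No grading of W is asked for, so that the results below apply to the product of two modules in
    the graph argument without making it a supermodule. *)
Definition is_rep : Prop :=
  (forall a b x y m, homog s a x -> homog s b y ->
     rho (br s x y) m = rho x (rho y m) - ssign K a b *: rho y (rho x m)) /\
  (forall c w, w != 0 -> rho (h_short s p) w = c *: w -> c \in [:: -1; 0; 1]).

Hypothesis Wrep : is_rep.

Definition mx_act A : 'End(W) := rho (tau s p A).
Definition z_act k : 'End(W) := rho (zc s p k).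
Local Notation X := mx_act.
Local Notation Z := z_act.

Lemma mx_act_linear : linear X.
Proof. by move=> a A B; rewrite /mx_act tau_linear linearP. Qed.

Lemma mx_actP a A B w : X (a *: A + B) w = a *: X A w + X B w.
Proof. by rewrite mx_act_linear !lfunE /= lfunE. Qed.
Lemma mx_actD A B w : X (A + B) w = X A w + X B w.
Proof. by rewrite -[A]scale1r mx_actP !scale1r. Qed.
Lemma mx_act0 w : X 0 w = 0.
Proof. by rewrite /mx_act linear0 linear0 lfunE. Qed.
Lemma mx_actZ a A w : X (a *: A) w = a *: X A w.
Proof. by rewrite -[_ *: A]addr0 mx_actP mx_act0 addr0. Qed.
Lemma mx_actN A w : X (- A) w = - X A w.
Proof. by rewrite -scaleN1r mx_actZ scaleN1r. Qed.
Lemma mx_act1 w : X 1%:M w = 0.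
Proof. by rewrite /mx_act tau_scalar linear0 lfunE. Qed.

Lemma mx_act_comb7 (a1 a2 a3 a4 a5 a6 a7 : K) A1 A2 A3 A4 A5 A6 A7 w :
  X (a1 *: A1 + a2 *: A2 + a3 *: A3 + a4 *: A4 + a5 *: A5 + a6 *: A6 + a7 *: A7) w =
  a1 *: X A1 w + a2 *: X A2 w + a3 *: X A3 w + a4 *: X A4 w + a5 *: X A5 w
  + a6 *: X A6 w + a7 *: X A7 w.
Proof. by rewrite 6!mx_actD 7!mx_actZ. Qed.

Lemma mx_act_even A w : gl_homog false A -> A \in sl22 K ->
  X A w = A o0 o1 *: X (E o0 o1) w + A o1 o0 *: X (E o1 o0) w
    + A o2 o3 *: X (E o2 o3) w + A o3 o2 *: X (E o3 o2) w
    + ((A o0 o0 - A o1 o1) / 2) *: X h1 w + ((A o2 o2 - A o3 o3) / 2) *: X h2 w.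
Proof.
by move=> hA sA; rewrite {1}(even_dec hA sA) mx_act_comb7 mx_act1 scaler0 addr0.
Qed.

Lemma rho_dec x w : rho x w = X (mat (p x)) w + \sum_k (to_ext Luce x).2 0 k *: Z k w.
Proof.
rewrite {1}[x](ext_dec Luce) linearD lfunE /= -/(mx_act _); congr (_ + _).
by rewrite linear_sum sum_lfunE; apply: eq_bigr => k _; rewrite linearZ lfunE.
Qed.

Lemma z_act_comm k x w : Z k (rho x w) = rho x (Z k w).
Proof.
have [x0 [x1 [hx0 hx1 ->]]] := homog_dec s x.
have key b y : homog s b y -> Z k (rho y w) = rho y (Z k w).
  move=> hy; have := proj1 Wrep _ _ _ _ w (zc_homog Luce k) hy.
  rewrite (zc_central Luce) linear0 lfunE /= /ssign /= expr0 scale1r => /eqP.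
  by rewrite eq_sym subr_eq0 => /eqP.
by rewrite linearD !lfunE /= lfD (key _ _ hx0) (key _ _ hx1).
Qed.

Lemma mx_act_br a b A B w : gl_homog a A -> gl_homog b B -> A \in sl22 K -> B \in sl22 K ->
  X A (X B w) = ssign K a b *: X B (X A w) + X (gl_br A B) w +
    \sum_k omega k A B *: Z k w.
Proof.
move=> hA hB sA sB.
have := proj1 Wrep _ _ _ _ w (tau_homog Luce hA) (tau_homog Luce hB).
rewrite (tau_br Luce sA sB) linearD lfunE /= -/(mx_act _) linear_sum sum_lfunE => e.
rewrite -addrA; apply/eqP; rewrite addrC -subr_eq -e /=; apply/eqP; congr (_ + _).
by apply: eq_bigr => k _; rewrite linearZ lfunE.
Qed.

Lemma mx_act_br_even b A B w : gl_homog false A -> gl_homog b B -> A \in sl22 K -> B \in sl22 K ->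
  X A (X B w) = X B (X A w) + X (gl_br A B) w.
Proof.
move=> hA hB sA sB; rewrite (mx_act_br _ hA hB) // /ssign /= expr0 scale1r big1 ?addr0 //.
by move=> k _; rewrite omega_even // scale0r.
Qed.

Lemma odd_sl A : gl_homog true A -> A \in sl22 K.
Proof.
by move=> hA; rewrite sl22P supertrace4 !(odd_entries hA) !subr0 addr0.
Qed.

Lemma mx_act_br_odd A B w : gl_homog true A -> gl_homog true B ->
  X A (X B w) = - X B (X A w) + X (gl_br A B) w + \sum_k omega k A B *: Z k w.
Proof.
by move=> hA hB; rewrite (mx_act_br _ hA hB) ?odd_sl // /ssign /= expr1 scaleN1r.
Qed.

Lemma h1_X n b A m w : gl_homog b A -> A \in sl22 K -> wtm n A ->
  X h1 w = m%:~R *: w -> X h1 (X A w) = (m + n)%:~R *: X A w.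
Proof.
move=> hA sA wA hw; rewrite (mx_act_br_even _ (h1_homog K) hA) ?h1_sl // hw wA mx_actZ lfZ.
by rewrite -scalerDl rmorphD.
Qed.

Let e1_homog : gl_homog false (E o0 o1). Proof. exact: (E_homog K o0 o1). Qed.
Let f1_homog : gl_homog false (E o1 o0). Proof. exact: (E_homog K o1 o0). Qed.
Let e2_homog : gl_homog false (E o2 o3). Proof. exact: (E_homog K o2 o3). Qed.
Let f2_homog : gl_homog false (E o3 o2). Proof. exact: (E_homog K o3 o2). Qed.

Lemma mx_act_short w : rho (h_short s p) w = 2^-1 *: (X h1 w + X h2 w).
Proof. by rewrite (h_shortE Luce) -/(mx_act _) mx_actZ mx_actD. Qed.

Lemma short_int (c : K) : c \in [:: -1; 0; 1] ->
  exists2 n : int, n \in [:: -1; 0; 1] & c = n%:~R.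
Proof.
by rewrite !inE => /or3P[] /eqP ->; [exists (-1) | exists 0 | exists 1].
Qed.

(* [A] has weight 1 for [h_short], whose eigenvalues are among -1, 0 and 1. *)
Lemma short_cube A : gl_homog false A -> A \in sl22 K ->
  gl_br (h1 + h2) A = 2 *: A -> forall w, X A (X A (X A w)) = 0.
Proof.
move=> hA sA eA w.
have step v : rho (h_short s p) (X A v) = X A (rho (h_short s p) v) + X A v.
  rewrite !mx_act_short -!mx_actD.
  have hh : gl_homog false (h1 + h2).
    by rewrite /gl_homog linearD /= (h1_homog K) (h2_homog K).
  rewrite (mx_act_br_even _ hh hA (rpredD (h1_sl K) (h2_sl K)) sA) eA mx_actZ lfZ scalerDr scalerA.
  by rewrite mulVf ?scale1r // pnatr_eq0.
pose T : 'End(W) := (X A \o (X A \o X A))%VF.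
have TE v : T v = X A (X A (X A v)) by rewrite /T !comp_lfunE.
rewrite -TE; apply: (@shift_nilp _ _ (rho (h_short s p)) T 3 (fun c => c \in [:: -1; 0; 1])).
- move=> v; rewrite !TE !step !lfD -!addrA; congr (_ + _).
  by vring.
- by move=> a v v0 e; apply: (proj2 Wrep) v0 e.
- move=> a /short_int[n nS ->] /short_int[m mS].
  move=> /eqP; rewrite -[3]/(3%:~R) -rmorphB eqr_int => /eqP e.
  by move: nS mS; rewrite -{}e !inE => /or3P[] /eqP ->.
Qed.

Lemma sl2_X (e f h : 'M[K]_4) : gl_homog false e -> gl_homog false f ->
  gl_homog false h -> e \in sl22 K -> f \in sl22 K -> h \in sl22 K ->
  gl_br h e = 2 *: e -> gl_br h f = - (2 *: f) -> gl_br e f = h ->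
  gl_br (h1 + h2) e = 2 *: e -> forall w,
  X h (X h (X h (X h (X h (X h w))))) - 5 *: X h (X h (X h (X h w))) + 4 *: X h (X h w) = 0.
Proof.
move=> he hf hh se sf sh e1 e2 e3 e4 w.
apply: (@sl2_weights _ _ (X e) (X f) (X h)).
- by move=> v; rewrite (mx_act_br_even _ hh he) // e1 mx_actZ.
- by move=> v; rewrite (mx_act_br_even _ hh hf) // e2 mx_actN mx_actZ.
- by move=> v; rewrite (mx_act_br_even _ he hf) // e3.
- exact: short_cube.
Qed.

Lemma br_h_E (a b c d : K) i j :
  gl_br (a *: E o0 o0 + b *: E o1 o1 + c *: E o2 o2 + d *: E o3 o3) (E i j) =
  (nth 0 [:: a; b; c; d] i - nth 0 [:: a; b; c; d] j) *: E i j.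
Proof.
set D := _ + _; have -> : D = diag_mx (\row_i nth 0 [:: a; b; c; d] i).
  apply/matrixP=> k l; rewrite !mxE.
  by elim/I4_ind: k; elim/I4_ind: l; rewrite /= ?mulr1 ?mulr0 ?addr0 ?add0r.
have hD : gl_homog false (diag_mx (\row_i nth 0 [:: a; b; c; d] i)).
  apply/matrixP=> k l; rewrite !mxE.
  by have [->|] := eqVneq k l; rewrite ?addbb //=; case: ifP.
rewrite (gl_br_evenl _ hD).
apply/matrixP=> k l; rewrite -!mulmxE mul_diag_mx mul_mx_diag !mxE.
have [->|_] := eqVneq k i; have [->|_] := eqVneq l j; rewrite ?mulr1 ?mulr0 /=; ring.
Qed.

Lemma h1_diag : h1 = 1 *: E o0 o0 + (-1) *: E o1 o1 + 0 *: E o2 o2 + 0 *: E o3 o3.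
Proof. by rewrite scale1r scaleN1r !scale0r !addr0. Qed.
Lemma h2_diag : h2 = 0 *: E o0 o0 + 0 *: E o1 o1 + 1 *: E o2 o2 + (-1) *: E o3 o3.
Proof. by rewrite scale1r scaleN1r !scale0r !add0r. Qed.
Lemma h12_diag : h1 + h2 = 1 *: E o0 o0 + (-1) *: E o1 o1 + 1 *: E o2 o2 + (-1) *: E o3 o3.
Proof. by rewrite !scale1r !scaleN1r -!addrA. Qed.

Lemma h1_poly w : X h1 (X h1 (X h1 (X h1 (X h1 (X h1 w))))) -
  5 *: X h1 (X h1 (X h1 (X h1 w))) + 4 *: X h1 (X h1 w) = 0.
Proof.
apply: (sl2_X e1_homog f1_homog (h1_homog K)); rewrite ?E_sl ?h1_sl //.
- by rewrite h1_diag br_h_E /=; congr (_ *: _); ring.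
- by rewrite h1_diag br_h_E /= -scaleNr; congr (_ *: _); ring.
- by rewrite br_E_E1 // /ssign /= expr0 scale1r.
- by rewrite h12_diag br_h_E /=; congr (_ *: _); ring.
Qed.

Lemma h2_poly w : X h2 (X h2 (X h2 (X h2 (X h2 (X h2 w))))) -
  5 *: X h2 (X h2 (X h2 (X h2 w))) + 4 *: X h2 (X h2 w) = 0.
Proof.
apply: (sl2_X e2_homog f2_homog (h2_homog K)); rewrite ?E_sl ?h2_sl //.
- by rewrite h2_diag br_h_E /=; congr (_ *: _); ring.
- by rewrite h2_diag br_h_E /= -scaleNr; congr (_ *: _); ring.
- by rewrite br_E_E1 // /ssign /= expr0 scale1r.
- by rewrite h12_diag br_h_E /=; congr (_ *: _); ring.
Qed.

Lemma poly_eig (T : 'End(W)) (c : K) w :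
  (forall w, T (T (T (T (T (T w))))) - 5 *: T (T (T (T w))) + 4 *: T (T w) = 0) ->
  T w = c *: w -> c ^+ 2 * (c ^+ 2 - 1) * (c ^+ 2 - 4) != 0 -> w = 0.
Proof.
move=> hT e c0; have := hT w; rewrite !(e, lfZ) !scalerA -!scaleNr -!scalerDl.
move/eqP; rewrite scaler_eq0 => /orP[|/eqP //].
by rewrite (_ : _ + _ = c ^+ 2 * (c ^+ 2 - 1) * (c ^+ 2 - 4)) ?(negbTE c0) //; ring.
Qed.

Lemma h1_eig (n : int) w : X h1 w = n%:~R *: w ->
  n ^+ 2 * (n ^+ 2 - 1) * (n ^+ 2 - 4) != 0 -> w = 0.
Proof.
move=> e n0; apply: poly_eig h1_poly e _.
by rewrite -[1]/(1%:~R) -[4]/(4%:~R) -!rmorphXn -!rmorphB -!rmorphM intr_eq0.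
Qed.

Lemma h2_eig (n : int) w : X h2 w = n%:~R *: w ->
  n ^+ 2 * (n ^+ 2 - 1) * (n ^+ 2 - 4) != 0 -> w = 0.
Proof.
move=> e n0; apply: poly_eig h2_poly e _.
by rewrite -[1]/(1%:~R) -[4]/(4%:~R) -!rmorphXn -!rmorphB -!rmorphM intr_eq0.
Qed.

Definition top_space : {vspace W} := lker (X h1 - 2 *: \1%VF).
Local Notation F := top_space.

Lemma top_spaceP w : reflect (X h1 w = 2 *: w) (w \in F).
Proof.
rewrite memv_ker add_lfunE opp_lfunE scale_lfunE id_lfunE subr_eq0.
exact: eqP.
Qed.

(** Where h1 is 2 and h2 is n, [h_short] has eigenvalue (2 + n) / 2, which is -1, 0 or 1 only for n
    = -4, -2, 0. *)
Lemma top_h2_eig v (n : int) : v \in F -> X h2 v = n%:~R *: v ->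
  n \notin [:: 0; -2; - 4%:Z] -> v = 0.
Proof.
move=> /top_spaceP e1 e2 nn; apply: contrapT => /eqP v0.
have : rho (h_short s p) v = (2^-1 * (2 + n%:~R)) *: v.
  by rewrite mx_act_short e1 e2 -scalerDl scalerA.
move=> /(proj2 Wrep _ _ v0)/short_int[m mS] /(congr1 (fun x => 2 * x)).
rewrite mulrA divff ?pnatr_eq0 // mul1r -[2]/(2%:~R) -rmorphD -rmorphM => /eqP.
rewrite eqr_int => /eqP e; move: nn; have -> : n = 2 * m - 2 by rewrite -e addrC addKr.
by move: mS; rewrite !inE => /or3P[] /eqP ->.
Qed.

Lemma top_shift n b A v : gl_homog b A -> A \in sl22 K -> wtm n A -> v \in F ->
  X h1 (X A v) = (2 + n)%:~R *: X A v.
Proof. by move=> hA sA wA /top_spaceP e; apply: h1_X hA sA wA _. Qed.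

Lemma top_stable b A v : gl_homog b A -> A \in sl22 K -> wtm 0 A -> v \in F -> X A v \in F.
Proof. by move=> hA sA wA vF; apply/top_spaceP; rewrite (top_shift hA sA wA vF). Qed.

Lemma top_raise n b A v : gl_homog b A -> A \in sl22 K -> wtm n A -> n \in [:: 1; 2] ->
  v \in F -> X A v = 0.
Proof.
move=> hA sA wA nn vF; apply: (h1_eig (top_shift hA sA wA vF)).
by move: nn; rewrite !inE => /orP[] /eqP ->.
Qed.

Lemma wtm_h2 : wtm 0 h2.
Proof.
have -> : h2 = (-1) *: E o3 o3 + E o2 o2 by rewrite scaleN1r addrC.
exact: wtmP (wtm_E K o3 o3) (wtm_E K o2 o2).
Qed.

Let e2_wt : wtm 0 (E o2 o3). Proof. exact: (wtm_E K o2 o3). Qed.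
Let f2_wt : wtm 0 (E o3 o2). Proof. exact: (wtm_E K o3 o2). Qed.
Let br_h2_e2 : gl_br h2 (E o2 o3) = 2 *: E o2 o3.
Proof. by rewrite h2_diag br_h_E /=; congr (_ *: _); ring. Qed.
Let br_h2_f2 : gl_br h2 (E o3 o2) = (-2) *: E o3 o2.
Proof. by rewrite h2_diag br_h_E /=; congr (_ *: _); ring. Qed.
Let br_e2_f2 : gl_br (E o2 o3) (E o3 o2) = h2.
Proof. by rewrite br_E_E1 // /ssign /= expr0 scale1r. Qed.

Let h2e2 w : X h2 (X (E o2 o3) w) = X (E o2 o3) (X h2 w) + 2 *: X (E o2 o3) w.
Proof. by rewrite (mx_act_br_even _ (h2_homog K) e2_homog) ?h2_sl ?E_sl // br_h2_e2 mx_actZ. Qed.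
Let h2f2 w : X h2 (X (E o3 o2) w) = X (E o3 o2) (X h2 w) - 2 *: X (E o3 o2) w.
Proof.
by rewrite (mx_act_br_even _ (h2_homog K) f2_homog) ?h2_sl ?E_sl // br_h2_f2 mx_actZ scaleNr.
Qed.
Let e2f2 w : X (E o2 o3) (X (E o3 o2) w) = X (E o3 o2) (X (E o2 o3) w) + X h2 w.
Proof. by rewrite (mx_act_br_even _ e2_homog f2_homog) ?E_sl // br_e2_f2. Qed.

(** The roots 0, 1, -1, 2, -2 of [h2_poly] and the values 0, -2, -4 allowed by [top_h2_eig] leave 0
    and -2. A vector of weight -2 is killed by f, but weight 2 is absent, which contradicts the
    symmetry of sl(2)-strings. *)
Lemma top_h2_square v : v \in F -> X h2 (X h2 v) = 0.
Proof.
have Fh w : w \in F -> X h2 w \in F by apply: top_stable (h2_homog K) (h2_sl K) wtm_h2.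
have Fe w : w \in F -> X (E o2 o3) w \in F by apply: top_stable e2_homog _ e2_wt; rewrite E_sl.
have Ff w : w \in F -> X (E o3 o2) w \in F by apply: top_stable f2_homog _ f2_wt; rewrite E_sl.
(* Starting from u = h2^2 v, the vectors u2, u3, u4 arise by applying h2 + 2, h2 - 2 and h2 + 1 in
   turn, and h2 - 1 kills u4. The factors other than h2 + 2 are then stripped one by one. *)
move=> vF; pose u := X h2 (X h2 v).
pose u2 := X h2 u + 2 *: u; pose u3 := X h2 u2 - 2 *: u2; pose u4 := X h2 u3 + u3.
have uF : u \in F by rewrite !Fh.
have u2F : u2 \in F by rewrite memvD ?memvZ ?Fh.
have u3F : u3 \in F by rewrite memvB ?memvZ ?Fh.
have u4F : u4 \in F by rewrite memvD ?Fh.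
have u40 : u4 = 0.
  apply: (@top_h2_eig u4 1) => //; rewrite scale1r; apply/eqP; rewrite -subr_eq0 -(h2_poly v).
  by apply/eqP; rewrite /u4 /u3 /u2 /u; vring.
have u30 : u3 = 0.
  apply: (@top_h2_eig u3 (-1)) => //; apply/eqP; rewrite -subr_eq0 -u40.
  by apply/eqP; rewrite /u4; vring.
have u20 : u2 = 0.
  by apply: (@top_h2_eig u2 2) => //; apply/eqP; rewrite -subr_eq0 -u30.
have hu : X h2 u = (-2)%:~R *: u.
  by apply/eqP; rewrite -subr_eq0 -u20; apply/eqP; rewrite /u2; vring.
have fu : X (E o3 o2) u = 0.
  apply: (@h2_eig (- 4%:Z)) => //; rewrite h2f2 hu; vring.
have eeu : X (E o2 o3) (X (E o2 o3) u) = 0.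
  apply: (@top_h2_eig _ 2); rewrite ?Fe // !h2e2 hu; vring.
have e1 : X (E o3 o2) (X (E o2 o3) u) = 2 *: u.
  have := e2f2 u; rewrite fu lf0 hu => /eqP; rewrite eq_sym addr_eq0 => /eqP ->; vring.
have e2 : 2 *: X (E o2 o3) u = 0.
  have := e2f2 (X (E o2 o3) u); rewrite e1 eeu lf0 h2e2 hu => e.
  by rewrite -lfZ e; vring.
have : 2 *: u = 0.
  by rewrite -e1; move/eqP: e2; rewrite scaler_eq0 pnatr_eq0 => /eqP ->; rewrite lf0.
by move/eqP; rewrite scaler_eq0 pnatr_eq0 => /eqP.
Qed.

(** On F both h2^2 and h2^2 e = e (h2 + 2)^2 vanish, so e h2 = - e there; applied twice, this gives
    e = e h2^2 = 0. With the same argument for f, the second sl(2) acts on F by zero. *)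
Lemma top_e2 v : v \in F -> X (E o2 o3) v = 0.
Proof.
have Fh w : w \in F -> X h2 w \in F by apply: top_stable (h2_homog K) (h2_sl K) wtm_h2.
have Fe w : w \in F -> X (E o2 o3) w \in F by apply: top_stable e2_homog _ e2_wt; rewrite E_sl.
have key w : w \in F -> X (E o2 o3) (X h2 w) = - X (E o2 o3) w.
  move=> wF; have := top_h2_square (Fe _ wF).
  rewrite !h2e2 lfD lfZ !h2e2 top_h2_square // => e; apply/eqP; rewrite -addr_eq0.
  have /eqP : 4 *: (X (E o2 o3) (X h2 w) + X (E o2 o3) w) = 0 by rewrite -e; vring.
  by rewrite scaler_eq0 pnatr_eq0.
move=> vF; have := key _ (Fh _ vF); rewrite top_h2_square // lf0 key // opprK.
by move=> <-.
Qed.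

Lemma top_f2 v : v \in F -> X (E o3 o2) v = 0.
Proof.
have Fh w : w \in F -> X h2 w \in F by apply: top_stable (h2_homog K) (h2_sl K) wtm_h2.
have Ff w : w \in F -> X (E o3 o2) w \in F by apply: top_stable f2_homog _ f2_wt; rewrite E_sl.
have key w : w \in F -> X (E o3 o2) (X h2 w) = X (E o3 o2) w.
  move=> wF; have := top_h2_square (Ff _ wF).
  rewrite !h2f2 lfD lfN lfZ !h2f2 top_h2_square // => e; apply/eqP; rewrite -subr_eq0.
  have /eqP : (-4) *: (X (E o3 o2) (X h2 w) - X (E o3 o2) w) = 0 by rewrite -e; vring.
  by rewrite scaler_eq0 oppr_eq0 pnatr_eq0.
move=> vF; have := key _ (Fh _ vF); rewrite top_h2_square // lf0 key //.
Qed.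

Lemma top_h2 v : v \in F -> X h2 v = 0.
Proof.
by move=> vF; have := e2f2 v; rewrite (top_f2 vF) (top_e2 vF) !lf0 add0r.
Qed.

(* The projection onto [top_space], the other generalized eigenspaces of [h1] being killed. *)
Definition top_proj w : W := 48^-1 *: (X h1 (X h1 (X h1 (X h1 (X h1 w))))
  + 2 *: X h1 (X h1 (X h1 (X h1 w))) - X h1 (X h1 (X h1 w)) - 2 *: X h1 (X h1 w)).

Lemma top_projP w : top_proj w \in F.
Proof.
apply/top_spaceP; apply/eqP; rewrite -subr_eq0; apply/eqP.
transitivity (48^-1 *: (X h1 (X h1 (X h1 (X h1 (X h1 (X h1 w))))) -
  5 *: X h1 (X h1 (X h1 (X h1 w))) + 4 *: X h1 (X h1 w))).
  by rewrite /top_proj; vring.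
by rewrite h1_poly scaler0.
Qed.

Lemma top_proj_eig c w : X h1 w = c *: w -> c != 2 -> top_proj w = 0.
Proof.
move=> e c2; have := top_spaceP _ (top_projP w).
have -> : X h1 (top_proj w) = c *: top_proj w by rewrite /top_proj ?(lfZ, lfD, lfN, e); vring.
move/eqP; rewrite -subr_eq0 -scalerBl scaler_eq0 subr_eq0 (negbTE c2) => /eqP //.
Qed.

Lemma top_proj_id v : v \in F -> top_proj v = v.
Proof.
move=> /top_spaceP e; rewrite /top_proj ?(e, lfZ); apply: crd_inj => i.
by rewrite ?(crdD, crdN, crdZ); field.
Qed.

Lemma top_proj_linear : linear top_proj.
Proof. by move=> a u v; rewrite /top_proj; vring. Qed.

End Rep.

(** * The submodule generated by part of the highest weight space *)

Section Generated.
Variables (K : numClosedFieldType) (L : vectType K) (s : lieSuper L).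
Variable p : {linear L -> psl22 K}.
Hypothesis Luce : universal_central_extension s (psl_lie K) p.
Variables (W : vectType K) (rho : {linear L -> 'End(W)}).
Hypothesis Wrep : is_rep s p rho.
Implicit Types (A B C : 'M[K]_4) (U : {vspace W}) (v w : W).
Local Notation E i j := (delta_mx i j : 'M[K]_4).
Local Notation h1 := (h1 K).
Local Notation h2 := (h2 K).
Local Notation X := (mx_act s p rho).
Local Notation Z := (z_act s p rho).
Local Notation F := (top_space s p rho).
Local Notation e := (E o0 o1).
Local Notation f := (E o1 o0).

Let eh : gl_homog false e. Proof. exact: (E_homog K o0 o1). Qed.
Let fh : gl_homog false f. Proof. exact: (E_homog K o1 o0). Qed.
Let es : e \in sl22 K. Proof. exact: E_sl. Qed.
Let fs : f \in sl22 K. Proof. exact: E_sl. Qed.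
Let ew : wtm 2 e. Proof. exact: (wtm_E K o0 o1). Qed.
Let fw : wtm (-2) f. Proof. exact: (wtm_E K o1 o0). Qed.

Lemma X_ef w : X e (X f w) = X f (X e w) + X h1 w.
Proof.
by rewrite (mx_act_br_even Luce Wrep _ eh fh es fs) br_E_E1 // /ssign /= expr0 scale1r.
Qed.

Lemma X_even_mem A w U : gl_homog false A -> A \in sl22 K ->
  X e w \in U -> X f w \in U -> X (E o2 o3) w \in U -> X (E o3 o2) w \in U ->
  X h1 w \in U -> X h2 w \in U -> X A w \in U.
Proof.
move=> hA sA *; rewrite (mx_act_even s p rho w hA sA).
by do !apply: memvD; apply: memvZ.
Qed.

Lemma X_odd_mem A w U : gl_homog true A ->
  (forall i j, ipar i (+) ipar j -> X (E i j) w \in U) -> X A w \in U.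
Proof.
move=> hA h; rewrite [A]matrix_sum_delta.
have sum_mem (I : finType) (G : I -> 'M[K]_4) :
    (forall i, X (G i) w \in U) -> X (\sum_i G i) w \in U.
  move=> hG; elim/big_ind: _ => [|B C hB hC|i _]; last exact: hG.
    by rewrite mx_act0 mem0v.
  by rewrite mx_actD memvD.
apply: (sum_mem) => i; apply: (sum_mem) => j; rewrite mx_actZ.
case: (boolP (ipar i (+) ipar j)) => ij; first by rewrite memvZ ?h.
by rewrite (gl_homog_entry hA) ?scale0r ?mem0v // (negbTE ij).
Qed.

Variable N : {vspace W}.
Hypothesis NF : (N <= F)%VS.
Hypothesis NZ : forall k v, v \in N -> Z k v \in N.

Let inF v : v \in N -> v \in F. Proof. exact: (subvP NF). Qed.

(* [N] is killed by the odd root vectors of weight 1, hence the submodule that it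
   generates is spanned by the products of at most two odd elements on [N2]. *)
Definition N2 : {vspace W} := (N + X f @: N + X f @: (X f @: N))%VS.

Lemma N2_ind U : (forall v, v \in N -> v \in U) -> (forall v, v \in N -> X f v \in U) ->
  (forall v, v \in N -> X f (X f v) \in U) -> forall w, w \in N2 -> w \in U.
Proof.
move=> h0 h1' h2' w /memv_addP[_ /memv_addP[v vN [_ /memv_imgP[v' v'N ->] ->]]].
move=> [_ /memv_imgP[_ /memv_imgP[v2 v2N ->] ->] ->].
by apply: memvD; [apply: memvD; [apply: h0|apply: h1']|apply: h2'].
Qed.

Lemma N_N2 v : v \in N -> v \in N2.
Proof. by move=> vN; rewrite -[v]addr0 memv_add ?mem0v // -[v]addr0 memv_add ?mem0v. Qed.

Lemma fN_N2 v : v \in N -> X f v \in N2.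
Proof.
by move=> vN; rewrite -[X f v]addr0 memv_add ?mem0v // -[X f v]add0r memv_add ?mem0v ?memv_img.
Qed.

Lemma ffN_N2 v : v \in N -> X f (X f v) \in N2.
Proof. by move=> vN; rewrite -[_ (_ v)]add0r memv_add ?mem0v // !memv_img. Qed.

Lemma N_h1 v : v \in N -> X h1 v = 2%:~R *: v.
Proof. by move=> /inF /top_spaceP. Qed.
Lemma N_h1f v : v \in N -> X h1 (X f v) = 0%:~R *: X f v.
Proof. by move=> /N_h1 h; rewrite (h1_X Luce Wrep fh fs fw h). Qed.
Lemma N_h1ff v : v \in N -> X h1 (X f (X f v)) = (-2)%:~R *: X f (X f v).
Proof. by move=> /N_h1f h; rewrite (h1_X Luce Wrep fh fs fw h). Qed.
Lemma N_fff v : v \in N -> X f (X f (X f v)) = 0.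
Proof.
by move=> /N_h1ff h; apply: (h1_eig Luce Wrep (h1_X Luce Wrep fh fs fw h)).
Qed.
Lemma N_e v : v \in N -> X e v = 0.
Proof. by move=> /inF; apply: (top_raise Luce Wrep eh es ew). Qed.

Lemma N2_f w : w \in N2 -> X f w \in N2.
Proof.
move: w; suff h : (N2 <= X f @^-1: N2)%VS.
  by move=> w /(subvP h); rewrite -memv_preim.
apply/subvP; apply: N2_ind => v vN; rewrite -memv_preim.
- exact: fN_N2.
- exact: ffN_N2.
- by rewrite N_fff // mem0v.
Qed.

Lemma N2_lift (T : 'End(W)) (U : {vspace W}) : (forall v, v \in N -> T v \in U) ->
  (forall v, v \in N -> T (X f v) \in U) -> (forall v, v \in N -> T (X f (X f v)) \in U) ->
  forall w, w \in N2 -> T w \in U.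
Proof.
move=> h0 h1' h2' w wN; rewrite memv_preim; apply: N2_ind wN => v vN; rewrite -memv_preim;
  by [apply: h0|apply: h1'|apply: h2'].
Qed.

Lemma X_comm0 A w : gl_homog false A -> A \in sl22 K -> gl_br A f = 0 ->
  X A (X f w) = X f (X A w).
Proof. by move=> hA sA h; rewrite (mx_act_br_even Luce Wrep _ hA fh sA fs) h mx_act0 addr0. Qed.

(** The first sl(2) acts by strings v, f v, f f v with e v = 0, while E34, E43 and h2 kill N and
    commute with f. *)
Lemma N2_even A w : gl_homog false A -> A \in sl22 K -> w \in N2 -> X A w \in N2.
Proof.
move=> hA sA wN.
have comm C : gl_homog false C -> C \in sl22 K -> gl_br C f = 0 ->
    (forall v, v \in N -> X C v = 0) -> X C w \in N2.
  move=> hC sC cf C0; apply: N2_lift wN => v vN.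
  - by rewrite C0 // mem0v.
  - by rewrite X_comm0 // C0 // lf0 mem0v.
  - by rewrite !X_comm0 // C0 // !lf0 mem0v.
apply: (X_even_mem hA sA).
- apply: N2_lift wN => v vN.
  + by rewrite N_e // mem0v.
  + by rewrite X_ef N_e // lf0 add0r N_h1 // memvZ // N_N2.
  + by rewrite X_ef X_ef N_e // lf0 add0r N_h1 // N_h1f // lfZ memvD ?memvZ // fN_N2.
- exact: N2_f.
- apply: comm; first exact: (E_homog K o2 o3).
  + exact: E_sl.
  + by rewrite br_E /= mulr0n scaler0 subrr.
  + by move=> v vN; apply: (top_e2 Luce Wrep); apply: inF.
- apply: comm; first exact: (E_homog K o3 o2).
  + exact: E_sl.
  + by rewrite br_E /= mulr0n scaler0 subrr.
  + by move=> v vN; apply: (top_f2 Luce Wrep); apply: inF.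
- apply: N2_lift wN => v vN.
  + by rewrite N_h1 // memvZ // N_N2.
  + by rewrite N_h1f // memvZ // fN_N2.
  + by rewrite N_h1ff // memvZ // ffN_N2.
- apply: comm; [exact: h2_homog|exact: h2_sl| |].
  + by rewrite h2_diag br_h_E /= subrr scale0r.
  + by move=> v vN; apply: (top_h2 Luce Wrep); apply: inF.
Qed.

Lemma z_act_mx_act k A w : Z k (X A w) = X A (Z k w).
Proof. exact: (z_act_comm Luce Wrep). Qed.

Lemma N2_Z k w : w \in N2 -> Z k w \in N2.
Proof.
move=> wN; apply: N2_lift wN => v vN; rewrite ?z_act_mx_act.
- exact/N_N2/NZ.
- exact/fN_N2/NZ.
- exact/ffN_N2/NZ.
Qed.

Definition Y1 : {vspace W} :=
  (\sum_(ij : 'I_4 * 'I_4 | ipar ij.1 (+) ipar ij.2) X (E ij.1 ij.2) @: N2)%VS.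

Lemma X_Y1 B w : gl_homog true B -> w \in N2 -> X B w \in Y1.
Proof.
move=> hB wN; apply: (X_odd_mem hB) => i j ij.
have := @sumv_sup _ _ _ (i, j) (fun ij : 'I_4 * 'I_4 => ipar ij.1 (+) ipar ij.2)
  (X (E i j) @: N2)%VS (fun ij => X (E ij.1 ij.2) @: N2)%VS ij (subvv _).
by move/subvP; apply; apply: memv_img.
Qed.

Lemma Y1_lift (T : 'End(W)) U :
  (forall B w, gl_homog true B -> w \in N2 -> T (X B w) \in U) ->
  forall w, w \in Y1 -> T w \in U.
Proof.
move=> h w wY; rewrite memv_preim; move: w wY; apply/subvP; apply/subv_sumP => -[i j] /= ij.
apply/subvP=> _ /memv_imgP[w wN ->]; rewrite -memv_preim; apply: h => //.
by rewrite -ij; apply: E_homog.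
Qed.

Lemma Y1_even A w : gl_homog false A -> A \in sl22 K -> w \in Y1 -> X A w \in Y1.
Proof.
move=> hA sA wY; apply: Y1_lift wY => B w' hB w'N.
rewrite (mx_act_br_even Luce Wrep _ hA hB sA (odd_sl hB)) memvD ?X_Y1 //.
  exact: N2_even.
exact: (gl_br_homog hA hB).
Qed.

Lemma Y1_Z k w : w \in Y1 -> Z k w \in Y1.
Proof.
move=> wY; apply: Y1_lift wY => B w' hB w'N; rewrite z_act_mx_act X_Y1 //; exact: N2_Z.
Qed.

Lemma sumZ_mem (U : {vspace W}) (c : 'I_3 -> K) w : (forall k, Z k w \in U) ->
  \sum_k c k *: Z k w \in U.
Proof. by move=> h; apply: memv_suml => k _; rewrite memvZ. Qed.

Lemma br_odd_even A B : gl_homog true A -> gl_homog true B -> gl_homog false (gl_br A B).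
Proof. by move=> hA hB; apply: (gl_br_homog hA hB). Qed.

Lemma N_plus C v : gl_homog true C -> wtm 1 C -> v \in N -> X C v = 0.
Proof. by move=> hC wC /inF; apply: (top_raise Luce Wrep hC (odd_sl hC) wC). Qed.

Lemma N_plus2 B C v : gl_homog true B -> wtm 1 B -> gl_homog true C -> v \in N ->
  X B (X C v) \in N2.
Proof.
move=> hB wB hC vN; rewrite (mx_act_br_odd Luce Wrep _ hB hC) (N_plus hB wB vN) lf0 oppr0 add0r.
rewrite memvD //.
  by apply: N2_even (N_N2 vN); [exact: br_odd_even|exact: sl_br].
by apply: sumZ_mem => k; apply/N_N2/NZ.
Qed.

(** A weight-raising factor is moved to the right. Next to N it kills v, one place further left it
    gives a vector of [N2] by [N_plus2], and the anticommutators are even or central, which preserve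
    [Y1]. *)
Lemma N_plus3 A B C v : gl_homog true A -> gl_homog true B -> gl_homog true C ->
  wtm 1 A \/ wtm 1 B \/ wtm 1 C -> v \in N -> X A (X B (X C v)) \in Y1.
Proof.
move=> hA hB hC w3 vN.
have caseC C' : gl_homog true C' -> wtm 1 C' -> X A (X B (X C' v)) \in Y1.
  by move=> hC' wC; rewrite (N_plus hC' wC) // !lf0 mem0v.
have caseB B' : gl_homog true B' -> wtm 1 B' -> X A (X B' (X C v)) \in Y1.
  by move=> hB' wB; apply: X_Y1 => //; apply: N_plus2.
case: w3 => [wA|[wB|wC]]; [|exact: caseB|exact: caseC].
rewrite (mx_act_br_odd Luce Wrep _ hA hB) !memvD //.
- by rewrite memvN X_Y1 // N_plus2.
- by apply: Y1_even; [exact: br_odd_even|exact: sl_br|apply: X_Y1 => //; apply: N_N2].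
- by apply: sumZ_mem => k; apply: Y1_Z; apply: X_Y1 => //; apply: N_N2.
Qed.

(* If all three factors lower the weight, the result [y] has weight -1 and is not
   lowered by [f], whence [y = f (e y)]. *)
Lemma N_odd3 A B C v : gl_homog true A -> gl_homog true B -> gl_homog true C ->
  v \in N -> X A (X B (X C v)) \in Y1.
Proof.
move=> /odd_dec[A1 [A2 [hA1 wA1 hA2 wA2 ->]]] /odd_dec[B1 [B2 [hB1 wB1 hB2 wB2 ->]]].
move=> /odd_dec[C1 [C2 [hC1 wC1 hC2 wC2 ->]]] vN.
rewrite !(mx_actD _ _ _ C1 C2) !(mx_actD _ _ _ B1 B2) !(mx_actD _ _ _ A1 A2) !lfD.
have pm := N_plus3 _ _ _ _ vN.
have wY : X A2 (X B2 (X C2 v)) \in Y1; last first.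
  by do ?apply: memvD => //; apply: pm; auto.
set y := X A2 _.
have w1 := h1_X Luce Wrep hC2 (odd_sl hC2) wC2 (N_h1 vN).
have w2 := h1_X Luce Wrep hB2 (odd_sl hB2) wB2 w1.
have wy : X h1 y = (-1)%:~R *: y := h1_X Luce Wrep hA2 (odd_sl hA2) wA2 w2.
have fy : X f y = 0.
  exact: (h1_eig Luce Wrep (h1_X Luce Wrep fh fs fw wy)).
have := X_ef y; rewrite fy lf0 wy => /eqP.
rewrite eq_sym scaleN1r subr_eq0 => /eqP <-; apply: Y1_even => //.
have ode D : gl_homog true D -> gl_homog true (gl_br e D) := @gl_br_homog K false true e D eh.
have wde D : wtm (-1) D -> wtm 1 (gl_br e D) by apply: wtm_br eh ew.
rewrite /y (mx_act_br_even Luce Wrep _ eh hA2 es (odd_sl hA2)).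
rewrite (mx_act_br_even Luce Wrep _ eh hB2 es (odd_sl hB2)) (mx_act_br_even Luce Wrep _ eh hC2 es (odd_sl hC2)).
by rewrite N_e // lf0 add0r; do ?[rewrite lfD|apply: memvD]; apply: pm; auto.
Qed.

(** The even element f is pushed to the left of the three odd factors: it preserves [Y1], and its
    brackets with odd matrices are odd. So the statement passes from N to f N and from there to f f
    N. *)
Lemma N2_odd3 A B C w : gl_homog true A -> gl_homog true B -> gl_homog true C ->
  w \in N2 -> X A (X B (X C w)) \in Y1.
Proof.
have step (T : W -> W) : (forall A B C, gl_homog true A -> gl_homog true B ->
      gl_homog true C -> forall v, v \in N -> X A (X B (X C (T v))) \in Y1) ->
    forall A B C, gl_homog true A -> gl_homog true B ->
      gl_homog true C -> forall v, v \in N -> X A (X B (X C (X f (T v)))) \in Y1.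
  move=> h {}A {}B {}C hA hB hC v vN.
  have sw D u : gl_homog true D -> X D (X f u) = X f (X D u) - X (gl_br f D) u.
    by move=> hD; rewrite (mx_act_br_even Luce Wrep _ fh hD fs (odd_sl hD)) addrK.
  have hf D : gl_homog true D -> gl_homog true (gl_br f D) := @gl_br_homog K false true f D fh.
  rewrite (sw C) // lfD (sw B) // !lfN !lfD (sw A) // !lfN.
  have yf u : u \in Y1 -> X f u \in Y1 by apply: Y1_even.
  do ?[apply: memvD | rewrite memvN]; first by apply/yf/h.
  - by apply: h => //; apply: hf.
  - by apply: h => //; apply: hf.
  - by apply: h => //; apply: hf.
move=> hA hB hC; pose T : 'End(W) := (X A \o (X B \o X C))%VF.
have TE u : X A (X B (X C u)) = T u by rewrite /T !comp_lfunE.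
rewrite TE; apply: N2_lift => v vN; rewrite -TE.
- exact: N_odd3.
- by apply: (step id) => // *; apply: N_odd3.
- by apply: (step (X f)) => // *; apply: (step id) => // *; apply: N_odd3.
Qed.

Definition Y0 : {vspace W} :=
  (N2 + \sum_(ij : 'I_4 * 'I_4 | ipar ij.1 (+) ipar ij.2) X (E ij.1 ij.2) @: Y1)%VS.

Definition gen : {vspace W} := (Y0 + Y1)%VS.

Lemma X_Y0 B w : gl_homog true B -> w \in Y1 -> X B w \in Y0.
Proof.
move=> hB wN; apply: (X_odd_mem hB) => i j ij.
have := @sumv_sup _ _ _ (i, j) (fun ij : 'I_4 * 'I_4 => ipar ij.1 (+) ipar ij.2)
  (X (E i j) @: Y1)%VS (fun ij => X (E ij.1 ij.2) @: Y1)%VS ij (subvv _).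
move/subvP => h; apply: (subvP (addvSr N2 _)); apply: h; exact: memv_img.
Qed.

Lemma gen_lift (T : 'End(W)) U : (forall w, w \in N2 -> T w \in U) ->
  (forall w, w \in Y1 -> T w \in U) ->
  (forall B w, gl_homog true B -> w \in Y1 -> T (X B w) \in U) ->
  forall w, w \in gen -> T w \in U.
Proof.
move=> hN hY hX w wG; rewrite memv_preim; move: w wG; apply/subvP.
rewrite /gen /Y0 2!subv_add; apply/andP; split; [apply/andP; split|].
- by apply/subvP => w /hN; rewrite -memv_preim.
- apply/subv_sumP => -[i j] /= ij; apply/subvP=> _ /memv_imgP[w wN ->].
  by rewrite -memv_preim; apply: hX => //; rewrite -ij; apply: E_homog.
- by apply/subvP => w /hY; rewrite -memv_preim.
Qed.

Let Y0_gen w : w \in Y0 -> w \in gen. Proof. exact: (subvP (addvSl _ _)). Qed.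
Let Y1_gen w : w \in Y1 -> w \in gen. Proof. exact: (subvP (addvSr _ _)). Qed.
Let N2_gen w : w \in N2 -> w \in gen.
Proof. by move=> wN; apply: Y0_gen; apply: (subvP (addvSl _ _)). Qed.

Lemma N_gen v : v \in N -> v \in gen.
Proof. by move=> /N_N2 /N2_gen. Qed.

(** Even elements and the center preserve every layer. Odd elements send [N2] to [Y1], [Y1] to [Y0],
    and the odd multiples of [Y1] back to [Y1] by [N2_odd3]. *)
Lemma gen_stable x w : w \in gen -> rho x w \in gen.
Proof.
have Ze k v : v \in gen -> Z k v \in gen.
  move=> vG; apply: gen_lift vG => [u uN|u uY|B u hB uY].
  - exact/N2_gen/N2_Z.
  - exact/Y1_gen/Y1_Z.
  - by rewrite z_act_mx_act; apply/Y0_gen/X_Y0/Y1_Z.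
have Xe A v : gl_homog false A -> A \in sl22 K -> v \in gen -> X A v \in gen.
  move=> hA sA vG; apply: gen_lift vG => [u uN|u uY|B u hB uY].
  - exact/N2_gen/N2_even.
  - exact/Y1_gen/Y1_even.
  - rewrite (mx_act_br_even Luce Wrep _ hA hB sA (odd_sl hB)) memvD //; apply/Y0_gen/X_Y0 => //.
      exact: Y1_even.
    exact: (gl_br_homog hA hB).
have Xo A v : gl_homog true A -> v \in gen -> X A v \in gen.
  move=> hA vG; apply: gen_lift vG => [u uN|u uY|B u hB uY].
  - exact/Y1_gen/X_Y1.
  - exact/Y0_gen/X_Y0.
  - apply: Y1_gen; have TE y : X A (X B y) = (X A \o X B)%VF y by rewrite comp_lfunE.
    rewrite TE; apply: Y1_lift uY => C y hC yN; rewrite -TE; exact: N2_odd3.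
move=> wG; rewrite (rho_dec Luce) memvD //; last first.
  by apply: sumZ_mem => k; apply: Ze.
have [A0 [A1 [k0 k1 eA]]] := gl_dec (mat (p x)).
have [s0 s1] := sl22_graded k0 k1 (eq_ind _ (fun Y => Y \in sl22 K) (mat_sl _) _ eA).
by rewrite eA mx_actD; apply: memvD; [apply: Xe|apply: Xo].
Qed.

Let pF : 'End(W) := linfun (top_proj s p rho).
Let pFE w : pF w = top_proj s p rho w.
Proof.
pose g := HB.pack_for {linear W -> W} (top_proj s p rho)
  (GRing.isLinear.Build _ _ _ _ _ (top_proj_linear s p rho)).
exact: (lfunE g).
Qed.
Let pF_id v : v \in F -> pF v = v.
Proof. by move=> vF; rewrite pFE top_proj_id. Qed.

Lemma top_proj_int n w : X h1 w = n%:~R *: w -> n != 2 -> pF w = 0.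
Proof.
move=> e1 n2; rewrite pFE; apply: (top_proj_eig Luce Wrep e1).
by rewrite -[2]/(2%:~R) eqr_int.
Qed.

Lemma N_wt0 C v : gl_homog false C -> C \in sl22 K -> wtm 0 C -> v \in N -> X C v \in N.
Proof.
move=> hC sC /wtm0_entries /(_ hC) [c1 c2] vN; have vF := inF vN.
rewrite (mx_act_even s p rho v hC sC) c1 c2 !scale0r !add0r.
rewrite (top_e2 Luce Wrep vF) (top_f2 Luce Wrep vF) (top_h2 Luce Wrep vF) N_h1 //.
by rewrite !scaler0 !addr0 ?add0r !memvZ.
Qed.

(** A kills v, so only the anticommutator remains: an even matrix of weight 0, which acts on F by a
    scalar, and central elements. *)
Lemma N_pm A B v : gl_homog true A -> wtm 1 A -> gl_homog true B -> wtm (-1) B ->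
  v \in N -> X A (X B v) \in N.
Proof.
move=> hA wA hB wB vN; rewrite (mx_act_br_odd Luce Wrep _ hA hB) (N_plus hA wA vN) lf0 oppr0 add0r.
rewrite memvD //; last by apply: sumZ_mem => k; apply: NZ.
apply: N_wt0 => //; [exact: br_odd_even|exact: sl_br|exact: (wtm_br hA wA wB)].
Qed.

(** Once odd factors are split by weight, [pF] keeps only weight 2. This occurs on N, for a raising
    factor after a lowering one on N, and for two raising factors on f N. In the last case the inner
    factor B1 kills N, so it may be replaced on f v by the lowering matrix - [f, B1] on v, as in the
    second case. *)
Lemma gen_top_proj w : w \in gen -> pF w \in N.
Proof.
have X1_wt B v n : gl_homog true B -> X h1 v = n%:~R *: v -> (n \in [:: 2; 0; -2]) ->
    pF (X B v) = 0.
  move=> /odd_dec[B1 [B2 [hB1 wB1 hB2 wB2 ->]]] ev n3; rewrite mx_actD lfD.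
  rewrite (top_proj_int (h1_X Luce Wrep hB1 (odd_sl hB1) wB1 ev)).
    rewrite (top_proj_int (h1_X Luce Wrep hB2 (odd_sl hB2) wB2 ev)) ?addr0 //.
    by move: n3; rewrite !inE => /or3P[] /eqP ->.
  by move: n3; rewrite !inE => /or3P[] /eqP ->.
have X2_wt A B v n a b : gl_homog true A -> wtm a A -> gl_homog true B -> wtm b B ->
    X h1 v = n%:~R *: v -> n + b + a != 2 -> pF (X A (X B v)) = 0.
  move=> hA wA hB wB ev; apply: top_proj_int.
  exact: (h1_X Luce Wrep hA (odd_sl hA) wA (h1_X Luce Wrep hB (odd_sl hB) wB ev)).
move=> wG; apply: gen_lift wG => [u uN|u uY|A u hA uY].
- apply: N2_lift uN => v vN.
  + by rewrite (pF_id (inF vN)).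
  + by rewrite (top_proj_int (N_h1f vN)) ?mem0v.
  + by rewrite (top_proj_int (N_h1ff vN)) ?mem0v.
- apply: Y1_lift uY => B u' hB u'N.
  have TE y : pF (X B y) = (pF \o X B)%VF y by rewrite comp_lfunE.
  rewrite TE; apply: N2_lift u'N => v vN; rewrite -TE.
  + by rewrite (X1_wt _ _ _ hB (N_h1 vN)) ?mem0v.
  + by rewrite (X1_wt _ _ _ hB (N_h1f vN)) ?mem0v.
  + by rewrite (X1_wt _ _ _ hB (N_h1ff vN)) ?mem0v.
- have TE y : pF (X A y) = (pF \o X A)%VF y by rewrite comp_lfunE.
  rewrite TE; apply: Y1_lift uY => B u' hB u'N; rewrite -TE.
  have TE2 y : pF (X A (X B y)) = (pF \o (X A \o X B))%VF y by rewrite !comp_lfunE.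
  rewrite TE2; move: u' u'N.
  have [A1 [A2 [hA1 wA1 hA2 wA2 eA]]] := odd_dec hA.
  have [B1 [B2 [hB1 wB1 hB2 wB2 eB]]] := odd_dec hB.
  have split4 y : pF (X A (X B y)) = pF (X A1 (X B1 y)) + pF (X A1 (X B2 y)) +
      pF (X A2 (X B1 y)) + pF (X A2 (X B2 y)).
    by rewrite eB (mx_actD s p rho B1 B2) eA (mx_actD s p rho A1 A2) !lfD addrA.
  have pm v : v \in N -> pF (X A1 (X B2 v)) \in N.
    move=> vN; have mN : X A1 (X B2 v) \in N by apply: N_pm.
    by rewrite (pF_id (inF mN)).
  apply: N2_lift => v vN; rewrite -TE2 split4.
  + rewrite (N_plus hB1 wB1 vN) !lf0 add0r addr0 memvD ?pm //.
    by rewrite (X2_wt _ _ _ _ _ _ hA2 wA2 hB2 wB2 (N_h1 vN)) ?mem0v.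
  + rewrite (X2_wt _ _ _ _ _ _ hA1 wA1 hB2 wB2 (N_h1f vN)) //.
    rewrite (X2_wt _ _ _ _ _ _ hA2 wA2 hB1 wB1 (N_h1f vN)) //.
    rewrite (X2_wt _ _ _ _ _ _ hA2 wA2 hB2 wB2 (N_h1f vN)) // !addr0.
    have := mx_act_br_even Luce Wrep v fh hB1 fs (odd_sl hB1).
    rewrite (N_plus hB1 wB1 vN) lf0 => /esym/eqP; rewrite addr_eq0 => /eqP ->.
    have hg : gl_homog true (gl_br f B1) by apply: (gl_br_homog fh hB1).
    have wg : wtm (-1) (gl_br f B1) by apply: (wtm_br fh fw wB1).
    have mN : X A1 (X (gl_br f B1) v) \in N by apply: N_pm.
    by rewrite !lfN memvN (pF_id (inF mN)).
  + rewrite (X2_wt _ _ _ _ _ _ hA1 wA1 hB1 wB1 (N_h1ff vN)) //.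
    rewrite (X2_wt _ _ _ _ _ _ hA1 wA1 hB2 wB2 (N_h1ff vN)) //.
    rewrite (X2_wt _ _ _ _ _ _ hA2 wA2 hB1 wB1 (N_h1ff vN)) //.
    by rewrite (X2_wt _ _ _ _ _ _ hA2 wA2 hB2 wB2 (N_h1ff vN)) // !addr0 mem0v.
Qed.

Lemma gen_top w : w \in gen -> w \in F -> w \in N.
Proof. by move=> wG wF; have := gen_top_proj wG; rewrite (pF_id wF). Qed.

End Generated.

(** * Submodules, quotients and typicality *)

Lemma leigP (K : fieldType) (V : vectType K) (f : 'End(V)) c :
  passmx.leigenvalue f c <-> exists2 v, v != 0 & f v = c *: v.
Proof.
have eq v : (v \in passmx.leigenspace f c) = (f v == c *: v).
  by rewrite memv_ker add_lfunE opp_lfunE scale_lfunE id_lfunE subr_eq0.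
split=> [h|[v v0 e]].
  exists (vpick (passmx.leigenspace f c)); first by rewrite vpick0.
  by apply/eqP; rewrite -eq memv_pick.
apply/eqP=> e0; move: (eq v); rewrite e0 memv0 e eqxx => /eqP v00.
by rewrite v00 eqxx in v0.
Qed.

Section SubQuo.
Variables (K : fieldType) (L : lmodType K) (s : lieSuper L) (M : supermod s).
Variable U : {vspace M}.
Hypothesis stU : forall x m, m \in U -> act M x m \in U.
Hypothesis grU : forall m0 m1, homog (mgrading M) false m0 ->
  homog (mgrading M) true m1 -> m0 + m1 \in U -> m0 \in U /\ m1 \in U.

Definition subm_grading : grading (subvs_of U).
Proof.
refine (@Grading K (subvs_of U) (fun b x => homog (mgrading M) b (vsval x)) _ _ _ _).
- by move=> b; apply: homog0.
- by move=> b a x y; apply: homogP.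
- move=> x; have [x0 [x1 [hx0 hx1 e]]] := homog_dec (mgrading M) (vsval x).
  have [|u0 u1] := grU hx0 hx1; first by rewrite -e subvsP.
  exists (vsproj U x0), (vsproj U x1); rewrite !vsprojK //; split=> //.
  by apply: val_inj; rewrite /= !vsprojK.
- by move=> x hx0 hx1; apply: val_inj; apply: homog_disj hx0 hx1.
Defined.

Definition subm_act_fun (x : L) : 'End(subvs_of U) :=
  linfun (vsproj U \o act M x \o vsval).

Lemma subm_actE x u : vsval (subm_act_fun x u) = act M x (vsval u).
Proof. by rewrite lfunE /= vsprojK // stU // subvsP. Qed.

Lemma subm_act_linear : linear subm_act_fun.
Proof.
move=> a x y; apply/lfunP=> u; apply: val_inj.
rewrite add_lfunE scale_lfunE linearP /= !subm_actE linearP /=.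
by rewrite add_lfunE scale_lfunE.
Qed.
HB.instance Definition _ :=
  GRing.isLinear.Build K L 'End(subvs_of U) _ subm_act_fun subm_act_linear.

Definition sub_mod : supermod s.
Proof.
refine (@SuperMod K L s (subvs_of U) subm_grading subm_act_fun _ _).
- by move=> a b x m hx hm /=; rewrite subm_actE; apply: act_homog.
- move=> a b x y m hx hy; apply: val_inj; rewrite linearB linearZ /= !subm_actE scalerN.
  exact: act_br.
Defined.

Definition quom_grading : grading (quo U).
Proof.
refine (@Grading K (quo U)
  (fun b y => exists2 x, homog (mgrading M) b x & quo_pi U x = y) _ _ _ _).
- by move=> b; exists 0; [apply: homog0 | rewrite linear0].
- move=> b a _ _ [x hx <-] [y hy <-]; exists (a *: x + y); first exact: homogP.
  by rewrite linearP.
- move=> y; have [x0 [x1 [hx0 hx1 e]]] := homog_dec (mgrading M) (vsval y).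
  exists (quo_pi U x0), (quo_pi U x1); split; [by exists x0 | by exists x1 |].
  by rewrite -linearD -e /= quo_piK.
- move=> _ [x hx <-] [y hy e]; apply/quo_pi_eq0.
  have [|//] := @grU x (- y) hx (homogN hy).
  by apply/quo_pi_eq0; rewrite linearB /= e subrr.
Defined.

Definition quom_act_fun (x : L) : 'End(quo U) :=
  linfun (quo_pi U \o act M x \o vsval).

Lemma quom_actE x m : quom_act_fun x (quo_pi U m) = quo_pi U (act M x m).
Proof.
rewrite lfunE /=; apply/eqP; rewrite -subr_eq0 -linearB -linearB /=; apply/eqP/quo_pi_eq0.
by apply: stU; apply/quo_pi_eq0; rewrite linearB /= quo_piK subrr.
Qed.

Lemma quom_act_linear : linear quom_act_fun.
Proof.
move=> a x y; apply/lfunP=> u; rewrite -[u]quo_piK.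
rewrite add_lfunE scale_lfunE !quom_actE linearP /=.
by rewrite add_lfunE scale_lfunE linearP.
Qed.
HB.instance Definition _ :=
  GRing.isLinear.Build K L 'End(quo U) _ quom_act_fun quom_act_linear.

Definition quo_mod : supermod s.
Proof.
refine (@SuperMod K L s (quo U) quom_grading quom_act_fun _ _).
- move=> a b x _ hx [m hm <-] /=; rewrite quom_actE.
  by exists (act M x m) => //; apply: act_homog.
- move=> a b x y m hx hy; rewrite -[m]quo_piK /= !quom_actE (act_br _ hx hy).
  by rewrite linearB linearZ.
Defined.

Lemma sub_mod_actE x (u : sub_mod) : vsval (act sub_mod x u) = act M x (vsval u).
Proof. exact: subm_actE. Qed.

Lemma quo_mod_actE x m : act quo_mod x (quo_pi U m) = quo_pi U (act M x m).
Proof. exact: quom_actE. Qed.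

End SubQuo.

Lemma nilpotent_sub (K : fieldType) (V W : vectType K) (f : 'End(V)) (g : 'End(W))
    (i : W -> V) : (forall w, i (g w) = f (i w)) -> injective i -> i 0 = 0 ->
  nilpotent_lfun f -> nilpotent_lfun g.
Proof.
move=> ig inj i0 [n hn]; exists n => w; apply: inj; rewrite i0 -[RHS](hn (i w)).
by elim: n {hn} => //= n IH; rewrite ig IH.
Qed.

Lemma nilpotent_quo (K : fieldType) (V W : vectType K) (f : 'End(V)) (g : 'End(W))
    (q : V -> W) : (forall v, q (f v) = g (q v)) -> (forall w, exists v, q v = w) ->
  q 0 = 0 -> nilpotent_lfun f -> nilpotent_lfun g.
Proof.
move=> qf surj q0 [n hn]; exists n => w; have [v <-] := surj w.
by rewrite -[RHS]q0 -(hn v); elim: n {hn} => //= n ->; rewrite qf.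
Qed.

Section Objects.
Variables (K : numClosedFieldType) (L : vectType K) (s : lieSuper L).
Variable p : {linear L -> psl22 K}.
Hypothesis Luce : universal_central_extension s (psl_lie K) p.
Variable chi : 'Hom(subvs_of (center s), K^o).
Implicit Types M N : supermod s.
Local Notation C := (mod1_chi p chi).

Lemma mod1_rep M : in_mod1 p M -> is_rep s p (act M).
Proof.
move=> hM; split=> [a b x y m hx hy|c w w0 e]; first exact: act_br hx hy.
by apply: hM; apply/leigP; exists w.
Qed.

Definition Cobj M : Prop := in_mod1 p M /\ has_gen_char chi M.

Lemma sub_Cobj M (U : {vspace M}) (stU : forall x m, m \in U -> act M x m \in U) grU :
  Cobj M -> Cobj (@sub_mod K L s M U stU grU).
Proof.
move=> [h1 h2]; split=> [c /leigP[v v0 e]|z].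
  apply: h1; apply/leigP; exists (vsval v).
    by rewrite -[0]/(vsval (0 : subvs_of U)) (inj_eq val_inj).
  by rewrite -sub_mod_actE e linearZ.
apply: (nilpotent_sub (i := vsval) _ _ _ (h2 z)); [|exact: val_inj|exact: linear0].
move=> w; rewrite !add_lfunE !opp_lfunE !scale_lfunE !id_lfunE linearB linearZ /=.
by rewrite sub_mod_actE.
Qed.

(** An eigenvalue c of H on the quotient is one on M: otherwise H - c is injective, hence bijective
    on U, and a vector that it sends into U would lie in U. *)
Lemma quo_Cobj M (U : {vspace M}) (stU : forall x m, m \in U -> act M x m \in U) grU :
  Cobj M -> Cobj (@quo_mod K L s M U stU grU).
Proof.
move=> [h1 h2]; split=> [c /leigP[v v0 e]|z].
  apply: h1; apply: contrapT => nc; pose H := act M (h_short s p).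
  pose f : 'End(M) := H - c *: \1%VF.
  have fE x : f x = H x - c *: x.
    by rewrite /f add_lfunE opp_lfunE scale_lfunE id_lfunE.
  have finj x : f x = 0 -> x = 0.
    rewrite fE => /eqP; rewrite subr_eq0 => /eqP hx; apply: contrapT => /eqP x0.
    by apply: nc; apply/leigP; exists x.
  have fU x : x \in U -> f x \in U by move=> xU; rewrite fE memvB ?memvZ ?stU.
  have : f (vsval v) \in U.
    apply/quo_pi_eq0; rewrite fE linearB linearZ /= -quo_mod_actE quo_piK.
    by rewrite e subrr.
  move=> /(inj_stable_surj finj fU)[u uU e'].
  have uv : u = vsval v.
    by apply/eqP; rewrite -subr_eq0; apply/eqP/finj; rewrite linearB /= e' subrr.
  move: v0; rewrite -[v]quo_piK -uv; suff -> : quo_pi U u = 0 by rewrite eqxx.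
  exact/quo_pi_eq0.
apply: (nilpotent_quo (q := quo_pi U) _ _ _ (h2 z)); [|by move=> w; exists (vsval w); apply: quo_piK|exact: linear0].
move=> w; rewrite !add_lfunE !opp_lfunE !scale_lfunE !id_lfunE linearB linearZ /=.
by rewrite quo_mod_actE.
Qed.

Definition is_mor M N (f : 'Hom(M, N)) : Prop :=
  (forall b m, homog (mgrading M) b m -> homog (mgrading N) b (f m)) /\
  (forall x m, f (act M x m) = act N x (f m)).

Lemma mor_ex (X Y : ob C) (f : 'Hom(sval X, sval Y)) : is_mor f ->
  exists g : hom C X Y, forall m, supermor_val g m = f m.
Proof. by move=> hf; exists (Supermor (introT (asboolP _) hf)). Qed.

Lemma mor_mor (X Y : ob C) (f : hom C X Y) : is_mor (supermor_val f).
Proof. exact: (elimT (asboolP _) (valP f)). Qed.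

Lemma mor_eq (X Y : ob C) (f g : hom C X Y) :
  (forall m, supermor_val f m = supermor_val g m) -> f = g.
Proof. by move=> h; apply/val_inj/lfunP. Qed.

Lemma mor0E (X Y : ob C) m : supermor_val (0 : hom C X Y) m = 0.
Proof. by rewrite lfunE. Qed.

Lemma mor1E (X : ob C) m : supermor_val (idm C X) m = m.
Proof. by rewrite /= lfunE. Qed.

Lemma morME (X Y T : ob C) (f : hom C Y T) (g : hom C X Y) m :
  supermor_val (cmp f g) m = supermor_val f (supermor_val g m).
Proof. by rewrite /= comp_lfunE. Qed.

Lemma is_zeroP (X : ob C) : is_zero X <-> forall m : sval X, m = 0.
Proof.
split=> [h m|h]; first by rewrite -[LHS]mor1E h mor0E.
by apply: mor_eq => m; rewrite [RHS]mor0E [LHS]h.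
Qed.

Lemma bij_iso (X Y : ob C) (f : hom C X Y) :
  (forall m, supermor_val f m = 0 -> m = 0) -> (forall n, exists m, supermor_val f m = n) ->
  is_iso f.
Proof.
move=> finj fsurj; have [fh fa] := mor_mor f.
have ker0 : lker (supermor_val f) == 0%VS.
  rewrite -subv0; apply/subvP=> m; rewrite memv_ker memv0 => /eqP /finj ->.
  exact: eqxx.
pose g := ((supermor_val f)^-1)%VF.
have fK m : g (supermor_val f m) = m by apply: lker0_lfunK.
have gK n : supermor_val f (g n) = n by have [m <-] := fsurj n; rewrite fK.
have [|g' eg] := @mor_ex Y X g.
  split=> [b n hn|x n]; last first.
    by rewrite -{1}[n]gK -fa fK.
  have [m0 [m1 [h0 h1 e]]] := homog_dec (mgrading (sval X)) (g n).
  have en : n = supermor_val f m0 + supermor_val f m1 by rewrite -lfD -e gK.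
  have [k0 k1] := (fh _ _ h0, fh _ _ h1).
  case: b hn => hn.
    suff -> : g n = m1 by [].
    rewrite e (finj m0) ?add0r //; apply: (homog_disj k0).
    have -> : supermor_val f m0 = n - supermor_val f m1 by rewrite en addrK.
    by apply: homogD => //; apply: homogN.
  suff -> : g n = m0 by [].
  rewrite e (finj m1) ?addr0 //; apply: (@homog_disj _ _ (mgrading (sval Y))) => //.
  have -> : supermor_val f m1 = n - supermor_val f m0 by rewrite en addrC addKr.
  by apply: homogD => //; apply: homogN.
by exists g'; split; apply: mor_eq => m; rewrite morME mor1E eg.
Qed.

Lemma ker_stable M N (f : 'Hom(M, N)) : is_mor f ->
  forall x m, m \in lker f -> act M x m \in lker f.
Proof. by move=> [_ fa] x m; rewrite !memv_ker fa => /eqP ->; rewrite lf0. Qed.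

Lemma ker_graded M N (f : 'Hom(M, N)) : is_mor f ->
  forall m0 m1, homog (mgrading M) false m0 -> homog (mgrading M) true m1 ->
  m0 + m1 \in lker f -> m0 \in lker f /\ m1 \in lker f.
Proof.
move=> [fh _] m0 m1 h0 h1; rewrite !memv_ker lfD addr_eq0 => /eqP e.
suff f0 : f m0 = 0.
  by rewrite f0 eqxx; split=> //; rewrite -oppr_eq0 -e f0.
by apply: (homog_disj (fh _ _ h0)); rewrite e; apply/homogN/fh.
Qed.

(** The kernel is itself an object of the category, and f equalises its inclusion with 0. *)
Lemma monic_inj (X Y : ob C) (f : hom C X Y) : monic f ->
  forall m, supermor_val f m = 0 -> m = 0.
Proof.
move=> mf m fm0; have hf := mor_mor f.
pose Kf := sub_mod (ker_stable hf) (ker_graded hf).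
pose X' : ob C := exist _ Kf (sub_Cobj _ _ (proj2_sig X)).
pose i0 : 'Hom(sval X', sval X) := linfun vsval.
have i0E u : i0 u = vsval u by rewrite lfunE.
have [|i ei] := @mor_ex X' X i0.
  split=> [b u hu|x u]; rewrite !i0E //.
  exact: sub_mod_actE.
have mk : m \in lker (supermor_val f) by rewrite memv_ker fm0.
have : i = 0.
  apply: mf; apply: mor_eq => u; rewrite !morME mor0E lf0 ei i0E.
  by apply/eqP; rewrite -memv_ker subvsP.
move=> /(congr1 (fun g : hom C X' X => supermor_val g (vsproj _ m))).
by rewrite ei i0E mor0E vsprojK.
Qed.

End Objects.

Section Typical.
Variables (K : numClosedFieldType) (L : vectType K) (s : lieSuper L).
Variable p : {linear L -> psl22 K}.
Hypothesis Luce : universal_central_extension s (psl_lie K) p.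
Variable chi : 'Hom(subvs_of (center s), K^o).
Implicit Types M N : supermod s.
Local Notation C := (mod1_chi p chi).
Local Notation FM M := (top_space s p (act M)).
Local Notation h1 := (h1 K).

Definition gstable M (U : {vspace M}) : Prop :=
  (forall x m, m \in U -> act M x m \in U) /\
  (forall m0 m1, homog (mgrading M) false m0 -> homog (mgrading M) true m1 ->
    m0 + m1 \in U -> m0 \in U /\ m1 \in U).

Definition sub_ob (X : ob C) (U : {vspace sval X}) (g : gstable U) : ob C :=
  exist _ (sub_mod (proj1 g) (proj2 g)) (sub_Cobj (proj1 g) (proj2 g) (proj2_sig X)).

Definition quo_ob (X : ob C) (U : {vspace sval X}) (g : gstable U) : ob C :=
  exist _ (quo_mod (proj1 g) (proj2 g)) (quo_Cobj (proj1 g) (proj2 g) (proj2_sig X)).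

Lemma sub_incl (X : ob C) (U : {vspace sval X}) (g : gstable U) :
  exists i : hom C (sub_ob g) X, forall u, supermor_val i u = vsval u.
Proof.
pose i0 : 'Hom(sval (sub_ob g), sval X) := linfun vsval.
have i0E u : i0 u = vsval u by rewrite lfunE.
have [|i ei] := @mor_ex _ _ _ _ _ (sub_ob g) X i0; last by exists i => u; rewrite ei.
by split=> [b u hu|x u]; rewrite !i0E //; apply: sub_mod_actE.
Qed.

Lemma img_gstable M N (f : 'Hom(M, N)) (U : {vspace M}) : is_mor f -> gstable U ->
  gstable (f @: U)%VS.
Proof.
move=> [fh fa] [stU grU]; split=> [x _ /memv_imgP[m mU ->]|n0 n1 h0 h1' ].
  by rewrite -fa memv_img // stU.
move=> /memv_imgP[m mU e]; have [m0 [m1 [k0 k1 em]]] := homog_dec (mgrading M) m.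
have [u0 u1] := grU _ _ k0 k1 (eq_ind _ (fun m => m \in U) mU _ em).
have e01 : n0 - f m0 = f m1 - n1.
  by apply/eqP; rewrite subr_eq addrAC -lfD [m1 + _]addrC -em -e addrK.
have z0 : n0 - f m0 = 0.
  apply: (@homog_disj _ _ (mgrading N)).
    by apply: homogD => //; apply/homogN/fh.
  by rewrite e01; apply: homogD; [apply: fh|apply: homogN].
have z1 : f m1 - n1 = 0 by rewrite -e01.
move/eqP: z0; move/eqP: z1; rewrite !subr_eq0 => /eqP <- /eqP ->.
by rewrite !memv_img.
Qed.

Lemma fullv_gstable M : gstable (fullv : {vspace M}).
Proof. by split=> *; rewrite ?memvf. Qed.

(** A nonzero graded submodule of least dimension will do. *)
Lemma simple_sub (X : ob C) : ~ is_zero X ->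
  exists (Y : ob C) (i : hom C Y X), is_simple Y /\
    (forall m, supermor_val i m = 0 -> m = 0).
Proof.
move=> X0; pose P n := `[< exists U : {vspace sval X}, [/\ gstable U, U != 0%VS & \dim U = n] >].
have exP : exists n, P n.
  exists (\dim (fullv : {vspace sval X})); apply/asboolP; exists fullv; split=> //.
    exact: fullv_gstable.
  apply/eqP=> f0; apply: X0; apply/is_zeroP => m; apply/eqP.
  by rewrite -memv0 -f0 memvf.
have [n /asboolP[U [gU U0 dU]] minU] := ex_minnP exP.
have [i ei] := sub_incl gU; exists (sub_ob gU), i; split; last first.
  by move=> m; rewrite ei => e; apply: val_inj.
split=> [/is_zeroP z|Y f mf].
  move/negP: U0; apply; rewrite -subv0; apply/subvP=> u uU.
  have := z (vsproj U u) => /(congr1 val) /=; rewrite vsprojK // => ->.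
  exact: mem0v.
have finj := monic_inj mf.
pose V := (supermor_val (cmp i f) @: fullv)%VS.
have gV : gstable V by apply: img_gstable (mor_mor _) (fullv_gstable _).
have VE m : vsval (supermor_val f m) \in V.
  by rewrite -ei -morME memv_img // memvf.
have sVU : (V <= U)%VS.
  by apply/subvP=> _ /memv_imgP[m _ ->]; rewrite morME ei subvsP.
have [V0|V0] := eqVneq V 0%VS.
  left; apply/is_zeroP => m; apply: finj; apply: val_inj; apply/eqP => /=.
  by rewrite -memv0 -V0 VE.
right; apply: bij_iso => // u.
have VU : V = U.
  by apply/eqP; rewrite eqEdim sVU /= dU minU //; apply/asboolP; exists V.
have : vsval u \in V by rewrite VU subvsP.
move=> /memv_imgP[m _ e]; exists m; apply: val_inj => /=.
by rewrite e morME ei.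
Qed.

Lemma top_space_mor M N (f : 'Hom(M, N)) m : is_mor f -> m \in FM M -> f m \in FM N.
Proof. by move=> [_ fa] /top_spaceP e; apply/top_spaceP; rewrite /mx_act -fa -/(mx_act _ _ _ _) e lfZ. Qed.

Lemma top_space_iso0 (X Y : ob C) : isomorphic X Y -> FM (sval X) = 0%VS -> FM (sval Y) = 0%VS.
Proof.
move=> [f [g [gf fg]]] FX0; apply/eqP; rewrite -subv0; apply/subvP=> y yF.
have := top_space_mor (mor_mor g) yF; rewrite FX0 !memv0 => /eqP gy.
by rewrite -[y]mor1E -fg morME gy lf0.
Qed.

Lemma top_space_sub0 (X Y : ob C) (i : hom C Y X) : (forall m, supermor_val i m = 0 -> m = 0) ->
  FM (sval X) = 0%VS -> FM (sval Y) = 0%VS.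
Proof.
move=> inj FX0; apply/eqP; rewrite -subv0; apply/subvP=> y yF.
have := top_space_mor (mor_mor i) yF; rewrite FX0 !memv0 => /eqP /inj ->.
exact: eqxx.
Qed.

Lemma isomorphic_sym (X Y : ob C) : isomorphic X Y -> isomorphic Y X.
Proof. by move=> [f [g [gf fg]]]; exists g, f. Qed.

Hypothesis typ : typical_char p chi.

(** [op_mod] changes only the grading, so the isomorphism between the shifted S and T also compares
    the highest weight spaces of S and T. *)
Lemma top_space_simple0 (X Y : ob C) : is_simple X -> is_simple Y ->
  FM (sval X) = 0%VS -> FM (sval Y) = 0%VS.
Proof.
move=> sX sY; have [S [T [sS sT nST dich opST]]] := typ.
have [f [g [gf fg]]] := opST.
have ST : FM (sval S) = 0%VS <-> FM (sval T) = 0%VS.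
  have /asboolP fm := valP f; have /asboolP gm := valP g.
  have fK m : supermor_val f (supermor_val g m) = m.
    by have /(congr1 (fun u => supermor_val u m)) := fg; rewrite /= comp_lfunE id_lfunE.
  have gK m : supermor_val g (supermor_val f m) = m.
    by have /(congr1 (fun u => supermor_val u m)) := gf; rewrite /= comp_lfunE id_lfunE.
  split=> F0; apply/eqP; rewrite -subv0; apply/subvP=> y yF.
    have e : (supermor_val g y : sval S) = 0.
      by apply/eqP; rewrite -memv0 -F0; apply: (top_space_mor gm yF).
    by rewrite -[y]fK e lf0 mem0v.
  have e : supermor_val f y = 0.
    by apply/eqP; rewrite -memv0 -F0; apply: (top_space_mor fm yF).
  by rewrite -[y]gK e lf0; apply: mem0v.
have to (Z : ob C) : is_simple Z -> FM (sval Z) = 0%VS <-> FM (sval S) = 0%VS.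
  move=> /dich[] iso; split=> h.
  - exact: top_space_iso0 iso h.
  - exact: top_space_iso0 (isomorphic_sym iso) h.
  - by apply/ST; apply: top_space_iso0 iso h.
  - by apply: top_space_iso0 (isomorphic_sym iso) _; apply/ST.
by move=> /(to _ sX) /(to _ sY).
Qed.

(* By typicality all simple objects have the same ungraded [top_space]; if it
   vanished, then [top_space] would vanish on all objects by induction on the dimension. *)
Lemma top_space_zero (X : ob C) (X1 : ob C) : FM (sval X1) <> 0%VS ->
  FM (sval X) = 0%VS -> is_zero X.
Proof.
move=> F1 F0; apply: contrapT => X0; apply: F1.
have [Y [i [sY inj]]] := simple_sub X0.
have FY : FM (sval Y) = 0%VS by apply: top_space_sub0 inj F0.
have simp0 (Z : ob C) : is_simple Z -> FM (sval Z) = 0%VS by move=> sZ; apply: top_space_simple0 sY sZ FY.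
have [n] := ubnP (\dim (fullv : {vspace sval X1})).
elim: n X1 => // n IH X1 dX.
have [/is_zeroP z|nz] := pselect (is_zero X1).
  by apply/eqP; rewrite -subv0; apply/subvP=> v _; rewrite (z v) mem0v.
have [Z [j [sZ jinj]]] := simple_sub nz.
have gU : gstable (supermor_val j @: fullv)%VS.
  exact: img_gstable (mor_mor _) (fullv_gstable _).
set U := (_ @: _)%VS in gU.
have U0 : (0 < \dim U)%N.
  rewrite lt0n dimv_eq0; apply/eqP=> U0; apply: (proj1 sZ); apply/is_zeroP=> m.
  apply: jinj; apply/eqP; rewrite -memv0 -U0; exact: memv_img (memvf _).
have dQ : (\dim (fullv : {vspace sval (quo_ob gU)}) < n)%N.
  rewrite dimvf /dim /= dimv_compl; rewrite dimvf ltnS in dX.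
  apply: leq_trans dX; rewrite dimvf ltn_subrL U0 /= -dimvf.
  exact: leq_trans U0 (dimvS (subvf U)).
have FQ := IH _ dQ.
apply/eqP; rewrite -subv0; apply/subvP=> v vF.
have qF : (quo_pi U v : sval (quo_ob gU)) \in FM (sval (quo_ob gU)).
  apply/top_spaceP; have /top_spaceP := vF; rewrite /mx_act => e.
  transitivity (quo_pi U (act (sval X1) (tau s p h1) v)); first exact: quo_mod_actE.
  by rewrite e linearZ.
have qv : quo_pi U v = 0.
  by apply/eqP; move: qF; rewrite FQ memv0.
have /memv_imgP[z _ ez] : v \in U by apply/quo_pi_eq0.
have zF : z \in FM (sval Z).
  apply/top_spaceP; apply/eqP; rewrite -subr_eq0; apply/eqP/jinj.
  by rewrite lfD lfN lfZ /mx_act (proj2 (mor_mor j)) -/(mx_act _ _ _ _) -ez (elimT (top_spaceP _ _ _ _) vF) subrr.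
by rewrite ez; move: zF; rewrite simp0 // !memv0 => /eqP ->; rewrite lf0.
Qed.

End Typical.

(** * Modules with prescribed highest weight space *)

Section Fundamental.
Variables (K : numFieldType) (B : comNzRingType) (iota : {rmorphism K -> B}).
Variables (p q r s : B).
Implicit Types A C : 'M[K]_4.

Let c A (i j : 'I_4) : B := iota (A i j).
Let half : B := iota 2^-1.

(* The natural representation of gl(2|2) made traceless on both diagonal blocks and
   twisted by the outer automorphism attached to the matrix [[p, q], [r, s]]. *)
Definition fund_entry A (i j : 'I_4) : B :=
  match val i, val j with
  | 0, 0 => half * (c A o0 o0 - c A o1 o1)
  | 1, 1 => - (half * (c A o0 o0 - c A o1 o1))
  | 2, 2 => half * (c A o2 o2 - c A o3 o3)
  | 3, 3 => - (half * (c A o2 o2 - c A o3 o3))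
  | 0, 1 => c A o0 o1 | 1, 0 => c A o1 o0
  | 2, 3 => c A o2 o3 | 3, 2 => c A o3 o2
  | 0, 2 => p * c A o0 o2 + r * c A o3 o1
  | 3, 1 => q * c A o0 o2 + s * c A o3 o1
  | 0, 3 => p * c A o0 o3 - r * c A o2 o1
  | 2, 1 => - (q * c A o0 o3) + s * c A o2 o1
  | 1, 2 => p * c A o1 o2 - r * c A o3 o0
  | 3, 0 => - (q * c A o1 o2) + s * c A o3 o0
  | 1, 3 => p * c A o1 o3 + r * c A o2 o0
  | _, _ => q * c A o1 o3 + s * c A o2 o0
  end.

Definition fund A : 'M[B]_4 := \matrix_(i, j) fund_entry A i j.

(** The coefficients of the binary quadratic form (p X + r Y)(q X + s Y), whose discriminant is (p s
    - q r)^2. *)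
Definition fund_z (k : 'I_3) : B :=
  match val k with 0 => p * q | 1 => r * s | _ => p * s + q * r end.

Lemma fundP a A C : fund (a *: A + C) = iota a *: fund A + fund C.
Proof.
apply/matrixP=> i j; rewrite !mxE.
by elim/I4_ind: i; elim/I4_ind: j; rewrite /fund_entry /c /= !mxE ?(rmorphD, rmorphM); ring.
Qed.

Lemma fund_scalar a : fund a%:M = 0.
Proof.
apply/matrixP=> i j; rewrite !mxE.
by elim/I4_ind: i; elim/I4_ind: j; rewrite /fund_entry /c /= !mxE /= ?mulr1n ?mulr0n ?rmorph0; ring.
Qed.

Lemma fund_homog b A i j : gl_homog b A -> ipar i (+) ipar j != b -> fund A i j = 0.
Proof.
move=> hA; rewrite mxE; elim/I4_ind: i; elim/I4_ind: j; case: b hA => hA //= _;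
  rewrite /fund_entry /c /= ?(even_entries hA) ?(odd_entries hA) ?rmorph0; ring.
Qed.

Let half2 : half + half = 1.
Proof. by rewrite /half -rmorphD (_ : _ + _ = 1) ?rmorph1 //; field. Qed.

Lemma fund_mul A C i j : (fund A *m fund C) i j =
  fund_entry A i o0 * fund_entry C o0 j + fund_entry A i o1 * fund_entry C o1 j +
  fund_entry A i o2 * fund_entry C o2 j + fund_entry A i o3 * fund_entry C o3 j.
Proof. by rewrite !mxE sum4 !mxE. Qed.

Let c_gl_br_even A C i j : gl_homog false A -> c (gl_br A C) i j =
  c A i o0 * c C o0 j + c A i o1 * c C o1 j + c A i o2 * c C o2 j + c A i o3 * c C o3 j
  - (c C i o0 * c A o0 j + c C i o1 * c A o1 j + c C i o2 * c A o2 j + c C i o3 * c A o3 j).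
Proof.
move=> hA; rewrite (gl_br_evenl _ hA) /c.
have -> : (A * C - C * A) i j = (A * C) i j - (C * A) i j by rewrite !mxE.
by rewrite !mulmx4 !(rmorphB, rmorphD, rmorphM).
Qed.

Let c_gl_br_odd A C i j : gl_homog true A -> gl_homog true C -> c (gl_br A C) i j =
  c A i o0 * c C o0 j + c A i o1 * c C o1 j + c A i o2 * c C o2 j + c A i o3 * c C o3 j
  + (c C i o0 * c A o0 j + c C i o1 * c A o1 j + c C i o2 * c A o2 j + c C i o3 * c A o3 j).
Proof.
move=> hA hC; rewrite (gl_brE hA hC) /c /ssign /= expr1 scaleN1r opprK.
have -> : (A * C + C * A) i j = (A * C) i j + (C * A) i j by rewrite !mxE.
by rewrite !mulmx4 !(rmorphB, rmorphD, rmorphM).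
Qed.

Let c_even A : gl_homog false A ->
  ((c A o0 o2 = 0) * (c A o0 o3 = 0) * (c A o1 o2 = 0) * (c A o1 o3 = 0)) *
  ((c A o2 o0 = 0) * (c A o2 o1 = 0) * (c A o3 o0 = 0) * (c A o3 o1 = 0)).
Proof. by move=> hA; rewrite /c !(even_entries hA) rmorph0. Qed.

Let c_odd A : gl_homog true A ->
  ((c A o0 o0 = 0) * (c A o0 o1 = 0) * (c A o1 o0 = 0) * (c A o1 o1 = 0)) *
  ((c A o2 o2 = 0) * (c A o2 o3 = 0) * (c A o3 o2 = 0) * (c A o3 o3 = 0)).
Proof. by move=> hA; rewrite /c !(odd_entries hA) rmorph0. Qed.

Let c_sl A : A \in sl22 K -> c A o3 o3 = c A o0 o0 + c A o1 o1 - c A o2 o2.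
Proof.
rewrite sl22P supertrace4 /c -!rmorphD -rmorphB => /eqP h; congr (iota _).
by apply/eqP; rewrite eq_sym -subr_eq0 h.
Qed.

(** The diagonal blocks have equal traces, so one t serves both; the names x and y hide the factors
    [half], which [ring] cannot cancel. *)
Let c_diag A : A \in sl22 K -> exists x y t : B,
  (((half * (c A o0 o0 - c A o1 o1))%R = x) * ((half * (c A o2 o2 - c A o3 o3))%R = y) *
  (c A o0 o0 = (t + x)%R) * (c A o1 o1 = (t - x)%R) *
  (c A o2 o2 = (t + y)%R) * (c A o3 o3 = (t - y)%R))%type.
Proof.
move=> sA; exists (half * (c A o0 o0 - c A o1 o1)), (half * (c A o2 o2 - c A o3 o3)),
  (half * (c A o0 o0 + c A o1 o1)); rewrite (c_sl sA); do !split => //;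
  rewrite -[LHS]mul1r -half2; ring.
Qed.

(** [half] is an opaque constant for [ring]; multiplying one side by [half + half] = 1 supplies the
    missing relation. *)
Ltac ring_half :=
  first [ ring | rewrite -[LHS]mul1r -half2; ring | rewrite -[RHS]mul1r -half2; ring ].

Lemma fund_br_ee A C : gl_homog false A -> gl_homog false C ->
  fund A *m fund C - fund C *m fund A = fund (gl_br A C).
Proof.
move=> hA hC; apply/matrixP=> i j.
have -> : (fund A *m fund C - fund C *m fund A) i j =
  (fund A *m fund C) i j - (fund C *m fund A) i j by rewrite mxE [X in _ + X]mxE.
rewrite !fund_mul [RHS]mxE.
by elim/I4_ind: i; elim/I4_ind: j; rewrite /fund_entry /= ?c_gl_br_even //
  ?(c_even hA) ?(c_even hC); ring_half.
Qed.

(** Since the supertrace of A vanishes, making the two diagonal blocks traceless subtracts the same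
    scalar from both, which does not affect the commutator with C. *)
Lemma fund_br_eo A C : gl_homog false A -> A \in sl22 K -> gl_homog true C ->
  fund A *m fund C - fund C *m fund A = fund (gl_br A C).
Proof.
move=> hA sA hC; have [x [y [t e]]] := c_diag sA; apply/matrixP=> i j.
have -> : (fund A *m fund C - fund C *m fund A) i j =
  (fund A *m fund C) i j - (fund C *m fund A) i j by rewrite mxE [X in _ + X]mxE.
rewrite !fund_mul [RHS]mxE.
by elim/I4_ind: i; elim/I4_ind: j; rewrite /fund_entry /= ?c_gl_br_even //
  ?e ?(c_even hA) ?(c_odd hC); ring.
Qed.

Hypothesis det1 : p * s - q * r = 1.

Lemma fund_br_oo A C : gl_homog true A -> gl_homog true C ->
  fund A *m fund C + fund C *m fund A =
  fund (gl_br A C) + (\sum_k iota (omega k A C) * fund_z k)%:M.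
Proof.
move=> hA hC; rewrite sum3 /fund_z /=.
have -> : iota (omega k2 A C) = half * (c A o0 o2 * c C o2 o0 + c A o0 o3 * c C o3 o0
    + c A o1 o2 * c C o2 o1 + c A o1 o3 * c C o3 o1 + c A o2 o0 * c C o0 o2
    + c A o3 o0 * c C o0 o3 + c A o2 o1 * c C o1 o2 + c A o3 o1 * c C o1 o3).
  by rewrite /omega /= rmorphM !rmorphD !rmorphM.
have -> : iota (omega k0 A C) = c A o0 o2 * c C o1 o3 + c A o1 o3 * c C o0 o2
    - c A o0 o3 * c C o1 o2 - c A o1 o2 * c C o0 o3.
  by rewrite /omega /= !(rmorphB, rmorphD, rmorphM).
have -> : iota (omega k1 A C) = c A o2 o0 * c C o3 o1 + c A o3 o1 * c C o2 o0
    - c A o2 o1 * c C o3 o0 - c A o3 o0 * c C o2 o1.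
  by rewrite /omega /= !(rmorphB, rmorphD, rmorphM).
set w0 := c A o0 o2 * c C o1 o3 + _ - _ - _.
set w1 := c A o2 o0 * c C o3 o1 + _ - _ - _.
(* The two sides are made comparable for [ring]: these terms are multiplied by [half + half], and
   below the entries of [fund (gl_br A C)] by p s - q r, both equal to 1. *)
have -> : w0 * (p * q) + w1 * (r * s) = (half + half) * (w0 * (p * q) + w1 * (r * s)).
  by rewrite half2 mul1r.
apply/matrixP=> i j; rewrite mxE !fund_mul [RHS]mxE [X in _ = X + _]mxE
  [X in _ = _ + X]mxE -[fund_entry (gl_br A C) i j]mulr1 -[X in _ = _ * X + _]det1 /w0 /w1.
by elim/I4_ind: i; elim/I4_ind: j; rewrite /fund_entry /= ?mulr1n ?mulr0n ?c_gl_br_odd //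
  ?(c_odd hA) ?(c_odd hC); ring_half.
Qed.

End Fundamental.

(** The shape of a commutator on a tensor product: the mixed products v and w cancel. In
    [cancel_cross_odd] they do so because of the Koszul sign. *)
Lemma cancel_cross (V : zmodType) (u v w z u' z' : V) :
  u + v + (w + z) - (u' + w + (v + z')) = (u - u') + (z - z').
Proof.
by rewrite !opprD (AC ((2*2)*(2*2)) (((1*5)*(4*8))*((2*7)*(3*6)))) /= !subrr !addr0.
Qed.

Lemma cancel_cross_odd (V : zmodType) (u v w z u' z' : V) :
  u + v + (- w + z) + (u' + w + (- v + z')) = (u + u') + (z + z').
Proof.
by rewrite (AC ((2*2)*(2*2)) (((1*5)*(4*8))*((2*7)*(6*3)))) /= !subrr !addr0.
Qed.

Definition tpar (m : 'I_(4 * 4)) : bool :=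
  ipar (mxtens_unindex m).1 (+) ipar (mxtens_unindex m).2.

Lemma tparE (ij : 'I_4 * 'I_4) : tpar (mxtens_index ij) = ipar ij.1 (+) ipar ij.2.
Proof. by rewrite /tpar mxtens_indexK. Qed.

(** * The tensor product of two twists *)

Section Tensor.
Variables (K : numFieldType) (B : comNzRingType) (iota : {rmorphism K -> B}).
Variables (p q r s p' q' r' s' : B).
Hypotheses (det1 : p * s - q * r = 1) (det1' : p' * s' - q' * r' = 1).
Implicit Types A C : 'M[K]_4.
Local Notation V := (fund iota p q r s).
Local Notation V' := (fund iota p' q' r' s').

Definition par_mx : 'M[B]_4 := diag_mx (\row_i (-1) ^+ ipar i).

Definition tens_z k : B := fund_z p q r s k + fund_z p' q' r' s' k.

(** [par_mx] is the Koszul sign of an odd matrix passing the first factor; it makes odd actions on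
    different factors anticommute. *)
Definition tens_fund A : 'M[B]_(4 * 4) :=
  V A *t 1%:M + 1%:M *t V' (gl_comp false A) + par_mx *t V' (gl_comp true A).

Lemma tensDl m n (A A' : 'M[B]_m) (C : 'M[B]_n) : (A + A') *t C = A *t C + A' *t C.
Proof. by apply/matrixP=> i j; rewrite !mxE mulrDl. Qed.
Lemma tensDr m n (A : 'M[B]_m) (C C' : 'M[B]_n) : A *t (C + C') = A *t C + A *t C'.
Proof. by apply/matrixP=> i j; rewrite !mxE mulrDr. Qed.
Lemma tensZl m n a (A : 'M[B]_m) (C : 'M[B]_n) : (a *: A) *t C = a *: (A *t C).
Proof. by apply/matrixP=> i j; rewrite !mxE mulrA. Qed.
Lemma tensZr m n a (A : 'M[B]_m) (C : 'M[B]_n) : A *t (a *: C) = a *: (A *t C).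
Proof. by apply/matrixP=> i j; rewrite !mxE mulrCA. Qed.
Lemma tensNl m n (A : 'M[B]_m) (C : 'M[B]_n) : (- A) *t C = - (A *t C).
Proof. by rewrite -scaleN1r tensZl scaleN1r. Qed.
Lemma tensNr m n (A : 'M[B]_m) (C : 'M[B]_n) : A *t (- C) = - (A *t C).
Proof. by rewrite -scaleN1r tensZr scaleN1r. Qed.
Lemma tens1 (a : B) : (a%:M : 'M_4) *t (1%:M : 'M_4) = a%:M.
Proof.
apply/matrixP=> i j; case: (mxtens_indexP i) => i0 i1; case: (mxtens_indexP j) => j0 j1.
rewrite tensmxE !mxE (inj_eq (can_inj (@mxtens_indexK _ _))) xpair_eqE.
by case: (i0 == j0); case: (i1 == j1); rewrite /= ?mulr1 ?mulr0 ?mul0r.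
Qed.
Lemma tens1r (a : B) : (1%:M : 'M_4) *t (a%:M : 'M_4) = a%:M.
Proof.
apply/matrixP=> i j; case: (mxtens_indexP i) => i0 i1; case: (mxtens_indexP j) => j0 j1.
rewrite tensmxE !mxE (inj_eq (can_inj (@mxtens_indexK _ _))) xpair_eqE.
by case: (i0 == j0); case: (i1 == j1); rewrite /= ?mul1r ?mulr0 ?mul0r.
Qed.

Lemma tens_fundP a A C : tens_fund (a *: A + C) = iota a *: tens_fund A + tens_fund C.
Proof.
rewrite /tens_fund !linearP /= !fundP !tensDl !tensDr !tensZl !tensZr !scalerDr.
by rewrite (AC ((2*2)*2) ((1*3*5)*(2*4*6))) /=.
Qed.

Lemma fund0' : V' 0 = 0. Proof. by rewrite -(raddf0 (@scalar_mx K 4)) fund_scalar. Qed.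

Lemma tens_even A : gl_homog false A -> tens_fund A = V A *t 1%:M + 1%:M *t V' A.
Proof.
move=> hA; rewrite /tens_fund [gl_comp false A]hA -{3}hA gl_comp_comp /=.
by rewrite fund0' tensmx0 addr0.
Qed.

Lemma tens_fund_scalar a : tens_fund a%:M = 0.
Proof. by rewrite (tens_even (gl_homog1 a)) !fund_scalar tens0mx tensmx0 addr0. Qed.

Lemma tens_odd A : gl_homog true A -> tens_fund A = V A *t 1%:M + par_mx *t V' A.
Proof.
move=> hA; rewrite /tens_fund [gl_comp true A]hA -{2}hA gl_comp_comp /=.
by rewrite fund0' tensmx0 addr0.
Qed.

Lemma par_mulE A i j : (par_mx *m V A) i j = (-1) ^+ ipar i * V A i j.
Proof. by rewrite mul_diag_mx [LHS]mxE [X in X * _]mxE. Qed.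

Lemma mul_parE A i j : (V A *m par_mx) i j = V A i j * (-1) ^+ ipar j.
Proof. by rewrite mul_mx_diag [LHS]mxE [X in _ * X]mxE. Qed.

Lemma par_even A : gl_homog false A -> par_mx *m V A = V A *m par_mx.
Proof.
move=> hA; apply/matrixP=> i j; rewrite par_mulE mul_parE.
have [e|ne] := eqVneq (ipar i (+) ipar j) false.
  by rewrite mulrC; congr (_ * _ ^+ _); case: (ipar i) (ipar j) e => [] [].
by rewrite (fund_homog _ _ _ _ _ hA ne) mulr0 mul0r.
Qed.

Lemma par_odd A : gl_homog true A -> par_mx *m V A = - (V A *m par_mx).
Proof.
move=> hA; apply/matrixP=> i j; rewrite par_mulE [RHS]mxE mul_parE.
have [e|ne] := eqVneq (ipar i (+) ipar j) true.
  rewrite mulrC -mulrN; congr (_ * _).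
  by case: (ipar i) (ipar j) e => [] [] //= _; rewrite ?expr0 ?expr1 ?opprK.
by rewrite (fund_homog _ _ _ _ _ hA ne) mulr0 mul0r oppr0.
Qed.

Lemma par_square : par_mx *m par_mx = 1%:M.
Proof.
rewrite mulmx_diag; apply/matrixP=> i j; rewrite !mxE.
by case: (ipar i); rewrite ?expr0 ?expr1 ?mulrNN mulr1.
Qed.

Lemma tens_br_ee A C : gl_homog false A -> gl_homog false C ->
  tens_fund A *m tens_fund C - tens_fund C *m tens_fund A = tens_fund (gl_br A C).
Proof.
move=> hA hC; rewrite (tens_even hA) (tens_even hC) (tens_even (gl_br_homog hA hC)).
rewrite !mulmxDl !mulmxDr !tensmx_mul !mulmx1 !mul1mx cancel_cross.
by rewrite -tensNl -tensDl -tensNr -tensDr !fund_br_ee.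
Qed.

Lemma tens_br_eo A C : gl_homog false A -> A \in sl22 K -> gl_homog true C ->
  tens_fund A *m tens_fund C - tens_fund C *m tens_fund A = tens_fund (gl_br A C).
Proof.
move=> hA sA hC; rewrite (tens_even hA) (tens_odd hC) (tens_odd (gl_br_homog hA hC)).
rewrite !mulmxDl !mulmxDr !tensmx_mul !mulmx1 !mul1mx (par_even hA) cancel_cross.
by rewrite -tensNl -tensDl -tensNr -tensDr !fund_br_eo.
Qed.

Lemma tens_br_oo A C : gl_homog true A -> gl_homog true C ->
  tens_fund A *m tens_fund C + tens_fund C *m tens_fund A =
  tens_fund (gl_br A C) + (\sum_k iota (omega k A C) * tens_z k)%:M.
Proof.
move=> hA hC; rewrite (tens_odd hA) (tens_odd hC) (tens_even (gl_br_homog hA hC)).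
rewrite !mulmxDl !mulmxDr !tensmx_mul !mulmx1 !mul1mx (par_odd hA) (par_odd hC) par_square.
rewrite !tensNl cancel_cross_odd -tensDl -tensDr !fund_br_oo //.
rewrite tensDl tensDr tens1 tens1r addrACA; congr (_ + _).
rewrite -raddfD /= -big_split; congr (_%:M); apply: eq_bigr => k _ /=.
by rewrite -mulrDr.
Qed.

Lemma tens_fund_entry b A k l : gl_homog b A -> tpar k (+) tpar l != b ->
  tens_fund A k l = 0.
Proof.
move=> hA; case: (mxtens_indexP k) => k1 k2; case: (mxtens_indexP l) => l1 l2.
rewrite !tparE => ne.
have -> : tens_fund A = V A *t 1%:M + (if b then par_mx else 1%:M) *t V' A.
  by case: b hA ne => hA _; [apply: tens_odd|apply: tens_even].
have z1 : V A k1 l1 * (k2 == l2)%:R = 0.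
  have [e|] := eqVneq k2 l2; last by rewrite mulr0.
  rewrite (fund_homog _ _ _ _ _ hA) ?mul0r //.
  by move: ne; rewrite e; case: (ipar k1) (ipar l1) (ipar l2) => [] [] [].
have z2 : (if b then par_mx else 1%:M) k1 l1 * V' A k2 l2 = 0.
  have [e|ne1] := eqVneq k1 l1; last first.
    by case: b {hA ne}; rewrite !mxE (negbTE ne1) ?mulr0n mul0r.
  rewrite (fund_homog _ _ _ _ _ hA) ?mulr0 //.
  by move: ne; rewrite e; case: (ipar k2) (ipar l2) (ipar l1) => [] [] [].
rewrite mxE !tensmxE z2 addr0 -[RHS]z1 !mxE.
by [].
Qed.

End Tensor.

Section MatrixAction.
Variables (K : fieldType) (B : comAlgType K) (N : algmod B) (n : nat).
Variable iota : {rmorphism K -> B}.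
Hypothesis iotaE : forall a, iota a = a%:A.
Implicit Types S T : 'M[B]_n.
Local Notation W := {ffun 'I_n -> N}.

Definition mat_act_fun T (x : W) : W := [ffun i => \sum_j aact N (T i j) (x j)].

Lemma mat_act_fun_linear T : linear (mat_act_fun T).
Proof.
move=> a x y; apply/ffunP=> i; rewrite !ffunE scaler_sumr -big_split /=.
by apply: eq_bigr => j _; rewrite !ffunE linearP.
Qed.

Definition mat_act T : 'End(W) :=
  linfun (HB.pack_for {linear W -> W} (mat_act_fun T)
    (GRing.isLinear.Build _ _ _ _ _ (mat_act_fun_linear T))).

Lemma mat_actE T x i : mat_act T x i = \sum_j aact N (T i j) (x j).
Proof. by rewrite lfunE /= ffunE. Qed.

Lemma mat_act_linear a S T x : mat_act (iota a *: S + T) x = a *: mat_act S x + mat_act T x.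
Proof.
apply/ffunP=> i; rewrite [in RHS]ffunE [X in _ = X + _]ffunE !mat_actE scaler_sumr -big_split /=.
apply: eq_bigr => j _; rewrite !mxE iotaE mulr_algl linearP /=.
by rewrite add_lfunE scale_lfunE.
Qed.

Lemma mat_actD S T x : mat_act (S + T) x = mat_act S x + mat_act T x.
Proof. by have := mat_act_linear 1 S T x; rewrite rmorph1 !scale1r. Qed.

Lemma mat_act0 x : mat_act 0 x = 0.
Proof.
apply/ffunP=> i; rewrite mat_actE ffunE big1 // => j _.
by rewrite mxE linear0 lfunE.
Qed.

Lemma mat_actM S T x : mat_act (S *m T) x = mat_act S (mat_act T x).
Proof.
apply/ffunP=> i; rewrite !mat_actE.
under [RHS]eq_bigr do rewrite mat_actE linear_sum.
rewrite exchange_big; apply: eq_bigr => j _ /=.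
rewrite mxE linear_sum sum_lfunE; apply: eq_bigr => k _.
by rewrite aactM comp_lfunE.
Qed.

Lemma aact_alg a v : aact N (iota a) v = a *: v.
Proof. by rewrite iotaE linearZ /= scale_lfunE aact1 id_lfunE. Qed.

End MatrixAction.

Section KacModule.
Variables (K : numClosedFieldType) (L : vectType K) (s : lieSuper L).
Variable p : {linear L -> psl22 K}.
Hypothesis Luce : universal_central_extension s (psl_lie K) p.
Variables (B : comAlgType K) (N : algmod B) (iota : {rmorphism K -> B}).
Hypothesis iotaE : forall a, iota a = a%:A.
Variables (a b c d a' b' c' d' : B).
Hypotheses (det1 : a * d - b * c = 1) (det1' : a' * d' - b' * c' = 1).

Local Notation T := (tens_fund iota a b c d a' b' c' d').
Local Notation zeta := (tens_z a b c d a' b' c' d').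
Local Notation W := {ffun 'I_(4 * 4) -> N}.

(* The tensor product of two twists of the natural representation by matrices of
   SL(2, B), over B, with the [B]-module [N]. *)
Definition kac_grading : grading W.
Proof.
refine (@Grading K W (fun e x => forall k, tpar k != e -> x k = 0) _ _ _ _).
- by move=> e k _; rewrite ffunE.
- by move=> e u x y hx hy k ne; rewrite !ffunE hx // hy // scaler0 addr0.
- move=> x; exists [ffun k => if tpar k then 0 else x k], [ffun k => if tpar k then x k else 0].
  split; [by move=> k; rewrite ffunE; case: ifP => //| by move=> k; rewrite ffunE; case: ifP|].
  by apply/ffunP=> k; rewrite !ffunE; case: ifP => _; rewrite ?addr0 ?add0r.
- move=> x h0 h1; apply/ffunP=> k; rewrite ffunE.
  by case: (boolP (tpar k)) => hk; [apply: h0; rewrite hk|apply: h1; rewrite (negbTE hk)].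
Defined.

Definition kac_mx (x : L) : 'M[B]_(4 * 4) :=
  T (mat (p x)) + (\sum_k iota ((to_ext Luce x).2 0 k) * zeta k)%:M.

Lemma kac_mx_linear u x y : kac_mx (u *: x + y) = iota u *: kac_mx x + kac_mx y.
Proof.
have e : to_ext Luce (u *: x + y) = u *: to_ext Luce x + to_ext Luce y by rewrite linearP.
have e' : mat (p (u *: x + y)) = u *: mat (p x) + mat (p y) by rewrite !linearP.
rewrite /kac_mx e' tens_fundP e.
have -> : \sum_k iota ((u *: to_ext Luce x + to_ext Luce y).2 0 k) * zeta k =
  iota u * (\sum_k iota ((to_ext Luce x).2 0 k) * zeta k) + \sum_k iota ((to_ext Luce y).2 0 k) * zeta k.
  rewrite mulr_sumr -big_split; apply: eq_bigr => k _ /=.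
  by rewrite !mxE rmorphD rmorphM mulrDl mulrA.
by rewrite [(_ + _)%:M]raddfD /= -scale_scalar_mx [in RHS]scalerDr [RHS]addrACA.
Qed.

Definition kac_act_fun (x : L) : 'End(W) := mat_act N (kac_mx x).

Lemma kac_act_linear : linear kac_act_fun.
Proof.
move=> u x y; apply/lfunP=> w; rewrite /kac_act_fun kac_mx_linear (mat_act_linear iotaE).
by rewrite add_lfunE scale_lfunE.
Qed.
HB.instance Definition _ :=
  GRing.isLinear.Build K L 'End(W) _ kac_act_fun kac_act_linear.

(** A commutator ignores scalar shifts; the sign -1 is met only for two odd elements, whose scalar
    parts vanish. *)
Lemma shift_comm m (S U : 'M[B]_m) (t u k : B) : k = 1 \/ (t = 0 /\ u = 0) ->
  S *m U - k *: (U *m S) = (S + t%:M) *m (U + u%:M) - k *: ((U + u%:M) *m (S + t%:M)).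
Proof.
case=> [->|[-> ->]]; last by rewrite raddf0 !addr0.
rewrite !scale1r !mulmxDl !mulmxDr -!scalar_mxM (mulrC u t) -!(scalar_mxC t) -!(scalar_mxC u).
by rewrite !opprD (AC ((2*2)*(2*2)) ((1*5)*((2*7)*((3*6)*(4*8))))) /= !subrr !addr0.
Qed.

Lemma tens_shift A t : T (A + t%:M) = T A.
Proof.
have := tens_fundP iota a b c d a' b' c' d' 1 A t%:M.
by rewrite scale1r rmorph1 scale1r => ->; rewrite tens_fund_scalar addr0.
Qed.

(** [mat (p x)] is a representative modulo scalars and need not be homogeneous; as [T] kills
    scalars, a homogeneous A can replace it. *)
Lemma homog_cases e x : homog s e x -> exists A t, [/\ gl_homog e A, A \in sl22 K,
  p x = psl_class A, kac_mx x = T A + t%:M & e -> t = 0].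
Proof.
move=> hx; have [h1 h2] := proj1 (to_ext_hom Luce) _ _ hx.
rewrite (to_ext_fst Luce) in h1; have [A [hA sA e1]] := psl_homogP h1.
exists A, (\sum_k iota ((to_ext Luce x).2 0 k) * zeta k); split=> //.
  by rewrite /kac_mx e1; have [t ->] := mat_psl_class sA; rewrite tens_shift.
by move=> /h2 ->; rewrite big1 // => k _; rewrite mxE rmorph0 mul0r.
Qed.

Lemma tens_comm e e' A C : gl_homog e A -> gl_homog e' C -> A \in sl22 K -> C \in sl22 K ->
  T A *m T C - iota (ssign K e e') *: (T C *m T A) =
  T (gl_br A C) + (\sum_k iota (omega k A C) * zeta k)%:M.
Proof.
move=> hA hC sA sC.
have om0 : (forall k, omega k A C = 0) -> (\sum_k iota (omega k A C) * zeta k)%:M = 0 :> 'M[B]_(4*4).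
  by move=> h; rewrite big1 ?raddf0 // => k _; rewrite h rmorph0 mul0r.
case: e e' hA hC => [] [] hA hC; rewrite /ssign /= ?expr0 ?expr1 ?rmorphN rmorph1 ?scaleN1r ?scale1r ?opprK.
- exact: tens_br_oo.
- rewrite om0 ?addr0 => [|k]; last by rewrite omegaC omega_even.
  rewrite (gl_br_anti hA hC) /ssign /= expr0 scale1r.
  have := tens_fundP iota a b c d a' b' c' d' (-1) (gl_br C A) 0.
  rewrite scaleN1r addr0 rmorphN rmorph1 scaleN1r => ->.
  rewrite -(tens_br_eo _ _ _ _ _ _ _ _ _ hC sC hA) opprB.
  by rewrite -[0](raddf0 (@scalar_mx K 4)) tens_fund_scalar addr0.
- by rewrite om0 ?addr0 => [|k]; [apply: tens_br_eo|rewrite omega_even].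
- by rewrite om0 ?addr0 => [|k]; [apply: tens_br_ee|rewrite omega_even].
Qed.

Definition kac : supermod s.
Proof.
refine (@SuperMod K L s W kac_grading kac_act_fun _ _).
- move=> e e' x m /homog_cases[A [t [hA sA _ ex et]]] hm k ne.
  rewrite /= mat_actE ex big1 // => l _.
  have [el|nl] := eqVneq (tpar l) e'; last by rewrite (hm _ nl) lf0.
  suff -> : (T A + t%:M) k l = 0 by rewrite linear0 lfunE.
  rewrite mxE (tens_fund_entry _ _ _ _ _ _ _ _ _ hA) ?add0r.
    rewrite mxE; have [ekl|] := eqVneq k l; last by [].
    by move: ne; rewrite ekl el; case: e et {hA ex} => [-> //|_]; rewrite ?mul0rn // addFb eqxx.
  by rewrite el; move: ne; case: (tpar k) (e) (e') => [] [] [].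
- move=> e e' x y m hx hy; rewrite /= /kac_act_fun -!mat_actM.
  have [A [t [hA sA eA ex et]]] := homog_cases hx.
  have [C [u [hC sC eC ey eu]]] := homog_cases hy.
  have exy : kac_mx (br s x y) = kac_mx x *m kac_mx y - iota (ssign K e e') *: (kac_mx y *m kac_mx x).
    have -> : kac_mx (br s x y) = T (gl_br A C) + (\sum_k iota (omega k A C) * zeta k)%:M.
      rewrite /kac_mx; have [_ ->] := to_ext_hom Luce.
      have -> : p (br s x y) = psl_class (gl_br A C).
        by have [[[_ ->] _ _] _] := Luce; rewrite eA eC psl_class_br.
      have [v ->] := mat_psl_class (sl_br A C); rewrite tens_shift; congr (_ + _).
      congr (_%:M); apply: eq_bigr => k _; rewrite mxE !(to_ext_fst Luce) eA eC.
      by rewrite omega_psl_class.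
    rewrite -(tens_comm hA hC sA sC) ex ey; apply: shift_comm.
    rewrite /ssign; case: (boolP (e && e')) => [/andP[/et -> /eu ->]|_]; first by right.
    by left; rewrite expr0 rmorph1.
  rewrite exy; have := mat_act_linear iotaE (- ssign K e e') (kac_mx y *m kac_mx x) (kac_mx x *m kac_mx y) m.
  by rewrite rmorphN !scaleNr ![- _ + _]addrC.
Defined.

End KacModule.

Section KacWeights.
Variables (K : numClosedFieldType) (L : vectType K) (s : lieSuper L).
Variable p : {linear L -> psl22 K}.
Hypothesis Luce : universal_central_extension s (psl_lie K) p.
Variables (B : comAlgType K) (N : algmod B) (iota : {rmorphism K -> B}).
Hypothesis iotaE : forall a, iota a = a%:A.
Variables (a b c d a' b' c' d' : B).
Hypotheses (det1 : a * d - b * c = 1) (det1' : a' * d' - b' * c' = 1).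

Local Notation T := (tens_fund iota a b c d a' b' c' d').
Local Notation zeta := (tens_z a b c d a' b' c' d').
Local Notation M := (kac Luce N iotaE det1 det1').
Local Notation hd u v := (u *: h1 K + v *: h2 K).

Lemma fund_hd (q r t w : B) u v i j : fund iota q r t w (hd u v) i j = iota (hd u v i j).
Proof.
have h : iota 2^-1 * 2 = 1 :> B.
  by rewrite -[2]/(2%:R) -(rmorph_nat iota) -rmorphM mulVf ?rmorph1 // pnatr_eq0.
rewrite !mxE; elim/I4_ind: i; elim/I4_ind: j; rewrite /fund_entry /= !mxE /=;
  rewrite ?(rmorphD, rmorphM, rmorphN, rmorph0, rmorph1) ?mulr0n ?mulr1n; try ring;
  by rewrite -[RHS]mul1r -[X in _ = X * _]h; ring.
Qed.

Lemma hd_homog u v : gl_homog false (hd u v).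
Proof. by rewrite /gl_homog linearP linearZ /= (h1_homog K) (h2_homog K). Qed.

Lemma hd_sl u v : hd u v \in sl22 K.
Proof. by rewrite rpredD ?rpredZ // ?h1_sl ?h2_sl. Qed.

Lemma hd_diag u v i j : i != j -> hd u v i j = 0.
Proof. by elim/I4_ind: i; elim/I4_ind: j => // _; rewrite !mxE /=; ring. Qed.

Definition hwt u v (k : 'I_(4 * 4)) : K :=
  hd u v (mxtens_unindex k).1 (mxtens_unindex k).1 +
  hd u v (mxtens_unindex k).2 (mxtens_unindex k).2.

Lemma tens_hd u v : T (hd u v) = diag_mx (\row_k iota (hwt u v k)).
Proof.
rewrite (tens_even _ _ _ _ _ _ _ _ _ (hd_homog u v)).
apply/matrixP=> k l; case: (mxtens_indexP k) => k1 k2; case: (mxtens_indexP l) => l1 l2.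
rewrite [LHS]mxE !tensmxE [RHS]mxE [X in X *+ _]mxE /hwt mxtens_indexK !fund_hd.
rewrite ![1%:M _ _]mxE (inj_eq (can_inj (@mxtens_indexK _ _))) xpair_eqE rmorphD /=.
move: (hd u v) (@hd_diag u v) => H Hd.
have [<-|/Hd ->] := eqVneq k1 l1; have [<-|/Hd ->] := eqVneq k2 l2;
  by rewrite /= ?rmorph0 ?mulr0n ?mulr1n ?mulr0 ?mul0r ?mulr1 ?mul1r ?addr0 ?add0r.
Qed.

(** [tau] sends h1 and h2 to brackets of lifts of even matrices, on which [omega] vanishes. *)
Lemma to_ext_hd u v : (to_ext Luce (tau s p (hd u v))).2 = 0.
Proof.
have z i j : i != j -> ipar i = ipar j ->
    (to_ext Luce (lift_br s p (delta_mx i j) (delta_mx j i))).2 = 0.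
  move=> ne e; have sij : delta_mx i j \in sl22 K by apply: E_sl.
  have sji : delta_mx j i \in sl22 K by apply: E_sl; rewrite eq_sym.
  rewrite (to_ext_beta Luce sij sji).
  apply/rowP=> k; rewrite !mxE omega_even //.
  by have := E_homog K i j; rewrite e addbb.
have e : (to_ext Luce (tau s p (hd u v))).2 =
    u *: (to_ext Luce (tau s p (h1 K))).2 + v *: (to_ext Luce (tau s p (h2 K))).2.
  by rewrite !linearP !linearZ.
by rewrite e (tau_h1 s p) (tau_h2 s p) !z // !scaler0 addr0.
Qed.

Lemma kac_hd u v (w : M) k : act M (tau s p (hd u v)) w k = hwt u v k *: w k.
Proof.
rewrite /= mat_actE /kac_mx to_ext_hd (p_tau Luce (hd_sl u v)).
have [t ->] := mat_psl_class (hd_sl u v); rewrite tens_shift tens_hd.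
have -> : \sum_i iota ((0 : 'rV[K]_3) 0 i) * zeta i = 0.
  by rewrite big1 // => l _; rewrite mxE rmorph0 mul0r.
rewrite raddf0 addr0 (bigD1 k) //= big1 => [|l ne].
  by rewrite addr0 mxE eqxx mxE mulr1n (aact_alg iotaE).
by rewrite mxE eq_sym (negbTE ne) mulr0n linear0 lfunE.
Qed.

Lemma kac_zc k (w : M) i : act M (zc s p k) w i = aact N (zeta k) (w i).
Proof.
rewrite /= mat_actE /kac_mx to_ext_zc (p_zc Luce).
have -> : mat (0 : psl22 K) = 0 by rewrite linear0.
have -> : T 0 = 0 by rewrite -(raddf0 (@scalar_mx K 4)) tens_fund_scalar.
have -> : \sum_l iota ((delta_mx 0 k : 'rV[K]_3) 0 l) * zeta l = zeta k.
  rewrite (bigD1 k) //= big1 => [|l ne]; last by rewrite mxE (negbTE ne) rmorph0 mul0r.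
  by rewrite mxE !eqxx rmorph1 mul1r addr0.
rewrite add0r (bigD1 i) //= big1 => [|l ne].
  by rewrite addr0 mxE eqxx mulr1n.
by rewrite mxE eq_sym (negbTE ne) mulr0n linear0 lfunE.
Qed.

End KacWeights.

Lemma nonroot (K : numFieldType) (q : {poly K}) : q != 0 -> exists a, q.[a] != 0.
Proof.
move=> q0; apply: contrapT => H.
have := @max_poly_roots _ q [seq i%:R | i <- iota 0 (size q)] q0.
rewrite size_map size_iota ltnn => H'; apply: notF; apply: H'.
  by apply/allP=> _ /mapP[i _ ->]; apply/negPn/negP => h; apply: H; exists i%:R.
by rewrite map_inj_uniq ?iota_uniq // => i j /eqP; rewrite eqr_nat => /eqP.
Qed.

(** * Solving for the central values up to the annihilator of a module *)

Section Spectrum.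
Variables (K : numFieldType) (B : comAlgType K) (N : algmod B).
Variable iota : {rmorphism K -> B}.
Implicit Types b c : B.

Definition nilp b := exists n, aact N (b ^+ n) = 0.

Lemma aactX b n v : aact N (b ^+ n) v = iter n (aact N b) v.
Proof.
elim: n => [|n IH]; first by rewrite expr0 aact1 id_lfunE.
by rewrite exprS aactM comp_lfunE IH.
Qed.

Lemma nilpP b : nilp b <-> nilpotent_lfun (aact N b).
Proof.
split=> [[n e]|[n e]]; exists n; first by move=> v; rewrite -aactX e lfunE.
by apply/lfunP=> v; rewrite aactX e lfunE.
Qed.

Lemma aact_eq0M b c : aact N b = 0 -> aact N (c * b) = 0.
Proof. by move=> e; rewrite aactM e comp_lfun0r. Qed.

Lemma nilpM b c : nilp b -> nilp (c * b).
Proof. by move=> [n e]; exists n; rewrite exprMn aact_eq0M. Qed.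

Lemma nilpD b c : nilp b -> nilp c -> nilp (b + c).
Proof.
move=> [n eb] [m ec]; exists (n + m)%N; rewrite exprDn linear_sum big1 // => i _.
rewrite -mulr_natl; apply: aact_eq0M; have [mi|im] := leqP m i.
  by rewrite -(subnK mi) exprD mulrA aact_eq0M.
have ni : (n <= n + m - i)%N by rewrite -addnBA ?leq_addr // ltnW.
by rewrite mulrC -(subnK ni) exprD mulrA aact_eq0M.
Qed.

Lemma nilp0 : nilp 0.
Proof. by exists 1; rewrite expr1 linear0. Qed.

(* [a] is the only eigenvalue of [b]. *)
Definition spec b (a : K) := nilp (b - iota a).

Lemma spec_iota a : spec (iota a) a.
Proof. by rewrite /spec subrr; exact: nilp0. Qed.

Lemma specD b c u v : spec b u -> spec c v -> spec (b + c) (u + v).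
Proof. by move=> hb hc; rewrite /spec rmorphD opprD addrACA; apply: nilpD. Qed.

Lemma specM b c u v : spec b u -> spec c v -> spec (b * c) (u * v).
Proof.
move=> hb hc; rewrite /spec rmorphM.
rewrite (_ : b * c - _ = c * (b - iota u) + iota u * (c - iota v)); last by ring.
by apply: nilpD; apply: nilpM.
Qed.

Lemma specN b u : spec b u -> spec (- b) (- u).
Proof. by move=> hb; rewrite -mulN1r -(mulN1r u) -(rmorphN1 iota); apply/specM/hb/spec_iota. Qed.

Lemma specB b c u v : spec b u -> spec c v -> spec (b - c) (u - v).
Proof. by move=> hb hc; apply/specD/specN. Qed.

Lemma spec_nat n : spec n%:R n%:R.
Proof. by rewrite -(rmorph_nat iota); apply: spec_iota. Qed.

(** b is u (1 - n) with n nilpotent on N; a truncated geometric series inverts 1 - n up to a power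
    of n that annihilates N. *)
Lemma spec_inv b u : spec b u -> u != 0 -> exists c, aact N (c * b - 1) = 0 /\ spec c u^-1.
Proof.
move=> hb u0; pose n := 1 - iota u^-1 * b.
have hn : nilp n.
  rewrite /n (_ : _ - _ = - iota u^-1 * (b - iota u)); first exact: nilpM.
  by rewrite mulrBr !mulNr -rmorphM mulVf // rmorph1; ring.
case: (hn) => k ek.
have [S [eS hS]] : exists S, (1 - n) * S = 1 - n ^+ k.+1 /\ spec S 1.
  elim: k {ek} => [|k [S [eS hS]]].
    by exists 1; rewrite mulr1 expr1; split=> //; rewrite -(rmorph1 iota); apply: spec_iota.
  exists (1 + n * S); split; first by rewrite mulrDr mulr1 mulrCA eS [n ^+ k.+2]exprS; ring.
  by rewrite /spec rmorph1 addrC addKr mulrC; apply: nilpM.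
exists (iota u^-1 * S); split; last by rewrite -[X in spec _ X]mulr1; apply/specM/hS/spec_iota.
rewrite (_ : _ - 1 = - n * n ^+ k); first exact: aact_eq0M.
have -> : iota u^-1 * S * b = (1 - n) * S by rewrite /n; ring.
by rewrite eS exprS; ring.
Qed.

Lemma aact_eq b c : aact N (b - c) = 0 -> aact N b = aact N c.
Proof. by rewrite linearB /= => /eqP; rewrite subr_eq0 => /eqP. Qed.

(** In the application, e and e' are the errors of two approximate inverses from [spec_inv]. *)
Lemma aact_err2 (b b' e e' f f' : B) : aact N e = 0 -> aact N e' = 0 ->
  b - b' = f * e + f' * e' -> aact N b = aact N b'.
Proof.
by move=> h h' eq; apply: aact_eq; rewrite eq linearD /= !aact_eq0M // addr0.
Qed.

(* [V] is a generic constant. The unknowns [u], [v'] solve the three equations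
   exactly when [d] and [x - u] are invertible in [B]; here they are inverted only
   up to elements acting by zero on [N]. *)
Lemma sl2_pair_generic x y w xi eta om : spec x xi -> spec y eta -> spec w om -> xi != 0 ->
  exists a b c d a' b' c' d', [/\ a * d - b * c = 1, a' * d' - b' * c' = 1 &
    forall k, aact N (tens_z a b c d a' b' c' d' k) =
      aact N (match val k with 0 => x | 1 => y | _ => w end)].
Proof.
move=> hx hy hw xi0.
pose half : B := iota 2^-1; pose t := half * w - 1; pose ta := 2^-1 * om - 1.
have half2 : 2 * half = 1.
  by rewrite /half -(rmorph_nat iota 2) -rmorphM mulfV ?rmorph1 // pnatr_eq0.
have ht : spec t ta by exact: specB (specM (spec_iota _) hw) (spec_nat 1).
(* At v, the first factor is the eigenvalue of d below, and the product of the other two divided by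
   it is the eigenvalue of x - u. *)
pose Q : {poly K} := (xi *: 'X^2 - (2 * (1 + ta)) *: 'X + eta%:P) *
  ((xi *: 'X - ta%:P) * (xi *: 'X - (1 + ta)%:P)).
have lin0 (e : K) : xi *: 'X - e%:P != 0.
  apply/eqP=> /(congr1 (fun q : {poly K} => q`_1)).
  by rewrite coefB coefZ coefX coefC coef0 /= mulr1 subr0; apply/eqP.
have Q0 : Q != 0.
  rewrite !mulf_neq0 ?lin0 //; apply/eqP=> /(congr1 (fun q : {poly K} => q`_2)).
  by rewrite coefD coefB !coefZ coefXn coefX coefC coef0 /= mulr1 mulr0 subr0 addr0; apply/eqP.
have [v] := nonroot Q0; rewrite !hornerE /= => Qv.
have [d0 [q1 q2]] : eta - 2 * v * (1 + ta) + v ^+ 2 * xi != 0 /\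
    (v * xi - ta != 0 /\ v * xi - 1 - ta != 0).
  move: Qv; rewrite !mulf_eq0 !negb_or. move=> /andP[/andP[h1 h2] h3]; split; [|split].
  - by apply: contra h1 => /eqP e; apply/eqP; rewrite -e /ta; ring.
  - by apply: contra h2 => /eqP e; apply/eqP; rewrite -e /ta; ring.
  - by apply: contra h3 => /eqP e; apply/eqP; rewrite -e /ta; ring.
(* The equation for w = 2 (1 + t) reads u V + (x - u) v' = t. Eliminating v' from the equation for
   y, the terms in u^2 cancel and u d = x y - V x - t - t^2 remains. *)
pose V := iota v; pose d := y - 2 * V * (1 + t) + V ^+ 2 * x.
have hV : spec V v := spec_iota v.
have hd : spec d (eta - 2 * v * (1 + ta) + v ^+ 2 * xi).
  have h1 := specD (spec_nat 1) ht; have h2 := specM (spec_nat 2) hV.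
  by rewrite /d !expr2; exact: specD (specB hy (specM h2 h1)) (specM (specM hV hV) hx).
have [de [ede hde]] := spec_inv hd d0.
pose u := (y * x - V * x - t - t ^+ 2) * de.
pose u0 := (eta * xi - v * xi - ta - ta ^+ 2) / (eta - 2 * v * (1 + ta) + v ^+ 2 * xi).
have hu : spec u u0.
  rewrite /u /u0 !expr2.
  exact: specM (specB (specB (specB (specM hy hx) (specM hV hx)) ht) (specM ht ht)) hde.
have xu0 : xi - u0 != 0.
  rewrite (_ : xi - u0 = (v * xi - ta) * (v * xi - 1 - ta) /
    (eta - 2 * v * (1 + ta) + v ^+ 2 * xi)); last by rewrite /u0; field.
  by rewrite !mulf_neq0 ?invr_eq0.
have [ka [eka _]] := spec_inv (specB hx hu) xu0.
pose v' := (t - u * V) * ka.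
(* With this shape both determinants are 1 and the equation for x is the identity u + (x - u) =
   x. *)
exists 1, u, V, (1 + u * V), 1, (x - u), v', (1 + (x - u) * v'); split; [by ring|by ring|].
elim/I3_ind; rewrite /tens_z /fund_z /=.
- by congr (aact N _); ring.
- apply: (@aact_err2 _ _ _ _ (- (V + u * V ^+ 2 - y) + ka * (t - u * V) ^+ 2)
    (ka * (x * y - x * V - t - t ^+ 2)) eka ede).
  by rewrite /v' /u /d; ring.
- apply: (@aact_err2 _ _ _ _ (2 * (t - u * V)) 0 eka ede).
  have -> : w = 2 * (1 + t) by rewrite /t [RHS]mulrC addrC subrK mulrC mulrA half2 mul1r.
  by rewrite /v'; ring.
Qed.

(* The triples transform as binary quadratic forms under SL(2); a constant unipotent
   element makes the first eigenvalue nonzero. *)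
Lemma sl2_pair x y w xi eta om : spec x xi -> spec y eta -> spec w om ->
  om ^+ 2 - 4 * xi * eta <> 0 ->
  exists a b c d a' b' c' d', [/\ a * d - b * c = 1, a' * d' - b' * c' = 1 &
    forall k, aact N (tens_z a b c d a' b' c' d' k) =
      aact N (match val k with 0 => x | 1 => y | _ => w end)].
Proof.
move=> hx hy hw D0.
(* Q at r is the eigenvalue of the first coefficient after the unipotent change of variable by r. It
   is not the zero polynomial, as xi, om and eta have nonzero discriminant. *)
pose Q : {poly K} := eta *: 'X^2 + om *: 'X + xi%:P.
have Q0 : Q != 0.
  apply/eqP=> Q0; apply: D0.
  have e0 := congr1 (fun q : {poly K} => q`_0) Q0; have e1 := congr1 (fun q : {poly K} => q`_1) Q0.
  move: e0 e1; rewrite /= /Q !coefD !coefZ !coefXn !coefX !coefC ?coef0 /= !mulr0 !mulr1 !add0r addr0.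
  by move=> -> ->; ring.
have [r] := nonroot Q0; rewrite !hornerE /= => Qr.
pose R := iota r; have hR : spec R r := spec_iota r.
have hx' : spec (x + R * w + R ^+ 2 * y) (xi + r * om + r ^+ 2 * eta).
  by rewrite !expr2; exact: specD (specD hx (specM hR hw)) (specM (specM hR hR) hy).
have hw' : spec (w + 2 * R * y) (om + 2 * r * eta).
  exact: specD hw (specM (specM (spec_nat 2) hR) hy).
have [|a [b [c [d [a' [b' [c' [d' [e1 e2 H]]]]]]]]] := sl2_pair_generic hx' hy hw'.
  by apply: contra Qr => /eqP e; apply/eqP; rewrite -e; ring.
(* Both matrices are multiplied on the left by the inverse unipotent matrix, which undoes the change
   of variable. *)
exists (a - R * c), (b - R * d), c, d, (a' - R * c'), (b' - R * d'), c', d'; split.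
- by rewrite -e1; ring.
- by rewrite -e2; ring.
have := H k0; have := H k1; have := H k2; rewrite /tens_z /fund_z /= => H2 H1 H0.
elim/I3_ind; rewrite /=.
- transitivity (aact N ((a * b + a' * b') - R * (a * d + b * c + (a' * d' + b' * c'))
    + R ^+ 2 * (c * d + c' * d'))); first by congr (aact N _); ring.
  rewrite linearD linearB /= [aact N (R * _)]aactM [aact N (_ ^+ 2 * _)]aactM H0 H1 H2.
  by rewrite -!aactM -linearB -linearD /=; congr (aact N _); ring.
- exact: H1.
- transitivity (aact N ((a * d + b * c + (a' * d' + b' * c')) - 2 * R * (c * d + c' * d'))).
    by congr (aact N _); ring.
  by rewrite linearB /= [aact N (_ * _)]aactM H1 H2 -aactM -linearB /=; congr (aact N _); ring.
Qed.

End Spectrum.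

Section EvenPart.
Variables (K : numClosedFieldType) (L : vectType K) (s : lieSuper L).
Variable p : {linear L -> psl22 K}.
Variables (W : vectType K) (rho : {linear L -> 'End(W)}).
Local Notation H := (mx_act s p rho (h1 K)).

(* The projection onto the even weight spaces of [h1], whose square has eigenvalues
   0, 1 and 4 only. *)
Definition even_part m : W := 3^-1 *: (H (H (H (H m))) - 4 *: H (H m) + 3 *: m).

Lemma even_part_linear : linear even_part.
Proof.
by move=> a u v; rewrite /even_part !(lfD, lfZ); nrm idtac; vring.
Qed.

End EvenPart.

(** b is the degree that carries the even weights of h1. *)
Definition has_parity (K : numClosedFieldType) (L : vectType K) (s : lieSuper L)
    (p : {linear L -> psl22 K}) (b : bool) (M : supermod s) : Prop :=
  forall c m, homog (mgrading M) c m -> even_part s p (act M) m = if c == b then m else 0.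

Section KacProperties.
Variables (K : numClosedFieldType) (L : vectType K) (s : lieSuper L).
Variable p : {linear L -> psl22 K}.
Hypothesis Luce : universal_central_extension s (psl_lie K) p.
Variable chi : 'Hom(subvs_of (center s), K^o).
Variables (B : comAlgType K) (N : algmod B) (iota : {rmorphism K -> B}).
Hypothesis iotaE : forall a, iota a = a%:A.
Variables (a b c d a' b' c' d' : B).
Hypotheses (det1 : a * d - b * c = 1) (det1' : a' * d' - b' * c' = 1).

Local Notation zeta := (tens_z a b c d a' b' c' d').
Local Notation M := (kac Luce N iotaE det1 det1').

Lemma kac_mod1 : in_mod1 p M.
Proof.
move=> e /leigP[w w0 ew].
have [k wk] : exists k, w k != 0.
  apply: contrapT => h; case/eqP: w0; apply/ffunP=> k; rewrite ffunE.
  by apply/eqP/negPn/negP => wk; apply: h; exists k.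
have := congr1 (fun f : {ffun _ -> _} => f k) ew; rewrite (h_shortE Luce) scalerDr.
rewrite kac_hd ffunE => /eqP; rewrite -subr_eq0 -scalerBl scaler_eq0 (negbTE wk) orbF.
rewrite subr_eq0 => /eqP <-; rewrite /hwt.
have n2 : 2 != 0 :> K by rewrite pnatr_eq0.
case: (mxtens_unindex k) => i j /=.
have hv l : (2^-1 *: h1 K + 2^-1 *: h2 K) l l = 2^-1 \/ (2^-1 *: h1 K + 2^-1 *: h2 K) l l = - 2^-1.
  by elim/I4_ind: l; rewrite !mxE /=; [left|right|left|right]; ring.
have e1 : 2^-1 + 2^-1 = 1 :> K by field.
rewrite !inE; case: (hv i) => ->; case: (hv j) => ->; rewrite -?opprD ?e1 ?subrr ?addNr ?eqxx ?orbT //.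
Qed.

Lemma hwt_h1 k : hwt 1 0 k = (h1 K) (mxtens_unindex k).1 (mxtens_unindex k).1 +
   (h1 K) (mxtens_unindex k).2 (mxtens_unindex k).2.
Proof. by rewrite /hwt scale1r scale0r addr0. Qed.

Lemma kac_h1 (w : M) k : mx_act s p (act M) (h1 K) w k = hwt 1 0 k *: w k.
Proof. by rewrite -kac_hd scale1r scale0r addr0. Qed.

Definition top_index : 'I_(4 * 4) := mxtens_index (o0, o0).

(** The diagonal of h1 has the entry 1 only at the first index and nothing larger, so a sum of two
    entries is 2 exactly at [top_index]: F is a single copy of N. *)
Lemma kac_top (w : M) : w \in top_space s p (act M) <-> forall k, k != top_index -> w k = 0.
Proof.
have e2 k : (hwt 1 0 k == 2 :> K) = (k == top_index).
  rewrite hwt_h1 /top_index; case: (mxtens_indexP k) => i j.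
  rewrite mxtens_indexK (inj_eq (can_inj (@mxtens_indexK _ _))) xpair_eqE.
  have h1z l : h1 K l l = (nth 0 [:: 1; -1; 0; 0] l : int)%:~R.
    by elim/I4_ind: l; rewrite !mxE /= ?intrN ?subr0 ?sub0r ?subrr.
  rewrite !h1z -intrD (_ : 2 = 2%:~R) // eqr_int.
  by elim/I4_ind: i; elim/I4_ind: j.
split=> [/top_spaceP e k|h]; last first.
  apply/top_spaceP/ffunP=> k; rewrite kac_h1 ffunE.
  have [->|/h ->] := eqVneq k top_index; last by rewrite !scaler0.
  by congr (_ *: _); apply/eqP; rewrite e2.
rewrite -e2 => ne; have := congr1 (fun f : {ffun _ -> _} => f k) e.
rewrite kac_h1 ffunE => /eqP; rewrite -subr_eq0 -scalerBl scaler_eq0 subr_eq0 (negbTE ne).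
by move/eqP.
Qed.

Lemma kac_parity : has_parity p false M.
Proof.
have e k : 3^-1 * (hwt 1 0 k ^+ 4 - 4 * hwt 1 0 k ^+ 2 + 3) = (~~ tpar k)%:R :> K.
  rewrite hwt_h1; case: (mxtens_indexP k) => i j; rewrite tparE mxtens_indexK.
  by elim/I4_ind: i; elim/I4_ind: j; rewrite !mxE /=; field.
move=> e' m hm; apply/ffunP=> k; rewrite /even_part.
have -> : (3^-1 *: (mx_act s p (act M) (h1 K) (mx_act s p (act M) (h1 K)
  (mx_act s p (act M) (h1 K) (mx_act s p (act M) (h1 K) m))) -
  4 *: mx_act s p (act M) (h1 K) (mx_act s p (act M) (h1 K) m) + 3 *: m)) k =
   3^-1 * (hwt 1 0 k ^+ 4 - 4 * hwt 1 0 k ^+ 2 + 3) *: m k.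
  rewrite !ffunE !kac_h1 !scalerA -scaleNr -!scalerDl scalerA; congr (_ *: _); ring.
rewrite e; have [te|/hm mk] := eqVneq (tpar k) e'.
  by rewrite te; case: e' {hm te}; rewrite /= ?scale1r ?scale0r ?ffunE.
by rewrite mk scaler0; case: ifP; rewrite ?ffunE.
Qed.

Variable X : 'I_3 -> B.
Hypothesis XE : forall k, aact N (zeta k) = aact N (X k + iota (chi_at chi (zc s p k))).
Hypothesis Xnilp : forall k, nilp N (X k).

Lemma chi_center z : chi z = \sum_k (to_ext Luce (vsval z)).2 0 k * chi_at chi (zc s p k) :> K.
Proof.
have {1}-> : z = \sum_k (to_ext Luce (vsval z)).2 0 k *: vsproj (center s) (zc s p k).
  apply: val_inj => /=; rewrite linear_sum {1}(center_zc Luce (subvsP z)).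
  by apply: eq_bigr => k _; rewrite linearZ /= vsprojK ?zc_center.
by rewrite linear_sum; apply: eq_bigr => k _; rewrite linearZ.
Qed.

Lemma kac_gen_char : has_gen_char chi M.
Proof.
move=> z; pose u k := (to_ext Luce (vsval z)).2 0 k.
have [n en] : nilp N (\sum_k iota (u k) * X k).
  elim/big_ind: _ => [||k _]; [exact: nilp0|exact: nilpD|exact: nilpM].
exists n => w; apply/ffunP=> i; rewrite ffunE.
have step v : (act M (vsval z) - chi z *: \1%VF) v i = aact N (\sum_k iota (u k) * X k) (v i).
  rewrite {1}(center_zc Luce (subvsP z)) linear_sum add_lfunE opp_lfunE scale_lfunE id_lfunE.
  rewrite sum_lfunE [LHS]ffunE sum_ffunE [in X in _ + X]ffunE [in X in _ + X]ffunE.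
  rewrite chi_center scaler_suml -sumrB linear_sum sum_lfunE; apply: eq_bigr => k _.
  rewrite linearZ scale_lfunE ffunE kac_zc XE linearD add_lfunE (aact_alg iotaE).
  by rewrite scalerDr scalerA addrK aactM comp_lfunE (aact_alg iotaE).
have : aact N ((\sum_k iota (u k) * X k) ^+ n) (w i) = 0 by rewrite en lfunE.
rewrite aactX => <-; elim: n {en} => //= n IH; by rewrite step IH.
Qed.

End KacProperties.

(** * Modules over polynomial algebras from commuting operators *)

Section PolyModule.
Variables (K : fieldType) (V : vectType K) (n : nat) (u : 'I_n -> 'End(V)).
Hypothesis uC : forall i j v, u i (u j v) = u j (u i v).
Implicit Types (m : multinom n) (g : mpoly n K).

Definition mon_act m (v : V) : V := foldr (fun i => iter (m i) (u i)) v (enum 'I_n).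

Lemma mon_act_linear m : linear (mon_act m).
Proof.
move=> a v w; rewrite /mon_act; elim: (enum _) => //= i l ->.
by elim: (m i) => //= k ->; rewrite linearP.
Qed.

Lemma mon_act0 v : mon_act mnm0 v = v.
Proof. by rewrite /mon_act; elim: (enum _) => //= i l ->; rewrite mnm0E. Qed.

Lemma mon_actD m1 m2 v : mon_act (mnm_add m1 m2) v = mon_act m1 (mon_act m2 v).
Proof.
rewrite /mon_act; elim: (enum _) => //= i l ->; rewrite mnmDE iterD; congr (iter _ _ _).
move: (foldr _ v l) => w; elim: l => //= j l <-.
have C1 k z : u i (iter k (u j) z) = iter k (u j) (u i z) by elim: k => //= k <-.
by elim: (m2 i) => //= k ->; rewrite C1.
Qed.

Lemma mon_actU i v : mon_act (mnm1 i) v = u i v.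
Proof.
rewrite /mon_act; have [l1 [l2 [-> n1 n2]]] : exists l1 l2, [/\ enum 'I_n = l1 ++ i :: l2,
    i \notin l1 & i \notin l2].
  have := enum_uniq 'I_n; have : i \in enum 'I_n by rewrite mem_enum.
  case/splitPr => l1 l2; rewrite cat_uniq /= => /and3P[_ h /andP[h2 _]].
  by exists l1, l2; split=> //; move: h; rewrite negb_or => /andP[].
have id0 l w : i \notin l -> foldr (fun j => iter (mnm1 i j) (u j)) w l = w.
  elim: l => //= j l IH; rewrite inE negb_or => /andP[ne /IH ->].
  by rewrite mnm1E (negbTE ne).
by rewrite foldr_cat /= !id0 // mnm1E eqxx.
Qed.

Definition poly_act_fun g (v : V) : V := \sum_(m <- msupp g) mcoeff m g *: mon_act m v.

(** A common index set for all polynomials of bounded size; the supports in [poly_act_fun] vary with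
    g, which hinders the proof of linearity. *)
Lemma poly_act_funE g k v : (msize g <= k)%N ->
  poly_act_fun g v = \sum_(m : bmultinom n k) mcoeff (bmnm m) g *: mon_act (bmnm m) v.
Proof.
move=> le_gk; set I : subFinType _ := bmultinom n k.
rewrite /poly_act_fun (big_mksub I) ?msupp_uniq //=; last first.
  by move=> x /msize_mdeg_lt /leq_trans; apply.
rewrite big_rmcond //= => j /memN_msupp_eq0 ->.
by rewrite scale0r.
Qed.

Lemma poly_act_fun_linear g : linear (poly_act_fun g).
Proof.
move=> a v w; rewrite /poly_act_fun scaler_sumr -big_split; apply: eq_bigr => m _ /=.
by rewrite mon_act_linear scalerDr !scalerA mulrC.
Qed.

Definition poly_act g : 'End(V) := linfun (HB.pack_for {linear V -> V} (poly_act_fun g)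
    (GRing.isLinear.Build _ _ _ _ _ (poly_act_fun_linear g))).

Lemma poly_actE g v : poly_act g v = poly_act_fun g v. Proof. by rewrite lfunE. Qed.

Lemma poly_act_linear : linear poly_act.
Proof.
move=> a g h; apply/lfunP=> v; rewrite add_lfunE scale_lfunE !poly_actE.
pose k := (msize g + msize h + msize (a *: g + h))%N.
rewrite !(@poly_act_funE _ k) ?leq_addl //; last first.
- by rewrite /k -addnA leq_addr.
- by rewrite /k addnAC leq_addl.
rewrite scaler_sumr -big_split; apply: eq_bigr => m _ /=.
by rewrite mcoeffD mcoeffZ scalerDl scalerA.
Qed.
HB.instance Definition _ := GRing.isLinear.Build K (mpoly n K) 'End(V) _ poly_act poly_act_linear.

Lemma poly_act_mon m v : poly_act (mpolyX K m) v = mon_act m v.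
Proof. by rewrite poly_actE /poly_act_fun msuppX big_seq1 mcoeffX eqxx scale1r. Qed.

Lemma poly_act_X i v : poly_act (mpolyX K (mnm1 i)) v = u i v.
Proof. by rewrite poly_act_mon mon_actU. Qed.

Lemma poly_act1 : poly_act 1 = \1%VF.
Proof. by apply/lfunP=> v; rewrite -mpolyX0 poly_act_mon mon_act0 id_lfunE. Qed.

Lemma poly_actM g h : poly_act (g * h) = (poly_act g \o poly_act h)%VF.
Proof.
elim/mpolyind: g => [|c m g _ _ IH]; first by rewrite mul0r !linear0 comp_lfun0l.
rewrite mulrDl -scalerAl !linearD !linearZ /= IH comp_lfunDl -comp_lfunZl; congr (_ *: _ + _).
elim/mpolyind: h {IH} => [|e m' h _ _ IH]; first by rewrite mulr0 !linear0 comp_lfun0r.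
rewrite mulrDr -scalerAr !linearD !linearZ /= IH comp_lfunDr -comp_lfunZr; congr (_ *: _ + _).
by apply/lfunP=> v; rewrite -mpolyXD comp_lfunE !poly_act_mon mon_actD.
Qed.

Definition poly_mod : algmod (mpoly n K) :=
  @AlgMod K (mpoly n K) V poly_act poly_act1 poly_actM.

End PolyModule.

Section PolyMorphism.
Variables (K : fieldType) (n : nat) (M N : algmod (mpoly n K)).

Lemma poly_mor_ex (f : 'Hom(M, N)) :
  (forall i v, f (aact M (mpolyX K (mnm1 i)) v) = aact N (mpolyX K (mnm1 i)) (f v)) ->
  forall g v, f (aact M g v) = aact N g (f v).
Proof.
move=> h.
have h1 v : f (aact M 1 v) = aact N 1 (f v) by rewrite !aact1 !id_lfunE.
have hM g1 g2 : (forall v, f (aact M g1 v) = aact N g1 (f v)) ->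
    (forall v, f (aact M g2 v) = aact N g2 (f v)) ->
    forall v, f (aact M (g1 * g2) v) = aact N (g1 * g2) (f v).
  by move=> e1 e2 v; rewrite !aactM !comp_lfunE e1 e2.
have hX m v : f (aact M (mpolyX K m) v) = aact N (mpolyX K m) (f v).
  rewrite mpolyXE_id; elim/big_ind: _ v => // i _.
  by elim: (m i) => [|k IH] v; [rewrite expr0|rewrite exprS hM].
elim/mpolyind => [|c m g _ _ IH] v; first by rewrite !linear0 !lfunE linear0.
by rewrite !linearD !linearZ !add_lfunE !scale_lfunE linearD linearZ /= IH hX.
Qed.

End PolyMorphism.

(** * Parity blocks *)

Ltac vfield := rewrite ?(lfD, lfN, lfZ, lf0);
  apply: crd_inj => ?; rewrite ?(crdD, crdN, crdZ, crd0); field.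

Section EvenProjection.
Variables (K : numClosedFieldType) (V : vectType K).
Implicit Types (H T : 'End(V)).

Let q H (w : V) : V := H (H (H (H (H (H w))))) - 5 *: H (H (H (H w))) + 4 *: H (H w).
Let ev H (w : V) : V := 3^-1 *: (H (H (H (H w))) - 4 *: H (H w) + 3 *: w).

Lemma ev_idem H w : (forall w, q H w = 0) -> ev H (ev H w) = ev H w.
Proof.
move=> hq; apply/eqP; rewrite -subr_eq0; apply/eqP.
(* With E = (h^2 - 1)(h^2 - 3) / 3, the polynomial E (E - 1) is (h^2 - 3) q / 9. *)
transitivity (9^-1 *: (q H (H (H w)) - 3 *: q H w)); last by rewrite !hq scaler0 subrr scaler0.
by rewrite /ev /q; vfield.
Qed.

(* The coefficients come from a Bezout relation between [q] and its translates. *)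
Lemma ev_shift2 H T : (forall w, q H w = 0) ->
  (forall w, H (T w) = T (H w) + 2 *: T w) -> forall w, ev H (T w) = T (ev H w).
Proof.
move=> hq c w.
have c2 v : H (H (T v)) = T (H (H v)) + 4 *: T (H v) + 4 *: T v.
  by rewrite !(c, lfD, lfZ); vring.
have c4 v : H (H (H (H (T v)))) = T (H (H (H (H v)))) + 8 *: T (H (H (H v))) + 24 *: T (H (H v)) + 32 *: T (H v) + 16 *: T v.
  by rewrite c2 !(lfD, lfZ) !c2; vring.
have c6 v : H (H (H (H (H (H (T v)))))) = T (H (H (H (H (H (H v)))))) + 12 *: T (H (H (H (H (H v))))) + 60 *: T (H (H (H (H v)))) + 160 *: T (H (H (H v))) + 240 *: T (H (H v)) + 192 *: T (H v) + 64 *: T v.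
  by rewrite c4 !(lfD, lfZ) !c2; vring.
apply/eqP; rewrite -subr_eq0; apply/eqP.
transitivity (45^-1 *: (- 17 *: T (q H w) - 8 *: T (q H (H w)) - T (q H (H (H w))) +
  5 *: q H (T w) - 4 *: q H (T (H w)) + q H (T (H (H w))))).
  by rewrite /ev /q !c6 !c4 !c2; vfield.
by rewrite !hq !lf0 !scaler0 !(subr0, addr0) scaler0.
Qed.

(** A shift by 1 exchanges even and odd weights. Without a weight decomposition, E(h + 1) + E(h) - 1
    is written as a combination of q(h) and q(h + 1), where E is the polynomial of [ev]. *)
Lemma ev_shift1 H T : (forall w, q H w = 0) ->
  (forall w, H (T w) = T (H w) + T w) -> forall w, ev H (T w) = T w - T (ev H w).
Proof.
move=> hq c w.
have c2 v : H (H (T v)) = T (H (H v)) + 2 *: T (H v) + T v.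
  by rewrite !(c, lfD, lfZ); vring.
have c4 v : H (H (H (H (T v)))) = T (H (H (H (H v)))) + 4 *: T (H (H (H v))) + 6 *: T (H (H v)) + 4 *: T (H v) + T v.
  by rewrite c2 !(lfD, lfZ) !c2; vring.
have c6 v : H (H (H (H (H (H (T v)))))) = T (H (H (H (H (H (H v)))))) + 6 *: T (H (H (H (H (H v))))) + 15 *: T (H (H (H (H v)))) + 20 *: T (H (H (H v))) + 15 *: T (H (H v)) + 6 *: T (H v) + T v.
  by rewrite c4 !(lfD, lfZ) !c2; vring.
apply/eqP; rewrite -subr_eq0; apply/eqP.
transitivity ((2 / 45) *: (7 *: T (q H w) + 2 *: T (q H (H w)) +
  5 *: q H (T w) - 2 *: q H (T (H w)))).
  by rewrite /ev /q !c6 !c4 !c2; vfield.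
by rewrite !hq !lf0 !scaler0 !(subr0, addr0) scaler0.
Qed.

Let ev_opp H w : ev (- H) w = ev H w.
Proof. by rewrite /ev !opp_lfunE; vring. Qed.
Let q_opp H w : q (- H) w = q H w.
Proof. by rewrite /q !opp_lfunE; vring. Qed.

(** [ev] and [q] are even polynomials in H, so replacing H by - H reverses the direction of the
    shift. *)
Lemma ev_shift2N H T : (forall w, q H w = 0) ->
  (forall w, H (T w) = T (H w) - 2 *: T w) -> forall w, ev H (T w) = T (ev H w).
Proof.
move=> hq c w; rewrite -(ev_opp H (T w)) -(ev_opp H w); apply: ev_shift2 => v; first by rewrite q_opp.
by rewrite !opp_lfunE c; vring.
Qed.

Lemma ev_shift1N H T : (forall w, q H w = 0) ->
  (forall w, H (T w) = T (H w) - T w) -> forall w, ev H (T w) = T w - T (ev H w).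
Proof.
move=> hq c w; rewrite -(ev_opp H (T w)) -(ev_opp H w); apply: ev_shift1 => v; first by rewrite q_opp.
by rewrite !opp_lfunE c; vring.
Qed.

Lemma ev_comm H T : (forall w, H (T w) = T (H w)) -> forall w, ev H (T w) = T (ev H w).
Proof. by move=> c w; rewrite /ev !c; vring. Qed.

End EvenProjection.

Section GradingProjections.
Variables (K : fieldType) (V : vectType K) (g : grading V).

(** A grading only asserts that components exist; they are chosen, and their uniqueness makes the
    choice linear. *)
Lemma grade_proj_ex : exists pr : bool -> 'End(V),
  (forall c v, homog g c (pr c v)) /\ (forall v, v = pr false v + pr true v).
Proof.
have ex v : exists u, homog g false u /\ homog g true (v - u).
  have [v0 [v1 [h0 h1 e]]] := homog_dec g v; exists v0; split=> //.
  by rewrite e addrC addKr.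
pose f0 v := projT1 (cid (ex v)); have hf0 v := projT2 (cid (ex v)); rewrite -/(f0 _) in hf0.
have lin : linear f0.
  move=> a u v; apply/eqP; rewrite -subr_eq0; apply/eqP.
  have [h0 h1] := hf0 (a *: u + v); have [u0 u1] := hf0 u; have [v0 v1] := hf0 v.
  apply: (@homog_disj _ _ g); first by apply/homogD/homogN/homogP.
  have -> : f0 (a *: u + v) - (a *: f0 u + f0 v) =
      (a *: (u - f0 u) + (v - f0 v)) - (a *: u + v - f0 (a *: u + v)).
    by rewrite scalerBr !opprD opprK; apply: crd_inj => i; rewrite ?(crdD, crdN, crdZ); ring.
  by apply/homogD/homogN => //; apply: homogP.
pose F0 : 'End(V) := linfun (HB.pack_for {linear V -> V} f0 (GRing.isLinear.Build _ _ _ _ _ lin)).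
have F0E v : F0 v = f0 v by rewrite lfunE.
exists (fun c => if c then \1%VF - F0 else F0); split=> [[] v|v] /=.
- by rewrite add_lfunE opp_lfunE id_lfunE F0E; case: (hf0 v).
- by rewrite F0E; case: (hf0 v).
- by rewrite add_lfunE opp_lfunE id_lfunE addrC subrK.
Qed.

Variable pr : bool -> 'End(V).
Hypothesis pr_homog : forall c v, homog g c (pr c v).
Hypothesis pr_sum : forall v, v = pr false v + pr true v.

Lemma pr_id c v c' : homog g c v -> pr c' v = if c' == c then v else 0.
Proof.
move=> hv; have z : pr (~~ c) v = 0.
  have h1 := pr_homog (~~ c) v; apply: (homog_disj (g := g)); case: c hv h1 => //= hv _.
    have -> : pr true v = v - pr false v by rewrite {2}[v]pr_sum addrC addKr.
    exact/homogD/homogN/pr_homog.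
  have -> : pr false v = v - pr true v by rewrite {2}[v]pr_sum addrK.
  exact/homogD/homogN/pr_homog.
case: c c' z hv => [] [] /= z hv //; by have := pr_sum v; rewrite z ?addr0 ?add0r => <-.
Qed.

End GradingProjections.

Section EvenAct.
Variables (K : numClosedFieldType) (L : vectType K) (s : lieSuper L).
Variable p : {linear L -> psl22 K}.
Hypothesis Luce : universal_central_extension s (psl_lie K) p.
Variables (W : vectType K) (rho : {linear L -> 'End(W)}).
Hypothesis Wrep : is_rep s p rho.
Local Notation X := (mx_act s p rho).
Local Notation E i j := (delta_mx i j : 'M[K]_4).

Lemma even_part_idem w : even_part s p rho (even_part s p rho w) = even_part s p rho w.
Proof. by apply: ev_idem => v; apply: (h1_poly Luce Wrep). Qed.

Lemma even_partD u v : even_part s p rho (u + v) = even_part s p rho u + even_part s p rho v.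
Proof. by have := even_part_linear s p rho 1 u v; rewrite !scale1r. Qed.
Lemma even_partZ a v : even_part s p rho (a *: v) = a *: even_part s p rho v.
Proof. by rewrite -[a *: v]addr0 even_part_linear /even_part !lf0 !scaler0 !addr0 subr0 scaler0 addr0. Qed.
Lemma even_partN v : even_part s p rho (- v) = - even_part s p rho v.
Proof. by rewrite -scaleN1r even_partZ scaleN1r. Qed.

Lemma h1_shift b n A w : gl_homog b A -> A \in sl22 K -> wtm n A ->
  X (h1 K) (X A w) = X A (X (h1 K) w) + n%:~R *: X A w.
Proof.
by move=> hA sA wA; rewrite (mx_act_br_even Luce Wrep _ (h1_homog K) hA (h1_sl K) sA) wA mx_actZ.
Qed.

Lemma even_part_wt_even n A w : gl_homog false A -> A \in sl22 K -> wtm n A ->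
  n \in [:: 0; 2; -2] -> even_part s p rho (X A w) = X A (even_part s p rho w).
Proof.
move=> hA sA wA; have hc := h1_shift _ hA sA wA; rewrite !inE => /or3P[] /eqP en.
- by apply: (@ev_comm _ _ (X (h1 K)) (X A)) => v; rewrite hc en scale0r addr0.
- by apply: (@ev_shift2 _ _ (X (h1 K)) (X A) (h1_poly Luce Wrep)) => v; rewrite hc en.
- by apply: (@ev_shift2N _ _ (X (h1 K)) (X A) (h1_poly Luce Wrep)) => v; rewrite hc en mulrNz scaleNr.
Qed.

Lemma even_part_wt_odd n A w : gl_homog true A -> wtm n A -> n \in [:: 1; -1] ->
  even_part s p rho (X A w) = X A w - X A (even_part s p rho w).
Proof.
move=> hA wA; have sA := odd_sl hA; have hc := h1_shift _ hA sA wA; rewrite !inE => /orP[] /eqP en.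
- by apply: (@ev_shift1 _ _ (X (h1 K)) (X A) (h1_poly Luce Wrep)) => v; rewrite hc en scale1r.
- by apply: (@ev_shift1N _ _ (X (h1 K)) (X A) (h1_poly Luce Wrep)) => v; rewrite hc en scaleN1r.
Qed.

Lemma rho_homog e x : homog s e x -> exists A, [/\ gl_homog e A, A \in sl22 K &
  forall w, rho x w = X A w + \sum_k (to_ext Luce x).2 0 k *: z_act s p rho k w] /\
  (e -> (to_ext Luce x).2 = 0).
Proof.
move=> hx; have [h1 h2] := proj1 (to_ext_hom Luce) _ _ hx.
rewrite (to_ext_fst Luce) in h1; have [A [hA sA e1]] := psl_homogP h1.
exists A; split=> //; split=> // w; rewrite (rho_dec Luce) e1.
by have [t ->] := mat_psl_class sA; rewrite mx_actD -[t%:M]scalemx1 mx_actZ mx_act1 // scaler0 addr0.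
Qed.

Lemma even_part_even x w : homog s false x -> even_part s p rho (rho x w) = rho x (even_part s p rho w).
Proof.
move=> /rho_homog[A [[hA sA rx] _]]; rewrite !rx even_partD; congr (_ + _); last first.
  have evn_sum (f : 'I_3 -> W) : even_part s p rho (\sum_k f k) = \sum_k even_part s p rho (f k).
    by rewrite !big_ord_recr !big_ord0 /= !add0r !even_partD.
  rewrite evn_sum; apply: eq_bigr => k _; rewrite even_partZ; congr (_ *: _).
  by apply: (@ev_comm _ _ (X (h1 K)) (z_act s p rho k)) => v; rewrite /mx_act (z_act_comm Luce Wrep).
rewrite !(mx_act_even s p rho _ hA sA) !even_partD !even_partZ.
have evE i j : i != j -> ipar i = ipar j -> cw i - cw j \in [:: 0; 2; -2] ->
    even_part s p rho (X (E i j) w) = X (E i j) (even_part s p rho w).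
  move=> ne ij; apply: even_part_wt_even; last exact: wtm_E.
    by have := E_homog K i j; rewrite ij addbb.
  exact: E_sl.
rewrite (evE o0 o1 isT erefl isT) (evE o1 o0 isT erefl isT).
rewrite (evE o2 o3 isT erefl isT) (evE o3 o2 isT erefl isT).
rewrite (@even_part_wt_even 0 _ _ (h2_homog K) (h2_sl K) (wtm_h2 K) isT).
by congr (_ + _ *: _ + _); apply: (@ev_comm _ _ (X (h1 K)) (X (h1 K))).
Qed.

Lemma even_part_odd x w : homog s true x ->
  even_part s p rho (rho x w) = rho x w - rho x (even_part s p rho w).
Proof.
move=> /rho_homog[A [[hA sA rx] /(_ isT) z]].
have {}rx v : rho x v = X A v.
  by rewrite rx z big1 ?addr0 // => k _; rewrite mxE scale0r.
have [A1 [A2 [h1 w1 h2 w2 eA]]] := odd_dec hA.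
have e1 := even_part_wt_odd w h1 w1 isT; have e2 := even_part_wt_odd w h2 w2 isT.
rewrite (rx w) (rx (even_part s p rho w)) eA (mx_actD s p rho A1 A2 w) even_partD e1 e2 (mx_actD s p rho A1 A2).
by rewrite opprD addrACA.
Qed.

End EvenAct.

(** * Splitting of a module according to the parity of its weights *)

Section ParityDecomposition.
Variables (K : numClosedFieldType) (L : vectType K) (s : lieSuper L).
Variable p : {linear L -> psl22 K}.
Hypothesis Luce : universal_central_extension s (psl_lie K) p.
Variable chi : 'Hom(subvs_of (center s), K^o).
Implicit Types M N : supermod s.
Local Notation C := (mod1_chi p chi).
Local Notation ev M := (even_part s p (act M)).

Definition parity_ob (b : bool) (X : ob C) : Prop := has_parity p b (sval X).

Lemma even_part_mor M N (f : 'Hom(M, N)) m : is_mor f -> f (ev M m) = ev N (f m).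
Proof. by move=> [_ fa]; rewrite /even_part /mx_act ?(lfD, lfN, lfZ, fa). Qed.

Lemma even_part_homog M c m : homog (mgrading M) c m -> homog (mgrading M) c (ev M m).
Proof.
move=> hm; have st v : homog (mgrading M) c v -> homog (mgrading M) c (act M (tau s p (h1 K)) v).
  by move=> hv; have := act_homog (tau_homog Luce (h1_homog K)) hv.
apply: homogZ; apply: homogD; last exact: homogZ.
by apply: homogD; [do 4!apply: (st)|apply: homogN; apply: homogZ; do 2!apply: (st)].
Qed.

Lemma parity_hom0 b (X Y : ob C) (f : hom C X Y) :
  parity_ob b X -> parity_ob (~~ b) Y -> f = 0.
Proof.
move=> PX PY; have fm := mor_mor f; apply: mor_eq => m; rewrite mor0E.
suff h c v : homog (mgrading (sval X)) c v -> supermor_val f v = 0.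
  by have [m0 [m1 [/h h0 /h h1 ->]]] := homog_dec (mgrading (sval X)) m; rewrite lfD h0 h1 addr0.
move=> hv; have hfv := proj1 fm _ _ hv.
have := PY _ _ hfv; rewrite -even_part_mor // (PX _ _ hv).
by case: c b {PX PY hv hfv} => [] [] /=; rewrite ?lf0.
Qed.

Lemma parity_replete b : replete (parity_ob b).
Proof.
move=> X Y [f [g [gf fg]]] PX c m hm.
have fm := mor_mor f; have gm := mor_mor g.
have fK v : supermor_val f (supermor_val g v) = v by rewrite -morME fg mor1E.
rewrite -[m in LHS]fK -(even_part_mor _ fm) (PX c _ (proj1 gm _ _ hm)).
by case: ifP => _; rewrite ?lf0 ?fK.
Qed.

Lemma stable_homog M (U : {vspace M}) :
  (forall e x m, homog s e x -> m \in U -> act M x m \in U) ->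
  forall x m, m \in U -> act M x m \in U.
Proof.
move=> h x m mU; have [x0 [x1 [h0 h1 ->]]] := homog_dec s x.
by rewrite linearD add_lfunE rpredD // ?(h _ _ _ h0) ?(h _ _ _ h1).
Qed.

Lemma parity_split (X : ob C) : exists Y Y', [/\ parity_ob false Y, parity_ob true Y' &
  is_biproduct Y Y' X].
Proof.
have Xrep := mod1_rep (proj1 (proj2_sig X)).
pose M := sval X; have [pr [prh prs]] := grade_proj_ex (mgrading M).
have prI c m c' := @pr_id _ _ (mgrading M) pr prh prs c m c'.
pose evl : 'End(M) := linfun (HB.pack_for {linear M -> M} (ev M)
  (GRing.isLinear.Build _ _ _ _ _ (even_part_linear s p (act M)))).
have evlE m : evl m = ev M m by rewrite lfunE.
(* The subspace where the projection on even weights agrees with the projection on degree b. It is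
   stable: even elements commute with both projections, and odd ones exchange both kinds of
   parity. *)
pose U b := lker (evl - pr b).
have inU b m : m \in U b <-> ev M m = pr b m.
  rewrite memv_ker add_lfunE opp_lfunE evlE subr_eq0; split=> [/eqP //|->]; exact: eqxx.
have inUh b c m : homog (mgrading M) c m -> m \in U b <-> ev M m = if b == c then m else 0.
  by move=> hm; rewrite inU (prI _ _ b hm).
have evpr c m : pr c (ev M m) = ev M (pr c m).
  rewrite [m in LHS]prs (even_partD s p) lfD !(prI _ _ c (even_part_homog (prh _ _))).
  by case: c; rewrite ?addr0 ?add0r.
have Upr b c m : m \in U b -> pr c m \in U b.
  move=> /inU e; apply/inU; rewrite -evpr e (prI _ _ _ (prh b m)) (prI _ _ _ (prh c m)).
  by rewrite eq_sym; case: eqVneq => [->|].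
have gU b : gstable (U b).
  split=> [|m0 m1 h0 h1 mU]; last first.
    have := Upr b false _ mU; have := Upr b true _ mU.
    by rewrite !lfD !(prI _ _ _ h0) !(prI _ _ _ h1) /= addr0 add0r.
  apply: stable_homog => e x m hx mU.
  have hact c : act M x (pr c m) \in U b.
    apply/(inUh _ _ _ (act_homog hx (prh c m))).
    have ec : ev M (pr c m) = if b == c then pr c m else 0 by apply/(inUh _ _ _ (prh c m))/Upr.
    case: e hx => hx; rewrite ?(even_part_odd Luce Xrep _ hx) ?(even_part_even Luce Xrep _ hx) ec;
    by case: b {mU ec} c => [] [] /=; rewrite ?lf0 ?subrr ?subr0.
  by rewrite [m]prs lfD rpredD.
(* The projection onto [U b] along [U (~~ b)]: even weights are kept in degree b, odd weights in the
   other degree. *)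
pose q b m := ev M (pr b m) + (pr (~~ b) m - ev M (pr (~~ b) m)).
have qlin b : linear (q b).
  move=> a u v; rewrite /q !linearP /= !(even_part_linear s p (act M)).
  by apply: crd_inj => i; rewrite ?(crdD, crdN, crdZ); ring.
pose Q b : 'End(M) := linfun (HB.pack_for {linear M -> M} (q b)
  (GRing.isLinear.Build _ _ _ _ _ (qlin b))).
have QE b m : Q b m = q b m by rewrite lfunE.
have qU b m : q b m \in U b.
  apply: rpredD.
    apply/(inUh _ _ _ (even_part_homog (prh b m))); rewrite eqxx; exact: (even_part_idem Luce Xrep).
  apply/(inUh _ (~~ b)); first by apply: homogD; [apply: prh|apply: homogN; apply: even_part_homog; apply: prh].
  rewrite (even_partD s p) (even_partN s p) (even_part_idem Luce Xrep) subrr.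
  by case: b.
have q_id b m : m \in U b -> q b m = m.
  move=> mU; have e c := iffLR (inUh b c _ (prh c m)) (Upr b c m mU).
  by rewrite /q !e eqxx; case: b mU e => mU e; rewrite /= subr0 [RHS]prs // addrC.
have q_0 b m : m \in U (~~ b) -> q b m = 0.
  move=> mU; have e c := iffLR (inUh _ c _ (prh c m)) (Upr _ c m mU).
  by rewrite /q !e eqxx; case: b mU e => mU e; rewrite /= subrr addr0.
have q_sum m : q false m + q true m = m.
  rewrite /q /= [RHS]prs; apply: crd_inj => i; rewrite ?(crdD, crdN); ring.
(* Equivariance needs no computation: M is the sum of the stable subspaces [U b] and [U (~~ b)], and
   [Q b] is 1 on the one and 0 on the other. *)
have q_mor b : is_mor (Q b : 'Hom(M, M)).
  have qc : (forall x m, Q b (act M x m) = act M x (Q b m)).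
    move=> x m; rewrite !QE.
    have -> : act M x m = act M x (q b m) + act M x (q (~~ b) m).
      by rewrite -lfD; congr (act M x _); rewrite -[LHS]q_sum; case: b => //; rewrite addrC.
    have -> : q b (act M x (q b m) + act M x (q (~~ b) m)) =
      q b (act M x (q b m)) + q b (act M x (q (~~ b) m)) by rewrite -!QE lfD.
    by rewrite (q_id b _ (proj1 (gU b) x _ (qU b m))) (q_0 b _ (proj1 (gU _) x _ (qU _ m))) addr0.
  split=> // c m hm; rewrite QE /q !(prI _ _ _ hm).
  apply: homogD; first by apply: even_part_homog; case: ifP => // _; apply: homog0.
  apply: homogD; first by case: ifP => // _; apply: homog0.
  by apply: homogN; apply: even_part_homog; case: ifP => // _; apply: homog0.
pose Y b : ob C := sub_ob (gU b).
have [i0 ei0] := sub_incl (gU false); have [i1 ei1] := sub_incl (gU true).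
have pj b : exists g : hom C X (Y b), forall m, vsval (supermor_val g m) = q b m.
  pose g0 : 'Hom(M, subvs_of (U b)) := linfun (vsproj (U b) \o Q b).
  have g0E m : vsval (g0 m) = q b m by rewrite lfunE /= QE vsprojK.
  have [|g eg] := @mor_ex _ _ _ _ _ X (Y b) g0; last by exists g => m; rewrite eg g0E.
  have [qh qa] := q_mor b; split=> [c m hm|x m].
    by have := qh c m hm; rewrite QE -g0E.
  apply: val_inj; rewrite [LHS]g0E [RHS]sub_mod_actE g0E -!QE; exact: qa.
have [p0 ep0] := pj false; have [p1 ep1] := pj true.
have Ypar b : parity_ob b (Y b).
  move=> c u hu; apply: val_inj.
  have := iffLR (inUh b c _ hu) (subvsP u); rewrite eq_sym => e.
  have [i ei] := sub_incl (gU b); have := even_part_mor u (mor_mor i); rewrite !ei => e2.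
  rewrite [LHS]e2 [LHS]e; by case: ifP => _; rewrite ?linear0.
exists (Y false), (Y true); split=> //; exists i0, i1, p0, p1; split; apply: mor_eq => m.
- by rewrite morME mor1E; apply: val_inj; rewrite [LHS]ep0 ei0 q_id ?subvsP.
- by rewrite morME mor1E; apply: val_inj; rewrite [LHS]ep1 ei1 q_id ?subvsP.
- by rewrite morME mor0E; apply: val_inj; rewrite [LHS]ep0 ei1 q_0 ?subvsP ?linear0.
- by rewrite morME mor0E; apply: val_inj; rewrite [LHS]ep1 ei0 q_0 ?subvsP ?linear0.
- rewrite mor1E -[RHS]q_sum -ep0 -ep1 -ei0 -ei1 -!morME.
  by rewrite /= add_lfunE.
Qed.

Lemma parity_direct_sum b : direct_sum (parity_ob b) (parity_ob (~~ b)).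
Proof.
split=> [||X Y PX PY|S]; [exact: parity_replete|exact: parity_replete| |].
  by split=> f; [apply: parity_hom0 PX PY|apply: parity_hom0 PY _; rewrite negbK].
have [Y [Y' [PY PY' [i [j [u [v [e1 e2 e3 e4 e5]]]]]]]] := parity_split S.
case: b; last by exists Y, Y'; split=> //; exists i, j, u, v.
by exists Y', Y; split=> //; exists j, i, v, u; split=> //; rewrite addrC.
Qed.

End ParityDecomposition.

(** * Equivalence with polynomial modules *)

Section TypicalGeneration.
Variables (K : numClosedFieldType) (L : vectType K) (s : lieSuper L).
Variable p : {linear L -> psl22 K}.
Hypothesis Luce : universal_central_extension s (psl_lie K) p.
Variable chi : 'Hom(subvs_of (center s), K^o).
Implicit Types M N : supermod s.
Local Notation C := (mod1_chi p chi).
Local Notation ev M := (even_part s p (act M)).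
Local Notation FM M := (top_space s p (act M)).

(** In a module of definite parity, [even_part] is the projection on one degree and is given by the
    action, so it preserves every stable subspace. *)
Lemma parity_gstable b M (U : {vspace M}) : has_parity p b M ->
  (forall x m, m \in U -> act M x m \in U) -> gstable U.
Proof.
move=> PM st; split=> // m0 m1 h0 h1 mU.
have evU m : m \in U -> ev M m \in U.
  by move=> hm; rewrite /even_part rpredZ // rpredD ?rpredZ // rpredB ?rpredZ // /mx_act; do !apply: (st).
have := evU _ mU; rewrite (even_partD s p) (PM _ _ h0) (PM _ _ h1).
case: b {PM}; rewrite /= ?addr0 ?add0r => m'U; split=> //.
  by have := rpredB mU m'U; rewrite addrK.
by have := rpredB mU m'U; rewrite addrC addKr.
Qed.

Lemma parity_homogP b M c m : has_parity p b M ->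
  homog (mgrading M) c m <-> ev M m = if c == b then m else 0.
Proof.
move=> PM; split=> [/PM //|]; have [m0 [m1 [h0 h1 ->]]] := homog_dec (mgrading M) m.
rewrite (even_partD s p) (PM _ _ h0) (PM _ _ h1).
case: b c {PM} => [] [] /=; rewrite ?addr0 ?add0r.
- by move=> e; rewrite -e.
- by move=> ->; rewrite addr0.
- by move=> ->; rewrite add0r.
- by move=> e; rewrite -e.
Qed.

Hypothesis typ : typical_char p chi.
Variable X1 : ob C.
Hypothesis F1 : FM (sval X1) <> 0%VS.

Lemma gstable_top0 (X : ob C) (U : {vspace sval X}) : gstable U ->
  (forall u, u \in U -> u \in FM (sval X) -> u = 0) -> forall u, u \in U -> u = 0.
Proof.
move=> gU U0 u uU; have [i ei] := sub_incl gU.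
have /is_zeroP z : is_zero (sub_ob gU).
  apply: (top_space_zero typ F1); apply/eqP; rewrite -subv0; apply/subvP=> v vF.
  have := top_space_mor (mor_mor i) vF; rewrite ei => /(U0 _ (subvsP v)) e.
  by rewrite memv0; apply/eqP/val_inj.
by have := congr1 vsval (z (vsproj U u)); rewrite /= vsprojK.
Qed.

(** A highest weight vector of the quotient is fixed by [top_proj], which commutes with the quotient
    map; hence it comes from F(X), which lies in U, and vanishes. Then [top_space_zero] applies to
    the quotient. *)
Lemma gstable_top (X : ob C) (U : {vspace sval X}) : gstable U ->
  (forall u, u \in FM (sval X) -> u \in U) -> forall m, m \in U.
Proof.
move=> gU FU m; pose M := sval X.
have actq x v : act (sval (quo_ob gU)) x (quo_pi U v) = quo_pi U (act M x v).
  exact: quo_mod_actE.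
have /is_zeroP z : is_zero (quo_ob gU).
  apply: (top_space_zero typ F1); apply/eqP; rewrite -subv0; apply/subvP=> v vF.
  rewrite memv0; apply/eqP; rewrite -(top_proj_id vF).
  have [w ew] : exists w, quo_pi U w = v by exists (vsval v); apply: quo_piK.
  have -> : top_proj s p (act (sval (quo_ob gU))) v = quo_pi U (top_proj s p (act M) w).
    by rewrite -ew /top_proj /mx_act !actq -!linearZ -!linearD -!linearB -linearZ.
  apply/quo_pi_eq0/FU; exact: (top_projP Luce (mod1_rep (proj1 (proj2_sig X)))).
by apply/quo_pi_eq0; exact: z.
Qed.

Lemma mor_top0 (X Y : ob C) (f : hom C X Y) :
  (forall v, v \in FM (sval X) -> supermor_val f v = 0) -> f = 0.
Proof.
move=> f0; apply: mor_eq => m; rewrite mor0E; apply/eqP; rewrite -memv_ker.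
apply: gstable_top; first by split; [apply: ker_stable (mor_mor f)|apply: ker_graded (mor_mor f)].
by move=> v /f0; rewrite memv_ker => ->.
Qed.

(** * Extension of maps between highest weight spaces *)

Section Graph.
Variables (b : bool) (X Y : ob C).
Hypotheses (PX : parity_ob b X) (PY : parity_ob b Y).
Local Notation M := (sval X).
Local Notation N := (sval Y).
Variable T : 'Hom(M, N).
Hypothesis TF : forall v, v \in FM M -> T v \in FM N.
Hypothesis TZ : forall k v, v \in FM M ->
  T (z_act s p (act M) k v) = z_act s p (act N) k (T v).
Local Notation W := (M * N)%type.

Definition pair_act_fun (x : L) (w : W) : W := (act M x w.1, act N x w.2).

Lemma pair_act_fun_linear x : linear (pair_act_fun x).
Proof. by move=> a u v; rewrite /pair_act_fun /= !linearP. Qed.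

Definition pair_act_end (x : L) : 'End(W) := linfun (HB.pack_for {linear W -> W} (pair_act_fun x)
  (GRing.isLinear.Build _ _ _ _ _ (pair_act_fun_linear x))).

Lemma pair_actE x w : pair_act_end x w = (act M x w.1, act N x w.2).
Proof. by rewrite lfunE. Qed.

Lemma pair_act_linear : linear pair_act_end.
Proof.
move=> a x y; apply/lfunP=> w; rewrite add_lfunE scale_lfunE !pair_actE !linearP.
by rewrite !add_lfunE !scale_lfunE.
Qed.
HB.instance Definition _ := GRing.isLinear.Build K L 'End(W) _ pair_act_end pair_act_linear.

Local Notation rho := (pair_act_end : {linear L -> 'End(W)}).

Lemma pair_rep : is_rep s p rho.
Proof.
have [rM wM] := mod1_rep (proj1 (proj2_sig X)).
have [rN wN] := mod1_rep (proj1 (proj2_sig Y)).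
split=> [e e' x y m hx hy|c w w0].
  by rewrite /= !pair_actE /= (rM _ _ _ _ _ hx hy) (rN _ _ _ _ _ hx hy).
rewrite /= pair_actE => -[e1 e2].
have [z1|n1] := eqVneq w.1 0; last exact: wM n1 e1.
apply: wN e2; apply: contra w0 => /eqP z2; apply/eqP.
by rewrite [w]surjective_pairing z1 z2.
Qed.

Lemma pair_top w : w \in top_space s p rho <-> w.1 \in FM M /\ w.2 \in FM N.
Proof.
split=> [/top_spaceP|[/top_spaceP e1 /top_spaceP e2]]; last apply/top_spaceP.
  by rewrite /mx_act /= pair_actE => -[e1 e2]; split; apply/top_spaceP.
by rewrite /mx_act /= pair_actE /mx_act in e1 e2 *; rewrite e1 e2.
Qed.

Definition graph_fun (v : M) : W := (v, T v).

Lemma graph_fun_linear : linear graph_fun.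
Proof. by move=> a u v; rewrite /graph_fun linearP. Qed.

Definition graph : {vspace W} := (linfun (HB.pack_for {linear M -> W} graph_fun
  (GRing.isLinear.Build _ _ _ _ _ graph_fun_linear)) @: FM M)%VS.

Lemma graphP w : w \in graph <-> w.1 \in FM M /\ w.2 = T w.1.
Proof.
split=> [/memv_imgP[v vF ->]|[h e]]; first by rewrite lfunE.
by rewrite [w]surjective_pairing e; apply/memv_imgP; exists w.1; rewrite ?lfunE.
Qed.

Lemma graph_top : (graph <= top_space s p rho)%VS.
Proof. by apply/subvP=> w /graphP[h e]; apply/pair_top; rewrite e; split=> //; apply: TF. Qed.

Lemma graph_Z k w : w \in graph -> z_act s p rho k w \in graph.
Proof.
move=> /graphP[h e]; apply/graphP; rewrite /z_act /= pair_actE /= e; split; last exact/esym/TZ.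
by apply/top_spaceP; rewrite /mx_act -(z_act_comm Luce (mod1_rep (proj1 (proj2_sig X)))) (elimT (top_spaceP _ _ _ _) h) linearZ.
Qed.

Let G := gen s p rho graph.
Let G_st x w : w \in G -> rho x w \in G. Proof. exact: (gen_stable Luce pair_rep graph_top graph_Z). Qed.
Let G_gr w : w \in graph -> w \in G. Proof. exact: N_gen. Qed.
Let G_F w : w \in G -> w \in top_space s p rho -> w \in graph.
Proof. exact: (gen_top Luce pair_rep graph_top graph_Z). Qed.

Lemma inr_linear : linear (fun n : N => (0, n) : W).
Proof. by move=> a u v; congr (_, _); rewrite /= scaler0 addr0. Qed.

Lemma fst_linear : linear (fun w : W => w.1).
Proof. by []. Qed.

(** The n with (0, n) in G form a submodule of Y. By [gen_top] its highest weight vectors lie on the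
    graph of T over 0, so they vanish and [gstable_top0] applies. *)
Lemma G_inj n : (0, n) \in G -> n = 0.
Proof.
pose i2 : 'Hom(N, W) := linfun (HB.pack_for {linear N -> W} (fun n : N => (0, n) : W)
  (GRing.isLinear.Build K N W _ (fun n : N => (0, n) : W) inr_linear)).
have i2E v : i2 v = (0, v) by rewrite lfunE.
rewrite -i2E memv_preim; apply: gstable_top0.
  apply: (parity_gstable PY) => x v; rewrite -!memv_preim !i2E => /(G_st x).
  by rewrite /= pair_actE /= linear0.
move=> u; rewrite -memv_preim i2E => uG uF.
have /graphP[_ /= ->] : (0, u) \in graph.
  by apply: G_F => //; apply/pair_top; split; rewrite ?mem0v.
by rewrite linear0.
Qed.

(** The first projection of G is a submodule of X that contains F(X). *)
Lemma G_surj m : exists n, (m, n) \in G.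
Proof.
pose f1 : 'Hom(W, M) := linfun (HB.pack_for {linear W -> M} (fun w : W => w.1)
  (GRing.isLinear.Build K W M _ (fun w : W => w.1) fst_linear)).
have f1E w : f1 w = w.1 by rewrite lfunE.
have /memv_imgP[[m1 n] wG e] : m \in (f1 @: G)%VS.
  apply: gstable_top => [|v vF].
    apply: (parity_gstable PX) => x _ /memv_imgP[w wG ->]; rewrite f1E.
    have := memv_img f1 (G_st x wG); by rewrite f1E /= pair_actE.
  have -> : v = f1 (graph_fun v) by rewrite f1E.
  by apply/memv_img/G_gr/graphP.
by exists n; rewrite e f1E.
Qed.

(** G is the graph of an equivariant linear map. It commutes with [even_part], which determines the
    grading on both sides since X and Y have the same parity, so it is homogeneous. *)
Lemma parity_full : exists f : hom C X Y, forall v, v \in FM M -> supermor_val f v = T v.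
Proof.
pose g m := projT1 (cid (G_surj m)).
have gG m : (m, g m) \in G := projT2 (cid (G_surj m)).
have g_uniq m n : (m, n) \in G -> n = g m.
  move=> h; apply/eqP; rewrite -subr_eq0; apply/eqP/G_inj.
  by have := rpredB h (gG m); rewrite -[_ - _]/(m - m, n - g m) subrr.
have glin : linear g.
  move=> a u v; apply/esym/g_uniq.
  by have := rpredD (rpredZ a (gG u)) (gG v).
pose g0 : 'Hom(M, N) := linfun (HB.pack_for {linear M -> N} g (GRing.isLinear.Build _ _ _ _ _ glin)).
have g0E m : g0 m = g m by rewrite lfunE.
have gact x m : g0 (act M x m) = act N x (g0 m).
  by rewrite !g0E; apply/esym/g_uniq; have := G_st x (gG m); rewrite /= pair_actE.
have gev m : g0 (ev M m) = ev N (g0 m).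
  by rewrite /even_part /mx_act ?(lfD, lfN, lfZ, gact).
have [|f ef] := @mor_ex _ _ _ _ _ X Y g0.
  split=> // c m /PX e; apply/(parity_homogP _ _ PY); rewrite -gev e.
  by case: ifP; rewrite ?lf0.
exists f => v vF; rewrite ef g0E; apply/esym/g_uniq/G_gr/graphP.
by [].
Qed.

End Graph.
End TypicalGeneration.

Lemma ff_es_indecomposable (K : fieldType) (C D : linCat K) (F : functor C D) (k : ob D) :
  (forall X Y (f g : hom C X Y), fhom F X Y f = fhom F X Y g -> f = g) ->
  (forall X Y (u : hom D (fob F X) (fob F Y)), exists f, fhom F X Y f = u) ->
  (forall N, exists X, isomorphic (fob F X) N) ->
  ~ is_zero k -> (forall f : hom D k k, exists a, f = a *: idm D k) ->
  (forall X, ~ is_zero X -> exists f : hom D k X, f <> 0) ->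
  indecomposable C.
Proof.
move=> faith full es k0 endk homk; have [k' [f [g [gf fg]]]] := es k.
apply: (@indecomposable_by K C k').
- move=> z; apply: k0; rewrite /is_zero -fg -[g]cmp1l -fhom1.
  by rewrite z linear0 cmp0l cmp0r.
- move=> u; have [a ea] := endk (cmp f (cmp (fhom F k' k' u) g)); exists a.
  apply: faith; rewrite linearZ /= fhom1 -gf.
  rewrite -[LHS]cmp1l -[LHS]cmp1r -gf -!cmpA [cmp f (cmp _ (cmp g f))](_ : _ = cmp (a *: idm D k) f).
    by rewrite cmpZl cmp1l cmpZr.
  by rewrite -ea !cmpA.
- move=> X X0; have [|u u0] := homk (fob F X).
    by move=> z; apply: X0; apply: faith; rewrite fhom1 linear0.
  have [v ev] := full k' X (cmp u f); exists v => v0; apply: u0.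
  by rewrite -[u]cmp1r -fg cmpA -ev v0 linear0 cmp0l.
Qed.

Section LinearFunctor.
Variables (K : fieldType) (C D : linCat K) (o : ob C -> ob D).
Variable h : forall X Y, hom C X Y -> hom D (o X) (o Y).
Hypothesis h_linear : forall X Y, linear (@h X Y).
Hypothesis h1 : forall X, h (idm C X) = idm D (o X).
Hypothesis hM : forall X Y T (f : hom C Y T) (g : hom C X Y), h (cmp f g) = cmp (h f) (h g).

Definition linear_functor : functor C D :=
  @Functor K C D o (fun X Y => HB.pack_for {linear hom C X Y -> hom D (o X) (o Y)} (@h X Y)
    (GRing.isLinear.Build K (hom C X Y) (hom D (o X) (o Y)) _ (@h X Y) (@h_linear X Y))) h1 hM.

Variable P : ob C -> Prop.
Hypothesis faith : forall X Y (f g : hom C X Y), h f = h g -> f = g.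
(** Fullness is asked only inside P: objects of opposite parities have no nonzero morphisms, whereas
    their ungraded highest weight spaces may have some. *)
Hypothesis full : forall X Y, P X -> P Y -> forall u : hom D (o X) (o Y), exists f, h f = u.
Hypothesis es : forall N, exists X, P X /\ isomorphic (o X) N.

Definition functor_sub : functor (full_sub P) D :=
  @Functor K (full_sub P) D (fun X => o (sval X))
    (fun X Y => fhom linear_functor (sval X) (sval Y)) (fun X => h1 (sval X))
    (fun X Y Z f g => hM f g).

Lemma full_sub_equivalent : equivalent (full_sub P) D.
Proof.
apply: (@ff_es_equivalent K _ _ functor_sub) => [X Y f g|X Y u|N].
- exact: faith.
- exact: full (proj2_sig X) (proj2_sig Y) u.
- by have [X [PX iso]] := es N; exists (exist _ X PX).
Qed.

Lemma full_sub_indecomposable (k : ob D) : ~ is_zero k ->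
  (forall f : hom D k k, exists a, f = a *: idm D k) ->
  (forall X, ~ is_zero X -> exists f : hom D k X, f <> 0) ->
  indecomposable (full_sub P).
Proof.
apply: (@ff_es_indecomposable K _ _ functor_sub) => [X Y f g|X Y u|N].
- exact: faith.
- exact: full (proj2_sig X) (proj2_sig Y) u.
- by have [X [PX iso]] := es N; exists (exist _ X PX).
Qed.

End LinearFunctor.

(** * The functor to polynomial modules *)

Section RestrictionFunctor.
Variables (K : numClosedFieldType) (L : vectType K) (s : lieSuper L).
Variable p : {linear L -> psl22 K}.
Hypothesis Luce : universal_central_extension s (psl_lie K) p.
Variable chi : 'Hom(subvs_of (center s), K^o).
Implicit Types M N : supermod s.
Local Notation C := (mod1_chi p chi).
Local Notation FM M := (top_space s p (act M)).
Local Notation chi_k k := (chi_at chi (zc s p k)).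
Local Notation Z M := (z_act s p (act M)).

Definition var_act M (k : 'I_3) : 'End(subvs_of (FM M)) :=
  linfun (vsproj (FM M) \o (Z M k - chi_k k *: \1%VF) \o vsval).

Lemma z_act_top M k v : in_mod1 p M -> v \in FM M -> Z M k v \in FM M.
Proof.
move=> /mod1_rep Mrep /top_spaceP e; apply/top_spaceP.
by rewrite /mx_act -(z_act_comm Luce Mrep) -/(mx_act _ _ _ _) e lfZ.
Qed.

Lemma var_actE M k v : in_mod1 p M ->
  vsval (var_act M k v) = Z M k (vsval v) - chi_k k *: vsval v.
Proof.
move=> M1; rewrite lfunE /= vsprojK add_lfunE opp_lfunE scale_lfunE id_lfunE //.
by apply: rpredB; [apply: z_act_top (subvsP v)|apply: rpredZ (subvsP v)].
Qed.

Lemma var_act_comm M (M1 : in_mod1 p M) i j v :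
  var_act M i (var_act M j v) = var_act M j (var_act M i v).
Proof.
apply: val_inj; rewrite /= !var_actE // !lfD !lfN !lfZ.
have -> : Z M i (Z M j (vsval v)) = Z M j (Z M i (vsval v)).
  exact: (z_act_comm Luce (mod1_rep M1)).
by apply: crd_inj => l; rewrite ?(crdD, crdN, crdZ); ring.
Qed.

Definition top_mod M (M1 : in_mod1 p M) : algmod (mpoly 3 K) :=
  poly_mod (var_act_comm M1).

Lemma top_modX M (M1 : in_mod1 p M) i (v : top_mod M1) :
  aact (top_mod M1) (mpolyX K (mnm1 i)) v = var_act M i v.
Proof. exact: poly_act_X. Qed.

Lemma top_mod_nilp M (M1 : in_mod1 p M) : has_gen_char chi M ->
  forall i : 'I_3, nilpotent_lfun (aact (top_mod M1) (mpolyX K (mnm1 i))).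
Proof.
move=> Mc i; have := Mc (vsproj (center s) (zc s p i)); rewrite vsprojK ?zc_center //.
apply: (nilpotent_sub (i := vsval)) => [w||]; [|exact: subvs_inj|exact: linear0].
by rewrite top_modX var_actE // add_lfunE opp_lfunE scale_lfunE id_lfunE.
Qed.

Definition top_ob (X : ob C) : ob (nilpPolyCat K) :=
  exist _ (top_mod (proj1 (proj2_sig X))) (top_mod_nilp _ (proj2 (proj2_sig X))).

Definition top_hom_fun (X Y : ob C) (f : hom C X Y) :
    'Hom(subvs_of (FM (sval X)), subvs_of (FM (sval Y))) :=
  linfun (vsproj (FM (sval Y)) \o supermor_val f \o vsval).

Lemma top_hom_funE (X Y : ob C) (f : hom C X Y) v :
  vsval (top_hom_fun f v) = supermor_val f (vsval v).
Proof. by rewrite lfunE /= vsprojK // (top_space_mor (mor_mor f) (subvsP v)). Qed.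

Lemma top_hom_mor (X Y : ob C) (f : hom C X Y) :
  top_hom_fun f \in @algmor_pred K (mpoly 3 K) (sval (top_ob X)) (sval (top_ob Y)).
Proof.
apply/asboolP; apply: poly_mor_ex => i v; apply: val_inj.
have [X1 Y1] := (proj1 (proj2_sig X), proj1 (proj2_sig Y)).
rewrite [in LHS]top_modX [in RHS]top_modX [LHS]top_hom_funE [RHS]var_actE // var_actE //.
by rewrite top_hom_funE lfD lfN lfZ /z_act (proj2 (mor_mor f)).
Qed.

Definition top_hom (X Y : ob C) (f : hom C X Y) : hom (nilpPolyCat K) (top_ob X) (top_ob Y) :=
  Algmor (top_hom_mor f).

Lemma algmor_eq (A : algType K) (M N : algmod A) (f g : algmor M N) :
  (forall v, algmor_val f v = algmor_val g v) -> f = g.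
Proof. by move=> h; apply/val_inj/lfunP. Qed.

Lemma top_hom_linear (X Y : ob C) : linear (@top_hom X Y).
Proof.
move=> a f g; apply: algmor_eq => v; apply: val_inj.
rewrite [LHS]top_hom_funE /= !(add_lfunE, scale_lfunE) linearP /=.
by congr (_ *: _ + _); apply/esym/top_hom_funE.
Qed.

Lemma top_hom1 (X : ob C) : top_hom (idm C X) = idm (nilpPolyCat K) (top_ob X).
Proof.
apply: algmor_eq => v; apply: val_inj.
by rewrite [LHS]top_hom_funE mor1E [RHS](_ : _ = vsval v) // id_lfunE.
Qed.

Lemma top_homM (X Y T : ob C) (f : hom C Y T) (g : hom C X Y) :
  top_hom (cmp f g) = cmp (top_hom f) (top_hom g).
Proof.
apply: algmor_eq => v; apply: val_inj; rewrite [LHS]top_hom_funE morME.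
have -> : algmor_val (cmp (top_hom f) (top_hom g)) v = top_hom_fun f (top_hom_fun g v).
  exact: comp_lfunE.
by rewrite [RHS]top_hom_funE top_hom_funE.
Qed.

End RestrictionFunctor.

Section TopProperties.
Variables (K : numClosedFieldType) (L : vectType K) (s : lieSuper L).
Variable p : {linear L -> psl22 K}.
Hypothesis Luce : universal_central_extension s (psl_lie K) p.
Variable chi : 'Hom(subvs_of (center s), K^o).
Implicit Types M N : supermod s.
Local Notation C := (mod1_chi p chi).
Local Notation FM M := (top_space s p (act M)).
Local Notation chi_k k := (chi_at chi (zc s p k)).
Local Notation Z M := (z_act s p (act M)).
Local Notation D := (nilpPolyCat K).
Local Notation var k := (mpolyX K (mnm1 (k : 'I_3))).

Lemma poly_hom_ex (M N : ob D) (f : 'Hom(asp (sval M), asp (sval N))) :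
  (forall k v, f (aact (sval M) (var k) v) = aact (sval N) (var k) (f v)) ->
  exists g : hom D M N, forall v, algmor_val g v = f v.
Proof.
move=> h; have fP : f \in @algmor_pred K (mpoly 3 K) (sval M) (sval N).
  by apply/asboolP; apply: poly_mor_ex.
by exists (Algmor fP).
Qed.

Lemma top_iso (X : ob C) (N : ob D) (e : 'Hom(asp (sval N), sval X))
    (e' : 'Hom(sval X, asp (sval N))) :
  (forall n, e n \in FM (sval X)) -> (forall n, e' (e n) = n) ->
  (forall v, v \in FM (sval X) -> e (e' v) = v) ->
  (forall k v, v \in FM (sval X) ->
    e' (Z (sval X) k v) = aact (sval N) (var k) (e' v) + chi_k k *: e' v) ->
  isomorphic (top_ob Luce X) N.
Proof.
move=> eF e'e ee' eZ; have X1 := proj1 (proj2_sig X).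
pose f0 : 'Hom(asp (sval (top_ob Luce X)), asp (sval N)) :=
  linfun (e' \o (vsval : subvs_of (FM (sval X)) -> sval X)).
pose g0 : 'Hom(asp (sval N), asp (sval (top_ob Luce X))) := linfun (vsproj (FM (sval X)) \o e).
have f0E v : f0 v = e' (vsval v) by rewrite lfunE.
have g0E n : vsval (g0 n) = e n by rewrite lfunE /= vsprojK.
have f0a k v : f0 (aact (sval (top_ob Luce X)) (var k) v) = aact (sval N) (var k) (f0 v).
  rewrite !f0E [aact (sval (top_ob Luce X)) _ v]top_modX var_actE //.
  by rewrite lfD lfN lfZ eZ ?subvsP // addrK.
have fg v : g0 (f0 v) = v by apply: val_inj; rewrite [LHS]g0E f0E ee' // subvsP.
have gf n : f0 (g0 n) = n by rewrite f0E g0E.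
have g0a k n : g0 (aact (sval N) (var k) n) = aact (sval (top_ob Luce X)) (var k) (g0 n).
  by rewrite -[RHS]fg f0a gf.
have [f fE] := poly_hom_ex f0a; have [g gE] := poly_hom_ex g0a.
exists f, g; split; apply: algmor_eq => v.
  transitivity (algmor_val g (algmor_val f v)); first exact: comp_lfunE.
  by rewrite fE gE fg; symmetry; apply: id_lfunE.
transitivity (algmor_val f (algmor_val g v)); first exact: comp_lfunE.
by rewrite gE fE gf; symmetry; apply: id_lfunE.
Qed.

Hypothesis chi_ss : semisimple_char p chi.

Lemma top_es (b : bool) (N : ob D) :
  exists X : ob C, parity_ob b X /\ isomorphic (top_ob Luce X) N.
Proof.
pose iota : {rmorphism K -> mpoly 3 K} := @mpolyC 3 K.
have iotaE a : iota a = a%:A by rewrite [RHS]alg_mpolyC.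
have Nn k : nilp (sval N) (var k) by apply/nilpP; exact: (proj2_sig N k).
have sp k : spec (sval N) iota (var k + iota (chi_k k)) (chi_k k).
  by rewrite /spec addrK.
(* The prescribed central operators are [var k] plus the value of chi, with this value as only
   eigenvalue; their discriminant is [discr], which is nonzero by [chi_ss]. *)
have [a [b1 [c [d [a' [b' [c' [d' [det1 det1' zE]]]]]]]]] :=
  sl2_pair (sp k0) (sp k1) (sp k2) chi_ss.
have XE k : aact (sval N) (tens_z a b1 c d a' b' c' d' k) =
    aact (sval N) (var k + iota (chi_k k)).
  by rewrite zE; elim/I3_ind: k.
pose M := kac Luce (sval N) iotaE det1 det1'.
have M1 : in_mod1 p M by apply: kac_mod1.
have Mc : has_gen_char chi M by apply: kac_gen_char; [exact: XE|exact: Nn].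
have Mp : has_parity p false M by apply: kac_parity.
pose e_fun (n : asp (sval N)) : M := [ffun k => if k == top_index then n else 0].
have e_lin : linear e_fun.
  move=> u m n; apply/ffunP=> k; rewrite !ffunE; case: ifP => // _.
  by rewrite scaler0 addr0.
pose e : 'Hom(asp (sval N), M) := linfun (HB.pack_for {linear asp (sval N) -> M} e_fun
  (GRing.isLinear.Build _ _ _ _ _ e_lin)).
pose e'_fun (w : M) : asp (sval N) := w top_index.
have e'_lin : linear e'_fun by move=> u m n; rewrite /e'_fun !ffunE.
pose e' : 'Hom(M, asp (sval N)) := linfun (HB.pack_for {linear M -> asp (sval N)} e'_fun
  (GRing.isLinear.Build _ _ _ _ _ e'_lin)).
have eE n k : e n k = if k == top_index then n else 0 by rewrite lfunE ffunE.
have e'E w : e' w = w top_index by rewrite lfunE.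
have eF n : e n \in FM M by apply/kac_top => k nk; rewrite eE (negbTE nk).
have e'e n : e' (e n) = n by rewrite e'E eE eqxx.
have ee' v : v \in FM M -> e (e' v) = v.
  move=> /kac_top h; apply/ffunP=> k; rewrite eE e'E.
  by case: eqP => [->//|/eqP /h ->].
have eZ k v : v \in FM M -> e' (Z M k v) = aact (sval N) (var k) (e' v) + chi_k k *: e' v.
  by move=> _; rewrite !e'E [LHS]kac_zc XE linearD add_lfunE (aact_alg iotaE).
(* The constructed module has even weights in degree [false]; for [true], its parity shift has the
   same action and hence the same F. *)
case: b.
  pose X : ob C := exist _ (op_mod M) (conj M1 Mc).
  exists X; split; last exact: (@top_iso X N e e' eF e'e ee' eZ).
  by move=> x m /Mp; case: x.
pose X : ob C := exist _ M (conj M1 Mc).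
by exists X; split=> //; exact: (@top_iso X N e e' eF e'e ee' eZ).
Qed.

End TopProperties.

Section TrivialPolyModule.
Variable K : numClosedFieldType.
Local Notation D := (nilpPolyCat K).
Local Notation var k := (mpolyX K (mnm1 (k : 'I_3))).

Let u0 (_ : 'I_3) : 'End(K^o) := 0.
Let u0E i v : u0 i v = 0. Proof. by rewrite [u0 i]/(0 : 'End(K^o)) lfunE. Qed.
Let u0C i j v : u0 i (u0 j v) = u0 j (u0 i v). Proof. by rewrite !u0E. Qed.

Let triv_nilp i : nilpotent_lfun (aact (poly_mod u0C) (var i)).
Proof. by exists 1%N => v /=; rewrite [LHS]poly_act_X u0E. Qed.

Definition triv_ob : ob D := exist _ (poly_mod u0C) triv_nilp.

Lemma triv_ob_nonzero : ~ is_zero triv_ob.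
Proof.
move=> /(congr1 (fun f : hom D triv_ob triv_ob => algmor_val f (1 : K^o))).
by rewrite [LHS]id_lfunE [RHS]lfunE => /eqP; rewrite oner_eq0.
Qed.

Lemma triv_ob_end (f : hom D triv_ob triv_ob) : exists a, f = a *: idm D triv_ob.
Proof.
pose f0 : 'Hom(K^o, K^o) := algmor_val f.
have fE (v : K^o) : f0 v = f0 1 *: v.
  by rewrite -[v in LHS]mulr1 -[v * 1]/(v *: (1 : K^o)) lfZ; exact: mulrC.
have idE (a : K) v : algmor_val (a *: idm D triv_ob) v = a *: v.
  by transitivity ((a *: \1%VF : 'Hom(K^o, K^o)) v); [|rewrite scale_lfunE id_lfunE].
by exists (f0 1); apply: algmor_eq => v; rewrite idE; exact: fE.
Qed.

(* The commuting nilpotent variables have a common kernel vector. *)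
Lemma triv_ob_hom (X : ob D) : ~ is_zero X -> exists f : hom D triv_ob X, f <> 0.
Proof.
move=> X0; pose V := asp (sval X).
have step k (U : {vspace V}) : U != 0%VS -> (forall i v, v \in U -> aact (sval X) (var i) v \in U) ->
    exists2 U' : {vspace V}, U' != 0%VS & (forall v, v \in U' -> v \in U) /\
      (forall i v, v \in U' -> aact (sval X) (var i) v \in U') /\
      (forall v, v \in U' -> aact (sval X) (var k) v = 0).
  move=> U0 stU; have [a [v [vU v0 e]]] := eigen_ex U0 (stU k).
  have a0 : a = 0.
    have [n hn] := proj2_sig X k.
    have ei : iter n (aact (sval X) (var k)) v = a ^+ n *: v.
      elim: n {hn} => [|n IH]; first by rewrite scale1r.
      by rewrite iterS IH lfZ e scalerA -exprSr.
    by have := hn v; rewrite ei => /eqP; rewrite scaler_eq0 (negbTE v0) orbF expf_eq0 => /andP[_ /eqP].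
  exists (U :&: lker (aact (sval X) (var k)))%VS.
    apply/eqP=> z; have : v \in (U :&: lker (aact (sval X) (var k)))%VS.
      by rewrite memv_cap vU memv_ker e a0 scale0r /=.
    by rewrite z memv0 (negbTE v0).
  split; first by move=> w; rewrite memv_cap => /andP[].
  split=> [i w|w]; rewrite memv_cap memv_ker => /andP[wU /eqP w0] //.
  rewrite memv_cap stU //= memv_ker -comp_lfunE -aactM mulrC aactM comp_lfunE w0 lf0.
  exact: eqxx.
have V0 : (fullv : {vspace V}) != 0%VS.
  apply/eqP=> z; apply: X0; apply: algmor_eq => v.
  have e (w : V) : w = 0 by apply/eqP; rewrite -memv0 -z memvf.
  by rewrite [LHS]e [RHS]e.
have [|U1 U10 [_ [st1 k1']]] := step k0 _ V0; first by move=> *; apply: memvf.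
have [U2 U20 [s2 [st2 k2']]] := step k1 _ U10 st1.
have [U3 U30 [s3 [st3 k3']]] := step k2 _ U20 st2.
pose v := vpick U3; have vU : v \in U3 := memv_pick U3.
have v0 : v != 0 by rewrite vpick0.
have kv k : aact (sval X) (var k) v = 0.
  by elim/I3_ind: k; [apply/k1'/s2/s3|apply/k2'/s3|apply/k3'].
have lin : linear (fun a : K^o => a *: v) by move=> a b c; rewrite scalerDl scalerA.
pose f0 : 'Hom(asp (sval triv_ob), V) := linfun (HB.pack_for {linear K^o -> V} (fun a : K^o => a *: v)
  (GRing.isLinear.Build _ _ _ _ _ lin)).
have f0E a : f0 a = (a : K) *: v by rewrite lfunE.
have [|f fE] := @poly_hom_ex K triv_ob X f0.
  move=> k a; rewrite !f0E lfZ kv scaler0.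
  have -> : aact (sval triv_ob) (var k) a = 0 by rewrite [LHS]poly_act_X u0E.
  by rewrite scale0r.
exists f => fz; have := fE (1 : K^o); rewrite f0E scale1r fz => e.
by move: v0; rewrite -e [algmor_val _ _]lfunE eqxx.
Qed.

End TrivialPolyModule.

Lemma algmor_act (K : fieldType) (A : algType K) (M N : algmod A) (f : algmor M N) g v :
  algmor_val f (aact M g v) = aact N g (algmor_val f v).
Proof. by case: f => f fP /=; have /asboolP h := fP; exact: h. Qed.

(** * The two blocks *)

Section Blocks.
Variables (K : numClosedFieldType) (L : vectType K) (s : lieSuper L).
Variable p : {linear L -> psl22 K}.
Hypothesis Luce : universal_central_extension s (psl_lie K) p.
Variable chi : 'Hom(subvs_of (center s), K^o).
Hypotheses (typ : typical_char p chi) (chi_ss : semisimple_char p chi).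
Local Notation C := (mod1_chi p chi).
Local Notation FM M := (top_space s p (act M)).

(** Essential surjectivity provides an object over the trivial module; it serves as the [X1]
    required by the arguments from typicality. *)
Lemma top_nonzero : exists X : ob C, FM (sval X) <> 0%VS.
Proof.
have [X [_ [f [g [_ fg]]]]] := top_es Luce chi_ss false (triv_ob K).
exists X => F0; apply: (@triv_ob_nonzero K); rewrite /is_zero -fg.
suff -> : g = 0 by rewrite cmp0r.
apply: algmor_eq => v; apply: val_inj; apply/eqP.
have z (w : subvs_of (FM (sval X))) : vsval w == 0 by rewrite -memv0 -F0 subvsP.
have e : vsval (algmor_val g v) = 0 by apply/eqP/z.
by rewrite [X in X == _]e [X in _ == X](eqP (z _)).
Qed.

Lemma top_faithful (X Y : ob C) (f g : hom C X Y) :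
  top_hom Luce f = top_hom Luce g -> f = g.
Proof.
move=> e; have [X1 F1] := top_nonzero; apply/eqP; rewrite -subr_eq0; apply/eqP.
apply: (mor_top0 Luce typ F1) => v vF.
have e2 : top_hom_fun f = top_hom_fun g :=
  congr1 (fun h : hom (nilpPolyCat K) (top_ob Luce X) (top_ob Luce Y) => algmor_val h) e.
have e' : supermor_val f v = supermor_val g v.
  by have := top_hom_funE f (vsproj (FM (sval X)) v); rewrite e2 top_hom_funE vsprojK.
transitivity ((supermor_val f - supermor_val g)%R v); first by [].
by rewrite add_lfunE opp_lfunE e' subrr.
Qed.

Lemma top_hom_var (X Y : ob C) (u : hom (nilpPolyCat K) (top_ob Luce X) (top_ob Luce Y))
    (u0 : 'Hom(subvs_of (FM (sval X)), subvs_of (FM (sval Y)))) :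
  (forall v, u0 v = algmor_val u v) ->
  forall k v, u0 (@var_act K L s p chi (sval X) k v) = @var_act K L s p chi (sval Y) k (u0 v).
Proof.
move=> e k v; rewrite !e.
transitivity (algmor_val u (aact (sval (top_ob Luce X)) (mpolyX K (mnm1 k)) v)).
  by congr (algmor_val u _); apply/esym/top_modX.
transitivity (aact (sval (top_ob Luce Y)) (mpolyX K (mnm1 k)) (algmor_val u v)).
  exact: (@algmor_act K (mpoly 3 K) (sval (top_ob Luce X)) (sval (top_ob Luce Y)) u).
exact: top_modX.
Qed.

Lemma top_full b (X Y : ob C) (u : hom (nilpPolyCat K) (top_ob Luce X) (top_ob Luce Y)) :
  parity_ob b X -> parity_ob b Y -> exists f, top_hom Luce f = u.
Proof.
move=> PX PY; have [X1 F1] := top_nonzero.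
have [M1 N1] := (proj1 (proj2_sig X), proj1 (proj2_sig Y)).
pose u0 : 'Hom(subvs_of (FM (sval X)), subvs_of (FM (sval Y))) := algmor_val u.
(* [vsproj] merely extends the given map to all of X, as [parity_full] expects; only its values on
   F(X) matter. *)
pose T : 'Hom(sval X, sval Y) := linfun ((vsval : subvs_of (FM (sval Y)) -> sval Y) \o
  u0 \o vsproj (FM (sval X))).
have TE v : T v = vsval (u0 (vsproj (FM (sval X)) v)) by rewrite lfunE.
have TF v : v \in FM (sval X) -> T v \in FM (sval Y) by move=> _; rewrite TE subvsP.
have TZ k v : v \in FM (sval X) ->
    T (z_act s p (act (sval X)) k v) = z_act s p (act (sval Y)) k (T v).
  move=> vF; have /(congr1 vsval) := top_hom_var (u := u) (fun _ => erefl : u0 _ = _) k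
    (vsproj (FM (sval X)) v).
  rewrite [RHS]var_actE // -TE => e.
  have : T (z_act s p (act (sval X)) k v - chi_at chi (zc s p k) *: v) =
      z_act s p (act (sval Y)) k (T v) - chi_at chi (zc s p k) *: T v.
    rewrite -e [in LHS]TE; congr (vsval (u0 _)); apply: val_inj.
    rewrite [RHS]var_actE // /= !vsprojK //.
    by apply: rpredB; [apply: z_act_top|apply: rpredZ].
  by rewrite lfD lfN lfZ => /addIr.
have [f fE] := parity_full Luce typ F1 PX PY TF TZ; exists f.
apply: algmor_eq => v; apply: val_inj; rewrite [LHS]top_hom_funE fE ?subvsP //.
by rewrite TE; congr (vsval (u0 _)); apply: val_inj; rewrite /= vsprojK ?subvsP.
Qed.

Local Notation Pb b := (@parity_ob K L s p chi b).

Lemma parity_equivalent b : equivalent (full_sub (Pb b)) (nilpPolyCat K).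
Proof.
exact: (@full_sub_equivalent K C (nilpPolyCat K) (@top_ob K L s p Luce chi)
  (@top_hom K L s p Luce chi) (@top_hom_linear K L s p Luce chi) (@top_hom1 K L s p Luce chi)
  (@top_homM K L s p Luce chi) (Pb b) top_faithful
  (fun X Y PX PY u => top_full u PX PY) (top_es Luce chi_ss b)).
Qed.

Lemma parity_block b : is_block (Pb b).
Proof.
split; first by exists (Pb (~~ b)); apply: parity_direct_sum.
exact: (@full_sub_indecomposable K C (nilpPolyCat K) (@top_ob K L s p Luce chi)
  (@top_hom K L s p Luce chi) (@top_hom_linear K L s p Luce chi) (@top_hom1 K L s p Luce chi)
  (@top_homM K L s p Luce chi) (Pb b) top_faithful
  (fun X Y PX PY u => top_full u PX PY) (top_es Luce chi_ss b) (triv_ob K)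
  (@triv_ob_nonzero K) (@triv_ob_end K) (@triv_ob_hom K)).
Qed.

End Blocks.

Theorem theorem6p10 (R : realType) (L : vectType R[i]) (s : lieSuper L)
    (p : {linear L -> psl22 R[i]})
    (Luce : universal_central_extension s (psl_lie R[i]) p)
    (chi : 'Hom(subvs_of (center s), (R[i])^o)) :
  typical_char p chi -> semisimple_char p chi ->
  exists P Q : ob (mod1_chi p chi) -> Prop,
    [/\ direct_sum P Q, is_block P, is_block Q,
        equivalent (full_sub P) (nilpPolyCat R[i])
      & equivalent (full_sub Q) (nilpPolyCat R[i])].
Proof.
move=> typ ss; exists (@parity_ob _ _ s p chi false), (@parity_ob _ _ s p chi true).
split; [exact: (parity_direct_sum Luce chi false)|exact: parity_block|exact: parity_block
       |exact: parity_equivalent|exact: parity_equivalent].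
Qed.
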